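(* Let $A=\sum_{n\ge0}A_n^{FC}(q)x^n$, $B=\sum_{n\ge0}B_n^{FC}(q)x^n$, $D=\sum_{n\ge0}D_{n+1}^{FC}(q)x^n$. Let $$J(x)=\sum_{n\ge0}\frac{(-x)^nq^{\binom n2}}{(q;q)_n(xq;q)_n},\qquad K(x)=\sum_{n\ge0}\frac{x^nq^{\binom{n+1}2}}{(xq;q)_n}\sum_{k=0}^n\frac{(-1)^k}{(q;q)_k}.$$ Then $$A=\frac1{1-xq}\frac{J(xq)}{J(x)},\qquad B=\frac{K(x)}{J(x)}+\frac{xq^2(1-x)}{(1-xq)(1-xq^2)}\frac{J(xq)}{J(x)}-\frac{xq^2}{1-xq^2},$$ $$D=\frac{2K(x)}{J(x)}+\frac{q-(1+q)x+x^2q^2}{(1-xq)(1-xq^2)}\frac{J(xq)}{J(x)}-\frac{q}{1-xq^2}-1.$$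
   Context: For a Coxeter system $(W,S)$, $\ell$ is the Coxeter length; $w$ is fully commutative (fc) if any reduced expression of $w$ can be obtained from any other using only commutation relations $st=ts$ ($m_{st}=2$); $W^{FC}(q)=\sum_{w\ \mathrm{fc}}q^{\ell(w)}$. $A_n$, $B_n$ ($n\ge2$) and $D_n$ ($n\ge3$) denote the finite Coxeter groups of the classical types with $n$ generators (type $B_n$: path $t,s_1,\dots,s_{n-1}$ with $m_{ts_1}=4$, other edges labeled 3). Conventions: $A_0=B_0$ is trivial, $B_1=A_1$ (one generator), so $B_0^{FC}=A_0^{FC}=1$, $B_1^{FC}=A_1^{FC}=1+q$; and $D_1^{FC}(q)=1$, $D_2^{FC}(q)=(1+q)^2$. Notation $(a;q)_n=(1-a)(1-aq)\cdots(1-aq^{n-1})$. *)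

(* Defs.v *)
From HB Require Import structures.
From mathcomp Require Import all_boot all_order all_algebra.
From mathcomp Require Import finmap.
From mathcomp Require Import boolp classical_sets functions cardinality.
From Stdlib Require Import Relation_Operators.

Set Implicit Arguments.
Unset Strict Implicit.
Unset Printing Implicit Defensive.

Import GRing.Theory.

(* The value 0 stands for m_{ij} = oo: the relation (ij)^0 = 1 is void.       *)
Record coxMatrix (I : finType) := CoxMatrix {
  cox_m :> I -> I -> nat;
  cox_diag : forall i, cox_m i i = 1;
  cox_sym : forall i j, cox_m i j = cox_m j i;
  cox_offdiag : forall i j, i != j -> cox_m i j != 1
}.

Section CoxeterGroup.
Variables (I : finType) (M : coxMatrix I).

(* Insertion of the relator (ij)^{m_ij}; for i = j it is the word ii.         *)
Inductive cox_step : seq I -> seq I -> Prop :=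
  CoxStep a b i j :
    cox_step (a ++ b) (a ++ flatten (nseq (M i j) [:: i; j]) ++ b).

Definition cox_congr : seq I -> seq I -> Prop :=
  clos_refl_sym_trans (seq I) cox_step.

Definition cox_congrb (u v : seq I) : bool := `[< cox_congr u v >].

Lemma cox_congrb_refl : reflexive cox_congrb.
Proof. by move=> u; apply/asboolP/rst_refl. Qed.

Lemma cox_congrb_sym : symmetric cox_congrb.
Proof. by move=> u v; apply/asboolP/asboolP; exact: rst_sym. Qed.

Lemma cox_congrb_trans : transitive cox_congrb.
Proof.
move=> v u w /asboolP uv /asboolP vw; apply/asboolP.
exact: (rst_trans _ _ _ v).
Qed.

Canonical cox_equiv :=
  EquivRel cox_congrb cox_congrb_refl cox_congrb_sym cox_congrb_trans.

Definition coxGroup := {eq_quot cox_equiv}%qT.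

HB.instance Definition _ := Choice.on coxGroup.

Definition cox_class (u : seq I) : coxGroup :=
  (\pi_{eq_quot cox_equiv} u)%qT.

Lemma cox_classP u v : cox_class u = cox_class v <-> cox_congr u v.
Proof.
split=> uv; first exact/asboolP/(eqmodP cox_equiv)/uv.
exact/(eqmodP cox_equiv)/asboolP.
Qed.

Lemma cox_class_repr (w : coxGroup) : cox_class (repr w) = w.
Proof. exact: reprK. Qed.

Lemma cox_congr_cat u u' v v' :
  cox_congr u u' -> cox_congr v v' -> cox_congr (u ++ v) (u' ++ v').
Proof.
move=> uu' vv'; apply: (rst_trans _ _ _ (u' ++ v)).
  elim: uu' => {u u' v' vv'} [u u' [a b i j]|u|u u' _ h|u1 u2 u3 _ h1 _ h2].
  - by rewrite -!catA; apply: rst_step; constructor.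
  - exact: rst_refl.
  - exact: rst_sym.
  - exact: (rst_trans _ _ _ _ _ h1 h2).
elim: vv' => {u uu' v v'} [v v' [a b i j]|v|v v' _ h|v1 v2 v3 _ h1 _ h2].
- by rewrite (catA u' a b) (catA u' a (_ ++ b)); apply: rst_step; constructor.
- exact: rst_refl.
- exact: rst_sym.
- exact: (rst_trans _ _ _ _ _ h1 h2).
Qed.

Lemma cox_congr_rev u v : cox_congr u v -> cox_congr (rev u) (rev v).
Proof.
elim=> {u v} [u v [a b i j]|u|u v _ h|u1 u2 u3 _ h1 _ h2].
- rewrite !rev_cat -catA rev_flatten map_nseq rev_nseq /= (cox_sym M).
  by apply: rst_step; constructor.
- exact: rst_refl.
- exact: rst_sym.
- exact: (rst_trans _ _ _ _ _ h1 h2).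
Qed.

Lemma cox_congr_revl u : cox_congr (rev u ++ u) [::].
Proof.
elim: u => [|i u ih]; first exact: rst_refl.
rewrite rev_cons cat_rcons; apply: rst_trans ih; apply: rst_sym.
have := CoxStep (rev u) u i i; rewrite (cox_diag M) /= => h.
exact: rst_step.
Qed.

Definition cox_mul (v w : coxGroup) : coxGroup := cox_class (repr v ++ repr w).
Definition cox_one : coxGroup := cox_class [::].
Definition cox_inv (w : coxGroup) : coxGroup := cox_class (rev (repr w)).

Lemma cox_repr_class u : cox_congr (repr (cox_class u)) u.
Proof. by apply/cox_classP; rewrite cox_class_repr. Qed.

Lemma cox_mul_class u v :
  cox_mul (cox_class u) (cox_class v) = cox_class (u ++ v).
Proof. by apply/cox_classP/cox_congr_cat; exact: cox_repr_class. Qed.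

Lemma cox_inv_class u : cox_inv (cox_class u) = cox_class (rev u).
Proof. by apply/cox_classP/cox_congr_rev; exact: cox_repr_class. Qed.

Lemma cox_mulA : associative cox_mul.
Proof.
move=> u v w; rewrite -(cox_class_repr u) -(cox_class_repr v).
by rewrite -(cox_class_repr w) !cox_mul_class catA.
Qed.

Lemma cox_mul1 : left_id cox_one cox_mul.
Proof. by move=> u; rewrite -(cox_class_repr u) cox_mul_class. Qed.

Lemma cox_mulr1 : right_id cox_one cox_mul.
Proof. by move=> u; rewrite -(cox_class_repr u) cox_mul_class cats0. Qed.

Lemma cox_mulV : left_inverse cox_one cox_inv cox_mul.
Proof.
move=> u; rewrite -(cox_class_repr u) cox_inv_class cox_mul_class.
exact/cox_classP/cox_congr_revl.
Qed.

Lemma cox_mulrV : right_inverse cox_one cox_inv cox_mul.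
Proof.
move=> u; rewrite -(cox_class_repr u) cox_inv_class cox_mul_class.
apply/cox_classP; rewrite -{1}[repr u]revK; exact: cox_congr_revl.
Qed.

HB.instance Definition _ := isGroup.Build coxGroup
  cox_mulA cox_mul1 cox_mulr1 cox_mulV cox_mulrV.

Definition cox_gen (i : I) : coxGroup := cox_class [:: i].

Definition cox_word (u : seq I) : coxGroup := (\prod_(i <- u) cox_gen i)%g.

Lemma cox_wordE u : cox_word u = cox_class u.
Proof.
rewrite /cox_word; elim: u => [|i u ih]; first by rewrite big_nil.
by rewrite big_cons ih; exact: cox_mul_class.
Qed.

Lemma cox_wordP u v : cox_word u = cox_word v <-> cox_congr u v.
Proof. by rewrite !cox_wordE; exact: cox_classP. Qed.

Lemma cox_word_ex (w : coxGroup) :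
  exists n, `[< exists u, size u = n /\ cox_word u = w >].
Proof.
exists (size (repr w)); apply/asboolP; exists (repr w).
by rewrite cox_wordE cox_class_repr.
Qed.

Definition cox_length (w : coxGroup) : nat := ex_minn (cox_word_ex w).

Definition reduced_expr (w : coxGroup) (u : seq I) : Prop :=
  cox_word u = w /\ size u = cox_length w.

Inductive comm_step : seq I -> seq I -> Prop :=
  CommStep a b i j : M i j = 2 ->
    comm_step (a ++ [:: i; j] ++ b) (a ++ [:: j; i] ++ b).

Definition comm_equiv : seq I -> seq I -> Prop :=
  clos_refl_trans (seq I) comm_step.

Definition fully_commutative (w : coxGroup) : Prop :=
  forall u v, reduced_expr w u -> reduced_expr w v -> comm_equiv u v.

Definition fc_of_length (k : nat) : set coxGroup :=
  [set w | fully_commutative w /\ cox_length w = k]%classic.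

(* So that [fset_set] below does not take its default value.                  *)
Lemma fc_of_length_finite k : finite_set (fc_of_length k).
Proof.
apply: (@sub_finite_set _ _ ((fun t : k.-tuple I => cox_word t) @` setT)%classic).
  move=> w [_]; rewrite /cox_length; case: ex_minnP => n /asboolP[u [<- uw]] _ e.
  by exists (tcast e (in_tuple u)) => //; rewrite val_tcast.
exact/finite_image/finite_finset.
Qed.

End CoxeterGroup.

Arguments cox_class {I} M u.
Arguments cox_gen {I} M i.
Arguments cox_word {I} M u.
Arguments comm_equiv {I} M _ _.
Arguments fc_of_length {I} M k _.

Local Open Scope ring_scope.

Record fps (R : Type) := Fps { fcoef : nat -> R }.

HB.instance Definition _ (R : Type) := gen_eqMixin (fps R).
HB.instance Definition _ (R : Type) := gen_choiceMixin (fps R).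

Lemma fpsP (R : Type) (f g : fps R) : (forall n, fcoef f n = fcoef g n) <-> f = g.
Proof.
split=> [|->//]; case: f g => [f] [g] /= fg.
by congr Fps; apply/funext.
Qed.

Section FpsRing.
Variable R : comNzRingType.
Implicit Types f g h : fps R.

Definition fps0 : fps R := Fps (fun=> 0).
Definition fps1 : fps R := Fps (fun n => (n == 0%N)%:R).
Definition fps_add f g := Fps (fun n => fcoef f n + fcoef g n).
Definition fps_opp f := Fps (fun n => - fcoef f n).
Definition fps_mul f g :=
  Fps (fun n => \sum_(i < n.+1) fcoef f i * fcoef g (n - i)%N).

Lemma fps_addA : associative fps_add.
Proof. by move=> f g h; apply/fpsP => n /=; rewrite addrA. Qed.
Lemma fps_addC : commutative fps_add.
Proof. by move=> f g; apply/fpsP => n /=; rewrite addrC. Qed.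
Lemma fps_add0 : left_id fps0 fps_add.
Proof. by move=> f; apply/fpsP => n /=; rewrite add0r. Qed.
Lemma fps_addN : left_inverse fps0 fps_opp fps_add.
Proof. by move=> f; apply/fpsP => n /=; rewrite addNr. Qed.

HB.instance Definition _ :=
  GRing.isZmodule.Build (fps R) fps_addA fps_addC fps_add0 fps_addN.

Definition fps_trunc N f : {poly R} := \poly_(i < N.+1) fcoef f i.

Lemma coef_trunc N f n : (n <= N)%N -> (fps_trunc N f)`_n = fcoef f n.
Proof. by move=> nN; rewrite coef_poly ltnS nN. Qed.

Lemma fps_mul_trunc N f g n : (n <= N)%N ->
  fcoef (fps_mul f g) n = (fps_trunc N f * fps_trunc N g)`_n.
Proof.
move=> nN; rewrite coefM /=; apply: eq_bigr => i _.
rewrite !coef_trunc //; first exact: leq_trans (leq_subr _ _) nN.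
by apply: leq_trans nN; rewrite -ltnS.
Qed.

Lemma fps_mulA : associative fps_mul.
Proof.
move=> f g h; apply/fpsP => n.
transitivity ((fps_trunc n f * fps_trunc n g * fps_trunc n h)`_n).
  rewrite -mulrA coefM; apply: eq_bigr => i _.
  by rewrite coef_trunc -1?ltnS // (@fps_mul_trunc n) // leq_subr.
rewrite coefM; apply: eq_bigr => i _.
by rewrite -(@fps_mul_trunc n) -1?ltnS // coef_trunc // leq_subr.
Qed.

Lemma fps_mulC : commutative fps_mul.
Proof.
by move=> f g; apply/fpsP => n; rewrite !(@fps_mul_trunc n) // mulrC.
Qed.

Lemma fps_mul1 : left_id fps1 fps_mul.
Proof.
move=> f; apply/fpsP => n /=.
rewrite big_ord_recl /= subn0 mul1r big1 ?addr0 // => i _.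
by rewrite mul0r.
Qed.

Lemma fps_mulDl : left_distributive fps_mul fps_add.
Proof.
move=> f g h; apply/fpsP => n /=; rewrite -big_split /=.
by apply: eq_bigr => i _; rewrite mulrDl.
Qed.

Lemma fps1_neq0 : fps1 != 0.
Proof.
by apply/eqP => /(congr1 (fun f => fcoef f 0)) /= /eqP; rewrite oner_eq0.
Qed.

HB.instance Definition _ := GRing.Zmodule_isComNzRing.Build (fps R)
  fps_mulA fps_mulC fps_mul1 fps_mulDl fps1_neq0.

Definition fpsC (a : R) : fps R := Fps (fun n => if n is 0%N then a else 0).
Definition fpsX : fps R := Fps (fun n => (n == 1%N)%:R).

(* The sum of a family in which F n is divisible by X^n; the coefficient of   *)
(* X^m then only receives contributions from the indices n <= m.              *)
Definition fps_sum (F : nat -> fps R) : fps R :=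
  Fps (fun m => \sum_(n < m.+1) fcoef (F n) m).

Lemma fcoefD f g n : fcoef (f + g) n = fcoef f n + fcoef g n.
Proof. by []. Qed.
Lemma fcoefN f n : fcoef (- f) n = - fcoef f n.
Proof. by []. Qed.
Lemma fcoefM f g n :
  fcoef (f * g) n = \sum_(i < n.+1) fcoef f i * fcoef g (n - i)%N.
Proof. by []. Qed.
Lemma fcoef1 n : fcoef (1 : fps R) n = (n == 0%N)%:R.
Proof. by []. Qed.
Lemma fcoef0 n : fcoef (0 : fps R) n = 0.
Proof. by []. Qed.

Lemma fcoef0M f g : fcoef (f * g) 0 = fcoef f 0 * fcoef g 0.
Proof. by rewrite fcoefM big_ord1. Qed.

Lemma fcoef_sum (J : Type) (r : seq J) (P : pred J) (F : J -> fps R) n :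
  fcoef (\sum_(j <- r | P j) F j) n = \sum_(j <- r | P j) fcoef (F j) n.
Proof. by elim/big_rec2: _ => // j y1 y2 _ <-. Qed.

Lemma fcoef_sum0 (F : nat -> fps R) : fcoef (fps_sum F) 0 = fcoef (F 0%N) 0.
Proof. exact: big_ord1. Qed.

Lemma fps_sumE (F : nat -> fps R) m N :
    (forall n k, (k < n)%N -> fcoef (F n) k = 0) -> (m <= N)%N ->
  fcoef (fps_sum F) m = fcoef (\sum_(n < N.+1) F n) m.
Proof.
move=> F0 mN; rewrite fcoef_sum /= -!(big_mkord xpredT (fun n => fcoef (F n) m)).
rewrite [RHS](@big_cat_nat _ _ _ m.+1) //= [X in _ = _ + X]big_nat_cond.
rewrite [X in _ = _ + X]big1 ?addr0 // => n; rewrite andbT => /andP[mn _].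
exact: F0.
Qed.

Lemma fcoef_exp_small h n k : fcoef h 0 = 0 -> (k < n)%N -> fcoef (h ^+ n) k = 0.
Proof.
move=> h0; elim: n k => // n ih k kn; rewrite exprS fcoefM big1 // => -[[|i] ik] _ /=.
  by rewrite h0 mul0r.
rewrite ih ?mulr0 //.
apply: leq_trans (kn : k <= n)%N; rewrite ltn_subrL /=; exact: (leq_ltn_trans (leq0n i) (ik : i < k)%N).
Qed.

End FpsRing.

Section FpsUnit.
Variable R : comUnitRingType.
Implicit Types f g h : fps R.

Definition fps_unit : pred (fps R) := fun f => fcoef f 0 \is a GRing.unit.

(* f = f_0 (1 - h) with h(0) = 0, so 1/f = f_0^-1 (1 + h + h^2 + ...).        *)
Definition fps_inv f : fps R :=
  if fps_unit f then
    fpsC (fcoef f 0)^-1 *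
    fps_sum (fun n => (1 - fpsC (fcoef f 0)^-1 * f) ^+ n)
  else f.

Lemma fps_geom h : fcoef h 0 = 0 -> (1 - h) * fps_sum (fun n => h ^+ n) = 1.
Proof.
move=> h0; apply/fpsP => n.
have -> : fcoef ((1 - h) * fps_sum (fun n => h ^+ n)) n =
          fcoef ((1 - h) * \sum_(k < n.+1) h ^+ k) n.
  rewrite !fcoefM; apply: eq_bigr => i _; congr (_ * _).
  apply: fps_sumE; last by rewrite leq_subr.
  by move=> *; exact: fcoef_exp_small.
have -> : (1 - h) * \sum_(k < n.+1) h ^+ k = 1 - h ^+ n.+1.
  by rewrite -opprB mulNr -subrX1 opprB.
by rewrite fcoefD fcoefN fcoef_exp_small // subr0.
Qed.

Lemma fpsCM (a b : R) : fpsC (a * b) = fpsC a * fpsC b.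
Proof.
apply/fpsP => -[|n]; first by rewrite fcoef0M.
by rewrite fcoefM big1 // => -[[|i] ik] _ /=; rewrite ?mul0r ?mulr0.
Qed.

Lemma fpsC1 : fpsC (1 : R) = 1.
Proof. by apply/fpsP => -[]. Qed.

Lemma fps_mulVx : {in fps_unit, left_inverse 1 fps_inv *%R}.
Proof.
move=> f uf; rewrite /fps_inv (_ : fps_unit f) //.
set g := fpsC _ * f; rewrite mulrAC -/g.
have := @fps_geom (1 - g); rewrite subKr; apply.
by rewrite fcoefD fcoefN fcoef1 fcoef0M /= mulVr ?subrr.
Qed.

Lemma fps_unitPl f g : g * f = 1 -> fps_unit f.
Proof.
move=> /(congr1 (fun h => fcoef h 0)); rewrite fcoef0M fcoef1 => gf.
by apply/unitrP; exists (fcoef g 0); rewrite gf mulrC gf.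
Qed.

Lemma fps_inv_out : {in [predC fps_unit], fps_inv =1 id}.
Proof. by move=> f nf; rewrite /fps_inv (negbTE (nf : ~~ fps_unit f)). Qed.

HB.instance Definition _ := GRing.ComNzRing_hasMulInverse.Build (fps R)
  fps_mulVx fps_unitPl fps_inv_out.

Lemma fps_unitE f : (f \is a GRing.unit) = (fcoef f 0 \is a GRing.unit).
Proof. by []. Qed.

End FpsUnit.

Arguments fps_inv : simpl never.

Definition FC_series (I : finType) (M : coxMatrix I) : fps int :=
  Fps (fun k => (#|` fset_set (fc_of_length M k)|)%fset%:Z).

(* [lab i j], read for i < j only, is the entry m_{ij}.                       *)
Section Diagram.
Variables (n : nat) (lab : nat -> nat -> nat).
Hypothesis lab_neq1 : forall i j, lab i j != 1%N.

Definition diagram_m (i j : 'I_n) : nat :=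
  if i == j then 1%N else lab (minn i j) (maxn i j).

Lemma diagram_diag i : diagram_m i i = 1%N.
Proof. by rewrite /diagram_m eqxx. Qed.

Lemma diagram_sym i j : diagram_m i j = diagram_m j i.
Proof. by rewrite /diagram_m eq_sym minnC maxnC. Qed.

Lemma diagram_offdiag i j : i != j -> diagram_m i j != 1%N.
Proof. by rewrite /diagram_m => /negbTE ->. Qed.

Definition diagram_cox : coxMatrix 'I_n :=
  CoxMatrix diagram_diag diagram_sym diagram_offdiag.
End Diagram.

Definition labA (i j : nat) : nat := (if j == i.+1 then 3 else 2)%N.

(* Node 0 is the generator t, node i >= 1 the generator s_i.                  *)
Definition labB (i j : nat) : nat :=
  (if j == i.+1 then if i == 0 then 4 else 3 else 2)%N.

(* Nodes 0 and 1 form the fork: both are joined to node 2.                    *)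
Definition labD (i j : nat) : nat :=
  (if (0 < i) && (j == i.+1) || (i == 0) && (j == 2) then 3 else 2)%N.

Lemma labA_neq1 i j : labA i j != 1%N.
Proof. by rewrite /labA; case: ifP. Qed.
Lemma labB_neq1 i j : labB i j != 1%N.
Proof. by rewrite /labB; do 2?case: ifP. Qed.
Lemma labD_neq1 i j : labD i j != 1%N.
Proof. by rewrite /labD; case: ifP. Qed.

(* Both are trivial for n = 0 and have a single generator for n = 1.          *)
Definition coxA n : coxMatrix 'I_n := diagram_cox n labA_neq1.
Definition coxB n : coxMatrix 'I_n := diagram_cox n labB_neq1.

(* Only used for n >= 3.                                                      *)
Definition coxD n : coxMatrix 'I_n := diagram_cox n labD_neq1.

Definition A_FC n : fps int := FC_series (coxA n).
Definition B_FC n : fps int := FC_series (coxB n).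

(* The values for n = 1, 2 are conventions; in particular D_1^FC = 1, although*)
(* [coxD 1] has one generator.                                                *)
Definition D_FC n : fps int :=
  match n with
  | 1%N => 1
  | 2%N => (1 + fpsX int) ^+ 2
  | _ => FC_series (coxD n)
  end.

Notation Zqx := (fps (fps int)).

Definition q : Zqx := fpsC (fpsX int).
Definition x : Zqx := fpsX (fps int).

(* (a; q)_n *)
Definition qpoch (a : Zqx) (n : nat) : Zqx := \prod_(i < n) (1 - a * q ^+ i).

(* The argument y is to be divisible by x, so that the sums converge.         *)
Definition J (y : Zqx) : Zqx :=
  fps_sum (fun n =>
    (- y) ^+ n * q ^+ 'C(n, 2) / (qpoch q n * qpoch (y * q) n)).

Lemma qpoch_unit (a : Zqx) n :
  fcoef (fcoef a 0) 0 = 0 -> qpoch a n \is a GRing.unit.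
Proof.
move=> a0; apply: rpred_prod => i _.
by rewrite !fps_unitE !fcoefD !fcoefN !fcoef0M a0 mul0r subr0 unitr1.
Qed.

Lemma J_unit (y : Zqx) : J y \is a GRing.unit.
Proof.
rewrite fps_unitE fcoef_sum0 expr0 /qpoch !big_ord0 !mul1r invr1.
exact: unitr1.
Qed.

Definition K (y : Zqx) : Zqx :=
  fps_sum (fun n =>
    y ^+ n * q ^+ 'C(n.+1, 2) / qpoch (y * q) n *
    \sum_(k < n.+1) (-1) ^+ k / qpoch q k).

Definition A_gf : Zqx := Fps A_FC.
Definition B_gf : Zqx := Fps B_FC.
Definition D_gf : Zqx := Fps (fun n => D_FC n.+1).

(* Main.v *)
(* Call a word fc if no word of its commutation class contains ii or a braid of
   length m_ij. Tits' exchange argument, given that s_i s_j has order m_ij (seen on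
   an integral reflection representation), shows that the fc words are exactly the
   reduced words of the fully commutative elements, one commutation class for each
   element. A commutation class is determined by its projections on pairs of
   non-commuting letters, and on a path of simple edges the class is fc if and only
   if the projections on consecutive letters alternate, except that one letter may be
   doubled, which forces a "peak" between it and the other end of the diagram.
   Reading the diagram from its simple end, fc classes are thus the runs of an
   automaton whose state is the number h of occurrences of the current letter (or
   "peak"), and the behaviour at the other end distinguishes the types A, B and D.

   The series P_h of the alternating runs ending at height h satisfy
     P_h = [h = 0] + x q^h ([h > 0] (P_(h-1) + P_h) + P_h + P_(h+1)),
   which has only one solution. With
     theta(y) = sum_n (-y)^n q^C(n+1,2) / ((q;q)_n (yq;q)_n),
   two contiguity relations between theta and J show that it is
     P_h = x^h q^C(h+1,2) theta(x q^h) / ((xq;q)_h J(x)),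
   and collecting the terms with h + k = n in sum_h P_h J(x) gives K(x). Finally
   A, B and D are combinations of P_0, P_1 and sum_h P_h. *)

Require Import Defs.
From mathcomp Require Import all_boot all_algebra.
From mathcomp Require Import finmap.
From mathcomp Require Import boolp classical_sets cardinality.
From mathcomp Require Import zify ring.
From Stdlib Require Import Relation_Operators.

Set Implicit Arguments.
Unset Strict Implicit.
Unset Printing Implicit Defensive.
Import GRing.Theory.

(** * Exchange and words without braids *)

(** The group is a quotient of words, so neither lengths nor the orders of the products s_i s_j are
    known in advance. Once the exchange argument is done, only words and their projections remain.
    Projections are preferred to chains of commutations because they can be restricted to the
    letters on either side of a letter o and glued back along o. The special end (the edge labelled
    4, or the fork) is met last, as a finite table of continuations for each state, so that one list
    of words serves the three types. The peak state is unavoidable: two consecutive occurrences of a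
    letter may enclose only neighbours from above. Such a peak has to climb to the special end,
    where types B and D can close it and type A cannot. The quotients by J(x) come from a linear
    system in the infinitely many unknowns P_h. The relations between theta and J at the arguments x
    q^h solve its homogeneous part, and the equation at h = 0 fixes the normalisation by J(x). *)

Section Words.
Variables (T : eqType) (mat : T -> T -> nat).
Implicit Types (u v w a b c : seq T) (i j k : T).

Fixpoint altw i j n : seq T := if n is n'.+1 then i :: altw j i n' else [::].

(* Equality of all projections on two non-commuting letters: by the
   Cartier-Foata projection lemma this is commutation equivalence. *)
Definition peq u v := forall i j, mat i j <> 2 ->
  filter (pred2 i j) u = filter (pred2 i j) v.

(** Pairs with [mat i j = 2] are left out because their braid is a mere commutation, which [peq]
    already absorbs. *)
Definition braid_free v :=
  (forall a b i, v <> a ++ [:: i; i] ++ b) /\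
  (forall a b i j, i != j -> mat i j <> 2 -> v <> a ++ altw i j (mat i j) ++ b).

Definition fc_word u := forall v, peq u v -> braid_free v.

Lemma peq_refl u : peq u u. Proof. by []. Qed.
Lemma peq_sym u v : peq u v -> peq v u.
Proof. by move=> h i j ij; rewrite h. Qed.
Lemma peq_trans v u w : peq u v -> peq v w -> peq u w.
Proof. by move=> h1 h2 i j ij; rewrite h1 // h2. Qed.

Lemma peq_cat u u' v v' : peq u u' -> peq v v' -> peq (u ++ v) (u' ++ v').
Proof. by move=> h1 h2 i j ij; rewrite !filter_cat h1 // h2. Qed.

Lemma peq_cons i u v : peq u v -> peq (i :: u) (i :: v).
Proof. by move=> h; rewrite -(cat1s i u) -(cat1s i v); exact: peq_cat. Qed.

Lemma peq_cons_inv i u v : peq (i :: u) (i :: v) -> peq u v.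
Proof. by move=> h k l /h /=; case: ifP => // _ []. Qed.

Lemma fc_word_peq u v : peq u v -> fc_word u -> fc_word v.
Proof. by move=> uv h w vw; apply: h; apply: peq_trans vw. Qed.

Lemma fc_word_behead i u : fc_word (i :: u) -> fc_word u.
Proof.
move=> h v uv; have [h1 h2] := h _ (peq_cons i uv).
split=> [a b j e|a b j k jk m e]; first by apply: (h1 (i :: a) b j); rewrite e.
by apply: (h2 (i :: a) b j k jk m); rewrite e.
Qed.

Lemma size_altw i j n : size (altw i j n) = n.
Proof. by elim: n i j => //= n ih i j; rewrite ih. Qed.

Lemma altwD i j m n : altw i j (m + n) =
  altw i j m ++ (if odd m then altw j i n else altw i j n).
Proof.
elim: m i j => //= m ih i j; rewrite ih; by case: (odd m).
Qed.

Lemma altw_flatten i j n : altw i j n.*2 = flatten (nseq n [:: i; j]).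
Proof. by elim: n => //= n ih; rewrite ih. Qed.

Hypothesis mat_sym : forall i j, mat i j = mat j i.
Hypothesis mat_diag : forall i, mat i i = 1.

(** Since [mat i i = 1], the pair (i, i) counts as non-commuting, and its projection records the
    multiplicity of i. *)
Lemma peq_perm u v : peq u v -> perm_eq u v.
Proof.
move=> h; apply/allP => i _; apply/eqP.
have e x : pred1 i x = pred2 i i x by rewrite /= orbb.
rewrite -!size_filter; congr size; rewrite !(eq_filter e).
by apply: h; rewrite mat_diag.
Qed.

Lemma peq_size u v : peq u v -> size u = size v.
Proof. by move/peq_perm/perm_size. Qed.

Lemma peq_comm i j : mat i j = 2 -> peq [:: i; j] [:: j; i].
Proof.
move=> ij k l kl /=; case: (boolP (_ || _)) => hi; case: (boolP (_ || _)) => hj //.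
move: hi hj ij => /orP[]/eqP-> /orP[]/eqP-> // ij; exfalso; apply: kl => //.
by rewrite mat_sym.
Qed.

End Words.

(** * Commutation classes and projections *)

Section CommEquiv.
Variables (I : finType) (M : coxMatrix I).
Implicit Types (u v w a b c : seq I) (i j k : I).
Local Notation peq := (peq M).

Lemma comm_equiv_peq u v : comm_equiv M u v -> peq u v.
Proof.
elim=> {u v} [u v [a b i j ij]|u|u v w _ h1 _ h2] //; last exact: peq_trans h1 h2.
apply: peq_cat => //; apply: peq_cat => //; exact: (peq_comm (cox_sym M)).
Qed.

Lemma comm_equiv_cat a b u v :
  comm_equiv M u v -> comm_equiv M (a ++ u ++ b) (a ++ v ++ b).
Proof.
elim=> {u v} [u v [c d i j ij]|u|u v w _ h1 _ h2].
- rewrite -!catA (catA a c) (catA a c (_ ++ _)).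
  by apply: rt_step; constructor.
- exact: rt_refl.
- exact: rt_trans h1 h2.
Qed.

Lemma comm_equiv_front i u : (forall j, j \in u -> M i j = 2) ->
  comm_equiv M (u ++ [:: i]) (i :: u).
Proof.
elim: u => [|j u ih] h; first exact: rt_refl.
apply: (rt_trans _ _ _ (j :: i :: u)).
  rewrite cat_cons -(cat1s j (u ++ _)) -(cat1s j (i :: u)) -(cats0 (u ++ _)) -(cats0 (i :: u)).
  apply: comm_equiv_cat; apply: ih => k ku; apply: h; by rewrite inE ku orbT.
have hji : M j i = 2 by rewrite (cox_sym M) h // mem_head.
exact: rt_step (CommStep [::] u hji).
Qed.

(** A letter j that precedes the first i of [v] commutes with i: otherwise the projection on i, j
    would begin with i for [i :: u] and with another letter for [v]. So i moves to the front of [v]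
    and cancels. Both directions of this move are constructed because [comm_equiv] is not symmetric
    by definition. *)
Lemma peq_comm_equiv u v : peq u v -> comm_equiv M u v.
Proof.
elim: u v => [|i u ih] v uv.
  have /size0nil -> : size v = 0 by rewrite -(peq_size (cox_diag M) uv).
  exact: rt_refl.
have : i \in v by rewrite -(perm_mem (peq_perm (cox_diag M) uv)) mem_head.
move=> iv; pose v1 := take (index i v) v; pose v2 := drop (index i v).+1 v.
have ev : v = v1 ++ i :: v2.
  by rewrite -{1}(cat_take_drop (index i v) v) (drop_nth i) ?index_mem // nth_index.
have niv1 : i \notin v1 by apply: contraT => /negbNE; rewrite in_take // ltnn.
have h1 j : j \in v1 -> M i j = 2.
  move=> jv1; apply/eqP; apply: contraT => /eqP mij.
  have := uv i j mij; rewrite ev filter_cat /= eqxx /=.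
  have : all (fun x => x != i) (filter (pred2 i j) v1).
    by apply/allP => x; rewrite mem_filter => /andP[_]; apply: contraTneq => ->.
  have : j \in filter (pred2 i j) v1 by rewrite mem_filter /= eqxx orbT.
  by case: (filter _ v1) => //= x s _ /andP[xi _] [xe]; rewrite -xe eqxx in xi.
have e2 : comm_equiv M v (i :: v1 ++ v2).
  rewrite ev -(cat1s i v2) catA.
  have := comm_equiv_cat [::] v2 (comm_equiv_front h1); by rewrite /= -cat_cons.
have e3 : comm_equiv M (i :: v1 ++ v2) v.
  have h1' : comm_equiv M (i :: v1) (v1 ++ [:: i]).
    elim: (v1) h1 => [|j w ihw] h; first exact: rt_refl.
    apply: (rt_trans _ _ _ (j :: i :: w)).
      have hij : M i j = 2 by rewrite h // mem_head.
      exact: rt_step (CommStep [::] w hij).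
    rewrite cat_cons -(cat1s j (w ++ _)) -(cat1s j (i :: w)) -(cats0 (w ++ _)) -(cats0 (i :: w)).
    apply: comm_equiv_cat; apply: ihw => k ku; apply: h; by rewrite inE ku orbT.
  rewrite ev -(cat1s i v2) catA -cat_cons.
  exact: (comm_equiv_cat [::] v2 h1').
apply: rt_trans e3; rewrite -(cat1s i u) -(cat1s i (_ ++ _)) -(cats0 u) -(cats0 (v1 ++ v2)).
apply: (comm_equiv_cat [:: i] [::]); apply: ih; apply: (@peq_cons_inv _ _ i).
by apply: peq_trans uv _; exact: comm_equiv_peq.
Qed.

Lemma comm_equivE u v : comm_equiv M u v <-> peq u v.
Proof. by split=> [/comm_equiv_peq|/peq_comm_equiv]. Qed.
End CommEquiv.

(** * Tits' exchange argument *)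

Section Exchange.
Variables (I : finType) (M : coxMatrix I).
Implicit Types (u v w a b c : seq I) (i j k : I).
Local Notation cw := (cox_word M).
Local Notation gen := (cox_gen M).
Local Open Scope group_scope.

Lemma cw_cat u v : cw (u ++ v) = cw u * cw v.
Proof. by rewrite /cox_word big_cat. Qed.
Lemma cw_cons i u : cw (i :: u) = gen i * cw u.
Proof. by rewrite /cox_word big_cons. Qed.
Lemma cw_nil : cw [::] = 1.
Proof. by rewrite /cox_word big_nil. Qed.

Lemma cw_flatten n i j : cw (flatten (nseq n [:: i; j])) = (gen i * gen j) ^+ n.
Proof.
elim: n => [|n ih]; first by rewrite cw_nil.
by rewrite /= expgS !cw_cons ih mulgA.
Qed.

Lemma gen_rel i j : (gen i * gen j) ^+ M i j = 1.
Proof.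
rewrite -cw_flatten -cw_nil; apply/cox_wordP/rst_sym/rst_step.
by have := CoxStep M [::] [::] i j; rewrite /= !cats0.
Qed.

Lemma genK i : gen i * gen i = 1.
Proof. by have := gen_rel i i; rewrite cox_diag. Qed.

Lemma genV i : (gen i)^-1 = gen i.
Proof. exact/mulg1_eq/genK. Qed.

(* The reflections i_1 .. i_k .. i_1 of a word. A relator contributes each of its
   reflections twice, so that the parities of the multiplicities only depend on the
   group element. *)
Fixpoint refls u : seq (coxGroup M) :=
  if u is i :: u' then gen i :: [seq t ^ (gen i) | t <- refls u'] else [::].

Lemma refls_cat u v : refls (u ++ v) = refls u ++ [seq t ^ (cw u)^-1 | t <- refls v].
Proof.
elim: u => [|i u ih] /=.
  by rewrite cw_nil invg1 -[LHS]map_id; apply: eq_map => t; rewrite conjg1.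
rewrite ih map_cat -map_comp; congr (_ :: (_ ++ _)); apply: eq_map => t /=.
by rewrite cw_cons invgM -conjgM genV.
Qed.

Lemma refls_flatten n i j :
  refls (flatten (nseq n [:: i; j])) =
  [seq (gen i * gen j) ^+ p * gen i | p <- iota 0 n.*2].
Proof.
elim: n => //= n ih; rewrite ih /= mul1g; congr (_ :: _ :: _).
  by rewrite expg1 conjgE genV mulgA.
rewrite -map_comp -map_comp (iotaDl 2 0) -map_comp.
apply: eq_map => p /=; rewrite addSn add1n.
by rewrite -conjgM conjgE invgM !genV expgS expgSr !mulgA.
Qed.

Lemma odd_refls u v t : cox_congr M u v ->
  odd (count_mem t (refls u)) = odd (count_mem t (refls v)).
Proof.
move=> h; elim: h t => {u v} [u v [a b i j]|u|u v _ h|u v w _ h1 _ h2] t //; last by rewrite h1 h2.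
set r := flatten _.
have r1 : cw r = 1 by rewrite cw_flatten gen_rel.
rewrite !refls_cat !count_cat map_cat count_cat !oddD; congr (_ (+) _).
have -> : [seq t0 ^ (cw a)^-1 | t0 <- [seq t0 ^ (cw r)^-1 | t0 <- refls b]] =
          [seq t0 ^ (cw a)^-1 | t0 <- refls b].
  by rewrite -map_comp; apply: eq_map => s /=; rewrite r1 invg1 conjg1.
suff -> : odd (count_mem t [seq t0 ^ (cw a)^-1 | t0 <- refls r]) = false by [].
rewrite refls_flatten -addnn iotaD map_cat map_cat count_cat add0n.
suff -> : [seq (gen i * gen j) ^+ p * gen i | p <- iota (M i j) (M i j)] =
          [seq (gen i * gen j) ^+ p * gen i | p <- iota 0 (M i j)].
  by rewrite addnn odd_double.
rewrite -{1}(addn0 (M i j)) iotaDl -map_comp; apply: eq_map => p /=.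
by rewrite expgnDr gen_rel mul1g.
Qed.

(** An occurrence of i after the prefix p contributes t = p i p^-1, and multiplying by t cancels
    exactly that occurrence. *)
Lemma refls_del u t : t \in refls u ->
  exists a b i, u = a ++ i :: b /\ t * cw u = cw (a ++ b).
Proof.
elim: u t => //= i u ih t; rewrite inE => /orP[/eqP ->|].
  by exists [::], u, i; rewrite cw_cons mulgA genK mul1g.
move=> /mapP[s /ih [a [b [j [-> e]]]] ->]; exists (i :: a), b, j; split=> //.
rewrite /= !cw_cons -e conjgE genV -!mulgA; congr (_ * (_ * _)).
by rewrite mulgA genK mul1g.
Qed.

Definition reduced u := forall v, cw v = cw u -> size u <= size v.

Lemma reduced_eq u v : reduced u -> cw u = cw v -> size v = size u -> reduced v.
Proof. by move=> ru e s w ew; rewrite s; apply: ru; rewrite ew. Qed.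

Lemma reduced_suffix a u : reduced (a ++ u) -> reduced u.
Proof.
move=> r v ev; have := r (a ++ v); rewrite !cw_cat ev !size_cat leq_add2l; exact.
Qed.

Lemma reduced_size u v : reduced u -> reduced v -> cw u = cw v -> size u = size v.
Proof. by move=> ru rv e; apply/eqP; rewrite eqn_leq ru // rv. Qed.

(** If [gen i] were missing from [refls u], it would occur once, hence an odd number of times, in
    [refls (i :: u)]. By parity it would then occur in [refls v] for a word [v] of the same element
    no longer than [u], and deleting the corresponding letter of [v] would express [cw u] by a word
    shorter than [u]. *)
Lemma exchange i u : reduced u -> ~ reduced (i :: u) -> gen i \in refls u.
Proof.
move=> ru /existsNP[v /not_implyP[ev /negP]]; rewrite -ltnNge /= ltnS => sv.
apply: contraT => nin.
have : odd (count_mem (gen i) (refls v)).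
  rewrite (odd_refls _ (v := i :: u)); last exact/cox_wordP.
  rewrite /= eqxx count_map oddD /=.
  suff -> : count (preim (fun t => t ^ gen i) (pred1 (gen i))) (refls u) = 0 by [].
  apply/eqP; rewrite -leqn0 leqNgt -has_count; apply/negP => /hasP[t tu /=] /eqP e.
  suff et : t = gen i by rewrite -et tu in nin.
  have := congr1 (fun s => s ^ gen i) e; rewrite -conjgM genK conjg1 => ->.
  by rewrite conjgE mulgA genV genK mul1g.
case: (boolP (gen i \in refls v)) => [iv _|/count_memPn -> //].
have [a [b [j [e1 e2]]]] := refls_del iv.
have := ru (a ++ b); rewrite -e2 ev cw_cons mulgA genK mul1g => /(_ erefl).
by move: sv; rewrite e1 !size_cat /= addnS => h1 h2; have := leq_trans h1 h2; rewrite ltnn.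
Qed.

Hypothesis ord_ok : forall i j (c : nat), i != j -> 0 < c -> (gen i * gen j) ^+ c = 1 ->
  M i j <= c.
Hypothesis mat_pos : forall i j, 0 < M i j.

Lemma cw_braid i j : cw (altw i j (M i j)) = cw (altw j i (M i j)).
Proof.
set m := M i j.
have E k l n : cw (altw k l n) = (gen k * gen l) ^+ n./2 * (if odd n then gen k else 1).
  rewrite -{1}(odd_double_half n) addnC altwD odd_double altw_flatten cw_cat cw_flatten.
  by case: (odd n) => /=; rewrite ?cw_cons cw_nil ?mulg1.
rewrite !E.
have V n : ((gen j * gen i) ^+ n) = ((gen i * gen j) ^+ n)^-1.
  by rewrite -expVgn invgM !genV.
have h : (gen i * gen j) ^+ m./2 * ((gen i * gen j) ^+ m./2 * (if odd m then gen i * gen j else 1)) = 1.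
  have := gen_rel i j; rewrite -/m -{1}(odd_double_half m) addnC -addnn !expgnDr -mulgA.
  by case: (odd m); rewrite ?expg1 ?expg0.
rewrite V (mulg1_eq h) -mulgA; congr (_ * _).
by case: (odd m); rewrite ?mulg1 // -mulgA genK mulg1.
Qed.

(* A maximal reduced prefix alternating in i, j has length at least m_ij: by
   exchange the other letter z is one of the reflections (xz)^p x, p < k, of the
   prefix, so that (xz)^(p+1) = 1. *)
Lemma dihedral_prefix i j u v : i != j -> reduced (i :: u) -> reduced (j :: v) ->
  cw (i :: u) = cw (j :: v) ->
  exists y, reduced (altw i j (M i j) ++ y) /\
    cw (altw i j (M i j) ++ y) = cw (i :: u).
Proof.
move=> ij ru rv e.
pose P n := `[< exists y, (reduced (altw i j n ++ y) /\ cw (altw i j n ++ y) = cw (i :: u))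
   \/ (reduced (altw j i n ++ y) /\ cw (altw j i n ++ y) = cw (i :: u)) >].
have P1 : exists n, P n by exists 1%N; apply/asboolP; exists u; left.
have Pb n : P n -> n <= size (i :: u).
  by move=> /asboolP[y [] [r ew]]; rewrite -(reduced_size r ru ew) size_cat size_altw leq_addr.
case: (ex_maxnP P1 Pb) => n /asboolP[y Hy] kmax.
(* The element also has a reduced word beginning with b, so putting b in front of the maximal word
   is not reduced and exchange deletes a letter. A deletion inside [y] would lengthen the
   alternating prefix, against maximality, so it happens inside the prefix. *)
have Q (a b : I) : a != b -> (exists u', reduced (b :: u') /\ cw (b :: u') = cw (i :: u)) ->
   reduced (altw a b n ++ y) -> cw (altw a b n ++ y) = cw (i :: u) ->
   (forall y', reduced (altw b a n.+1 ++ y') ->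
   cw (altw b a n.+1 ++ y') = cw (i :: u) -> P n.+1) -> M a b <= n.
  move=> ab [u' [ru' eu']] r ew hP.
  have sz := reduced_size ru' r (etrans eu' (esym ew)).
  have nr : ~ reduced (b :: altw a b n ++ y).
    move=> rr; have := rr u'; rewrite cw_cons ew -eu' cw_cons mulgA genK mul1g => /(_ erefl).
    by rewrite /= -sz /= ltnNge leqnSn.
  have := exchange r nr; rewrite refls_cat mem_cat => /orP[].
    (* [refls_flatten] only describes powers of ab, so the prefix is completed to a word of even
       length at least n. *)
    have [n' ek] : exists n', n' = n./2.+1 by exists (n./2.+1).
    have lek : n <= n'.*2.
      by rewrite ek doubleS -{1}(odd_double_half n); case: (odd n); rewrite ?add1n ?add0n ltnW.
    have : altw a b n'.*2 = altw a b n ++ (if odd n then altw b a (n'.*2 - n) else altw a b (n'.*2 - n)).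
      by rewrite -altwD subnKC.
    rewrite altw_flatten => /(congr1 refls); rewrite refls_flatten refls_cat => er.
    have sr w : size (refls w) = size w by elim: w => //= x w ih; rewrite size_map ih.
    have : refls (altw a b n) = take n [seq (gen a * gen b) ^+ p * gen a | p <- iota 0 n'.*2].
      by rewrite er take_size_cat // sr size_altw.
    move=> ->; rewrite -map_take take_iota (minn_idPl lek) => /mapP[p].
    rewrite mem_iota add0n => /andP[_ pk] eb.
    have : (gen a * gen b) ^+ p.+1 = 1 by rewrite expgSr mulgA -eb genK.
    move=> /(ord_ok ab (ltn0Sn p)) h; exact: leq_trans pk.
  move=> /mapP[t /refls_del[c [d [l [ey et]]]] eb].
  have eb' : gen b * cw (altw a b n) = cw (altw a b n) * t.
    by rewrite eb conjgE invgK -!mulgA mulVg mulg1.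
  suff /kmax : P n.+1 by rewrite ltnn.
  have eq1 : cw (altw b a n.+1 ++ c ++ d) = cw (i :: u).
    rewrite -ew /= cw_cons !(cw_cat (altw _ _ _)); apply: (mulgI (gen b)).
    by rewrite mulgA genK mul1g mulgA eb' -mulgA et.
  apply: (hP (c ++ d)) => //.
  apply: reduced_eq r _ _; first by rewrite eq1.
  by rewrite ey /= !size_cat /= !size_altw !addnS.
have ht (p : nat) (a b : I) y0 : p <= n -> altw a b n ++ y0 = altw a b p ++ ((if odd p then altw b a (n - p) else altw a b (n - p)) ++ y0).
  by move=> pk; rewrite -{1}(subnKC pk) altwD -catA.
case: Hy => [[r ew]|[r ew]].
  have mk : M i j <= n.
    apply: (Q i j) => //; first by exists v.
    by move=> y' r' e'; apply/asboolP; exists y'; right.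
  rewrite (ht _ _ _ y mk) in r ew.
  by eexists; split; [exact: r | exact: ew].
have ji : j != i by rewrite eq_sym.
have mk : M i j <= n.
  rewrite (cox_sym M); apply: (Q j i) => //; first by exists u.
  by move=> y' r' e'; apply/asboolP; exists y'; left.
rewrite (ht _ _ _ y mk) in r ew.
set z := _ ++ y in r ew.
have e2 : cw (altw i j (M i j) ++ z) = cw (i :: u) by rewrite -ew !cw_cat cw_braid.
exists z; split=> //; apply: reduced_eq r _ _; first by rewrite e2.
by rewrite !size_cat !size_altw.
Qed.

Lemma cw_comm i j u : M i j = 2 -> cw [:: i, j & u] = cw [:: j, i & u].
Proof.
by move=> ij; have := cw_braid i j; rewrite ij /= !cw_cons !cw_nil !mulg1 !mulgA => ->.
Qed.

Lemma cw_peq u v : peq M u v -> cw u = cw v.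
Proof.
move/peq_comm_equiv; elim=> {u v} [u v [a b i j ij]|u|u v w _ h1 _ h2] //; last by rewrite h1.
by rewrite !cw_cat !cw_cons cw_nil mulg1; congr (_ * _); have := cw_comm [::] ij;
  rewrite !cw_cons cw_nil mulg1 => ->.
Qed.

(** The two claims need each other in the induction. Uniqueness for the tail turns the word produced
    by exchange into a member of the class beginning with ii, and turns a dihedral prefix into a
    braid in the class; the first is impossible, and the second leaves only m_ij = 2, where the two
    first letters are swapped. *)
Lemma fc_word_reduced_unique n u : size u <= n -> fc_word M u ->
  reduced u /\ (forall v, reduced v -> cw u = cw v -> peq M u v).
Proof.
elim: n u => [|n ih] u.
  rewrite leqn0 => /eqP/size0nil -> _; split=> [//|v rv e].
  by have := rv [::] e; rewrite leqn0 => /eqP/size0nil ->.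
case: u => [|i u].
  move=> _ _; split=> [//|v rv e].
  by have := rv [::] e; rewrite leqn0 => /eqP/size0nil ->.
rewrite ltnS => su fu; have [ru uu] := ih u su (fc_word_behead fu).
have rr : reduced (i :: u).
  apply: contrapT => /(exchange ru) /refls_del[a [b [j [eu e]]]].
  have e1 : cw u = cw (i :: a ++ b) by rewrite cw_cons -e mulgA genK mul1g.
  have r1 : reduced (i :: a ++ b).
    by apply: reduced_eq ru e1 _; rewrite eu /= !size_cat addnS.
  have [h _] := fu _ (peq_cons i (uu _ r1 e1)).
  exact: (h [::] (a ++ b) i).
split=> // -[|j v] rv e.
  by have := rr [::]; rewrite e => /(_ erefl).
have [eij|ij] := eqVneq i j.
  subst j; apply: peq_cons; apply: uu; first exact: (@reduced_suffix [:: i]).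
  by apply: (mulgI (gen i)); rewrite -!cw_cons.
have [y [ry ey]] := dihedral_prefix ij rr rv e.
have em : altw i j (M i j) = i :: altw j i (M i j).-1 by case: (M i j) (mat_pos i j).
have pu : peq M (i :: u) (altw i j (M i j) ++ y).
  rewrite em cat_cons; apply: peq_cons; apply: uu.
    by apply: (@reduced_suffix [:: i]); rewrite /= -cat_cons -em.
  by apply: (mulgI (gen i)); rewrite -!cw_cons -cat_cons -em.
have m2 : M i j = 2.
  apply: contrapT => m2; have [_ h] := fu _ pu.
  exact: (h [::] y i j ij m2).
rewrite m2 /= in pu ry ey.
have pu' : peq M (i :: u) [:: j, i & y].
  have h : peq M ([:: i; j] ++ y) ([:: j; i] ++ y) by apply: peq_cat => //; exact: (peq_comm (cox_sym M)).
  exact: (peq_trans pu h).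
have fy := fc_word_behead (fc_word_peq pu' fu).
have sy : size (i :: y) <= n by have := peq_size (cox_diag M) pu' => /= -[<-].
apply: (peq_trans pu'); apply: peq_cons.
apply: (ih _ sy fy).2; first exact: (@reduced_suffix [:: j]).
by apply: (mulgI (gen j)); rewrite -!cw_cons -(cw_peq pu') e.
Qed.

Lemma cox_lengthE u : reduced u -> cox_length (cw u) = size u.
Proof.
move=> ru; rewrite /cox_length; case: ex_minnP => n /asboolP[v [sv ev]] nmin.
apply/eqP; rewrite eqn_leq -{2}sv ru // andbT; apply: nmin.
by apply/asboolP; exists u.
Qed.

Lemma reduced_exprP (w : coxGroup M) u : reduced_expr w u -> reduced u.
Proof.
move=> [ew sw] v ev; rewrite sw /cox_length; case: ex_minnP => n _; apply.
by apply/asboolP; exists v; rewrite ev.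
Qed.

Lemma fc_word_fc u : fc_word M u ->
  fully_commutative (cw u) /\ cox_length (cw u) = size u.
Proof.
move=> fu; have [ru uu] := fc_word_reduced_unique (leqnn _) fu.
split; last exact: cox_lengthE.
have P v : reduced_expr (cw u) v -> peq M u v.
  by move=> h; apply: uu; [exact: reduced_exprP h | case: h => ->].
move=> v1 v2 /P h1 /P h2; apply/peq_comm_equiv.
exact: (peq_trans (peq_sym h1) h2).
Qed.

(** A braid in [v] can be replaced by its mirror image without changing the element or the length.
    The new reduced expression has a different projection on i, j, so commutations cannot reach
    it. *)
Lemma fc_reduced_word (w : coxGroup M) u : fully_commutative w -> reduced_expr w u -> fc_word M u.
Proof.
move=> fw ru v uv; have rw : reduced_expr w v.
  by case: ru => e s; split; rewrite -?(cw_peq uv) // -(peq_size (cox_diag M) uv).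
have rv := reduced_exprP rw; split=> [a b i ev|a b i j ij mij ev].
  have := rv (a ++ b); rewrite ev !cw_cat !cw_cons cw_nil mulg1 genK mul1g => /(_ erefl).
  by rewrite !size_cat /=; lia.
have rw' : reduced_expr w (a ++ altw j i (M i j) ++ b).
  case: rw => e s; split; first by rewrite -e ev !cw_cat cw_braid.
  by rewrite -s ev !size_cat !size_altw.
have /comm_equivE/(_ i j mij) := fw _ _ rw rw'.
rewrite ev !filter_cat => /eqP; rewrite eqseq_cat // eqxx /= eqseq_cat.
  by case: (M i j) (mat_pos i j) => //= m _; rewrite !eqxx orbT /= eqseq_cons (negbTE ij).
have e k l : pred2 k l =1 pred2 l k by move=> t /=; rewrite orbC.
move: (M i j) => m.
have f k l n : filter (pred2 k l) (altw k l n) = altw k l n.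
  elim: n k l => //= n ihn k l; rewrite eqxx /= (eq_filter (e k l)).
  by congr (_ :: _); exact: ihn.
by rewrite f (eq_filter (e i j)) f !size_altw.
Qed.
End Exchange.

Section Count.
Variables (I : finType) (M : coxMatrix I).
Hypothesis ord_ok : forall i j (c : nat), i != j -> 0 < c ->
  ((cox_gen M i * cox_gen M j) ^+ c = 1)%g -> M i j <= c.
Hypothesis mat_pos : forall i j, 0 < M i j.

Lemma cox_word_ex_reduced (w : coxGroup M) : exists u, reduced_expr w u.
Proof.
rewrite /reduced_expr /cox_length; case: ex_minnP => n /asboolP[u [su eu]] _.
by exists u.
Qed.

(** The list [s] is a transversal of the commutation classes of fc words; distinct classes give
    distinct elements by uniqueness of reduced words up to commutation. *)
Lemma card_fc_of_length (s : seq (seq I)) k : uniq s ->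
  {in s, forall u, fc_word M u} -> {in s &, forall u v, peq M u v -> u = v} ->
  (forall u, fc_word M u -> exists2 v, v \in s & peq M u v) ->
  #|` fset_set (fc_of_length M k)|%fset = count (fun u => size u == k) s.
Proof.
move=> us fs ijs cs; rewrite -size_filter.
set s' := filter _ s.
have inj : {in s' &, injective (cox_word M)}.
  move=> u v; rewrite !mem_filter => /andP[_ hu] /andP[_ hv] e.
  apply: ijs => //.
  have [ru uu] := fc_word_reduced_unique ord_ok mat_pos (leqnn _) (fs _ hu).
  have [rv _] := fc_word_reduced_unique ord_ok mat_pos (leqnn _) (fs _ hv).
  exact: uu.
have -> : fset_set (fc_of_length M k) = [fset w in map (cox_word M) s']%fset.
  apply/fsetP => w; rewrite in_fset_set; last exact: fc_of_length_finite.
  rewrite inE /=; apply/idP/mapP => [|[u]].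
    rewrite inE => -[fw lw].
    have [u ru] := cox_word_ex_reduced w.
    have [v vs uv] := cs _ (fc_reduced_word mat_pos fw ru).
    exists v; last by rewrite -(cw_peq uv); case: ru.
    by rewrite mem_filter vs -(peq_size (cox_diag M) uv); case: ru => _ ->; rewrite lw eqxx.
  rewrite mem_filter => /andP[/eqP su us'] ->; rewrite inE -su.
  exact: (fc_word_fc ord_ok mat_pos (fs _ us')).
rewrite card_fseq undup_id ?size_map // map_inj_in_uniq ?filter_uniq //.
Qed.
End Count.

(** * Renaming generators as letters of a larger alphabet *)

Section Transport.
Variables (I : finType) (M : coxMatrix I) (T : eqType) (mat : T -> T -> nat).
Variable f : I -> T.
Hypothesis f_inj : injective f.
Hypothesis mat_f : forall i j, mat (f i) (f j) = M i j.
Hypothesis mat_diag : forall a, mat a a = 1.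
Hypothesis mat_ge2 : forall a b, a != b -> 2 <= mat a b.

Lemma peq_map u v : peq mat (map f u) (map f v) <-> peq M u v.
Proof.
have E w i j : filter (pred2 (f i) (f j)) (map f w) = map f (filter (pred2 i j) w).
  by rewrite filter_map; congr map; apply: eq_filter => k /=; rewrite !(inj_eq f_inj).
split=> h i j ij.
  by apply: (inj_map f_inj); rewrite -!E; apply: h; rewrite mat_f.
(* A letter outside the image of [f] never occurs, so a projection involving it reduces to a
   projection on a single letter. *)
have R a b : mat a b <> 2 -> ~~ (a \in codom f) ->
    filter (pred2 a b) (map f u) = filter (pred2 a b) (map f v).
  move=> ab af; have E1 w : filter (pred2 a b) (map f w) = filter (pred2 b b) (map f w).
    apply: eq_in_filter => k /mapP[l _ ->] /=; rewrite orbb.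
    case: eqP => // e; by rewrite -e codom_f in af.
  rewrite !E1; have [bf|bf] := boolP (b \in codom f).
    by case/codomP: bf => k ->; rewrite !E h // (cox_diag M).
  have N w : filter (pred2 b b) (map f w) = [::].
    apply/eqP; rewrite -(negbK (_ == _)) -has_filter; apply/hasPn => k /mapP[l _ ->] /=.
    by rewrite orbb; apply: contra bf => /eqP <-; exact: codom_f.
  by rewrite !N.
have [iF|iF] := boolP (i \in codom f); last exact: R.
have [jF|jF] := boolP (j \in codom f).
  case/codomP: iF ij => i' ->; case/codomP: jF => j' -> ij.
  by rewrite !E h // -mat_f.
have e (k l : T) : pred2 k l =1 pred2 l k by move=> t /=; rewrite orbC.
rewrite !(eq_filter (e i j)).
have [ji|ji] := eqVneq (mat j i) 2; last by apply: R => //; apply/eqP.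
have E1 w : filter (pred2 j i) (map f w) = filter (pred2 i i) (map f w).
  apply: eq_in_filter => k /mapP[l _ ->] /=; rewrite orbb.
  case: eqP => // e'; by rewrite -e' codom_f in jF.
by rewrite !E1; case/codomP: iF => i' ->; rewrite !E h // (cox_diag M).
Qed.

Lemma map_catP (u : seq I) (a b : seq T) : map f u = a ++ b ->
  exists a' b', [/\ u = a' ++ b', a = map f a' & b = map f b'].
Proof.
move=> e; exists (take (size a) u), (drop (size a) u).
by rewrite cat_take_drop map_take map_drop e take_size_cat // drop_size_cat.
Qed.

Lemma map_altw i j n : map f (altw i j n) = altw (f i) (f j) n.
Proof. by elim: n i j => //= n ih i j; rewrite ih. Qed.

Lemma codom_word (u : seq T) : all [in codom f] u -> exists u', u = map f u'.
Proof.
elim: u => [|x u ih] /=; first by exists [::].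
by move=> /andP[/codomP[i ->] /ih[u' ->]]; exists (i :: u').
Qed.

Lemma fc_word_map u : fc_word mat (map f u) <-> fc_word M u.
Proof.
split=> h v uv.
  have [h1 h2] := h _ (proj2 (peq_map _ _) uv).
  split=> [a b i e|a b i j ij mij e].
    by apply: (h1 (map f a) (map f b) (f i)); rewrite e !map_cat.
  apply: (h2 (map f a) (map f b) (f i) (f j)); rewrite ?(inj_eq f_inj) ?mat_f //.
  by rewrite e !map_cat map_altw.
have [w ew] : exists w, v = map f w.
  apply: codom_word; apply/allP => x; rewrite -(perm_mem (peq_perm mat_diag uv)).
  by move=> /mapP[i _ ->]; exact: codom_f.
rewrite ew in uv *; have [h1 h2] := h _ (proj1 (peq_map _ _) uv).
split=> [a b x|a b x y xy mxy].
  move=> /map_catP[a' [b' [e1 _ /esym/map_catP[c' [d' [e2 e3 _]]]]]].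
  case: c' e2 e3 => [|i [|j [|]]] //= e2 [e3 e4]; have /f_inj ? : f i = f j by rewrite -e3.
  by subst j; apply: (h1 a' d' i); rewrite e1 e2.
move=> /map_catP[a' [b' [e1 _ /esym/map_catP[c' [d' [e2 e3 _]]]]]].
have := mat_ge2 xy; have [k] : exists k, k = mat x y by eexists.
move=> ek; rewrite -ek in e3 *; case: k ek e3 => [|[|k]] // ek e3 _.
case: c' e2 e3 => [|i [|j c']] //= e2 [e3 e4 e5]; rewrite e3 e4 in xy mxy ek e5.
have ij : i != j by rewrite (inj_eq f_inj) in xy.
rewrite mat_f in ek mxy.
apply: (h2 a' d' i j ij mxy); rewrite e1 e2 -ek /=.
by congr (_ ++ (_ :: _ :: (_ ++ _))); apply: (inj_map f_inj); rewrite -e5 map_altw.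
Qed.

Hypothesis ord_ok : forall i j (c : nat), i != j -> 0 < c ->
  ((cox_gen M i * cox_gen M j) ^+ c = 1)%g -> M i j <= c.

Lemma card_fc_of_length_words (s : seq (seq T)) k : uniq s ->
  {in s, forall u, all [in codom f] u /\ fc_word mat u} ->
  {in s &, forall u v, peq mat u v -> u = v} ->
  (forall u, all [in codom f] u -> fc_word mat u -> exists2 v, v \in s & peq mat u v) ->
  #|` fset_set (fc_of_length M k)|%fset = count (fun u => size u == k) s.
Proof.
move=> us fs ijs cs.
have mat_pos i j : 0 < M i j.
  have [->|ij] := eqVneq i j; first by rewrite cox_diag.
  by rewrite -mat_f ltnW // mat_ge2 // (inj_eq f_inj).
have [s0 es] : exists s0, s = map (map f) s0.
  have : {in s, forall u, all [in codom f] u} by move=> u /fs [].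
  elim: (s) => [|u t ih] h; first by exists [::].
  have [u' eu] := codom_word (h u (mem_head _ _)).
  have [|t' et] := ih; first by move=> v vt; apply: h; rewrite inE vt orbT.
  by exists (u' :: t'); rewrite eu et.
have finj := inj_map f_inj.
have ms u : (map f u \in s) = (u \in s0) by rewrite es mem_map.
rewrite (card_fc_of_length ord_ok mat_pos (s := s0)).
- rewrite es count_map; apply: eq_count => u /=; by rewrite size_map.
- by move: us; rewrite es map_inj_uniq.
- by move=> u; rewrite -ms => /fs[_ /fc_word_map].
- by move=> u v; rewrite -!ms => hu hv /peq_map /(ijs _ _ hu hv) /finj.
- move=> u /fc_word_map fu; have [|v vs uv] := cs _ _ fu.
    by apply/allP => x /mapP[i _ ->]; exact: codom_f.
  move: vs uv; rewrite {1}es => /mapP[v' v's ->] /peq_map uv.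
  by exists v'.
Qed.

End Transport.

(** * Orders of products of two generators *)

Section Reflections.
Variables (I : finType) (M : coxMatrix I) (c : I -> I -> int).
Local Open Scope ring_scope.
Hypothesis cP : forall i j, i != j ->
  [\/ [/\ M i j = 2%N, c i j = 0 & c j i = 0],
      [/\ M i j = 3%N, c i j = 1 & c j i = 1],
      [/\ M i j = 4%N, c i j = 1 & c j i = 2] |
      [/\ M i j = 4%N, c i j = 2 & c j i = 1]].

(** The simple reflection with off-diagonal Cartan entries -c_ij. The products c_ij c_ji = 4
    cos^2(pi / m_ij) are 0, 1, 2 for m_ij = 2, 3, 4, which is why integers suffice. *)
Definition refl_act (i : I) (g : I -> int) : I -> int :=
  fun l => if l == i then - g i + \sum_(j | j != i) c i j * g j else g l.

Definition word_act (u : seq I) (g : I -> int) := foldr refl_act g u.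

Definition upd2 (i j : I) (g : I -> int) (a b : int) : I -> int :=
  fun l => if l == i then a else if l == j then b else g l.

(** Words in i and j never change this contribution of the other coordinates, so they act on the
    coordinates i, j by affine maps of a plane. *)
Definition rest (i j : I) g := \sum_(l | (l != i) && (l != j)) c i l * g l.

Lemma upd2_id i j g : i != j -> upd2 i j g (g i) (g j) = g.
Proof. by move=> ij; apply/funext => l; rewrite /upd2; do 2?case: eqP => [->|]. Qed.

Lemma upd2C i j g a b : i != j -> upd2 i j g a b = upd2 j i g b a.
Proof.
move=> ij; apply/funext => l; rewrite /upd2.
by case: eqP => [->|//]; rewrite (negbTE ij).
Qed.

Lemma refl_upd2 i j g a b : i != j ->
  refl_act i (upd2 i j g a b) = upd2 i j g (- a + c i j * b + rest i j g) b.
Proof.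
move=> ij; apply/funext => l; rewrite /refl_act.
have ea : upd2 i j g a b i = a by rewrite /upd2 eqxx.
have [->|li] := eqVneq l i; last by rewrite /upd2 (negbTE li).
rewrite ea [RHS]/upd2 eqxx.
rewrite -addrA; congr (_ + _); rewrite (bigD1 j) 1?eq_sym //=.
rewrite /upd2 eqxx eq_sym (negbTE ij); congr (_ + _); apply: eq_bigr => k /andP[ki kj].
by rewrite (negbTE ki) (negbTE kj).
Qed.

Lemma refl_upd2r i j g a b : i != j ->
  refl_act j (upd2 i j g a b) = upd2 i j g a (- b + c j i * a + rest j i g).
Proof.
by move=> ij; rewrite upd2C // refl_upd2 1?eq_sym // upd2C // eq_sym.
Qed.

Lemma refl_actK i g : refl_act i (refl_act i g) = g.
Proof.
apply/funext => l; rewrite {1}/refl_act; case: eqP => [->|nl].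
  have -> : \sum_(j | j != i) c i j * refl_act i g j = \sum_(j | j != i) c i j * g j.
    by apply: eq_bigr => j ji; rewrite /refl_act (negbTE ji).
  by rewrite /refl_act eqxx; ring.
by rewrite /refl_act; case: eqP.
Qed.

Lemma word_act_relator i j g : word_act (flatten (nseq (M i j) [:: i; j])) g = g.
Proof.
have [->|ij] := eqVneq i j; first by rewrite cox_diag /= refl_actK.
rewrite -{1}(upd2_id g ij) -[RHS](upd2_id g ij).
have E := (fun a b => refl_upd2 g a b ij, fun a b => refl_upd2r g a b ij).
by case: (cP ij) => -[-> c1 c2]; rewrite /word_act /= !E c1 c2; congr upd2; ring.
Qed.

Lemma word_act_congr u v g : cox_congr M u v -> word_act u g = word_act v g.
Proof.
move=> h; elim: h g => {u v} [u v [a b i j]|u|u v _ h|u v w _ h1 _ h2] g //; last by rewrite h1 h2.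
have wc w w' g' : word_act (w ++ w') g' = word_act w (word_act w' g').
  exact: foldr_cat.
by rewrite !wc word_act_relator.
Qed.

Lemma gen_order i j (n : nat) : i != j -> (0 < n)%N ->
  ((cox_gen M i * cox_gen M j) ^+ n = 1)%g -> (M i j <= n)%N.
Proof.
move=> ij n0; rewrite -cw_flatten -(cw_nil M) => /cox_wordP h.
have {}h a b := word_act_congr (upd2 i j (fun=> 0) a b) h.
have r0 k l : rest k l (fun=> 0) = 0 by rewrite /rest big1 // => *; rewrite mulr0.
have E := (fun a b => refl_upd2 (fun=> 0) a b ij,
  fun a b => refl_upd2r (fun=> 0) a b ij, r0).
have ji : (j == i) = false by rewrite eq_sym (negbTE ij).
have V a b a' b' : upd2 i j (fun=> 0) a b = upd2 i j (fun=> 0) a' b' -> a = a' /\ b = b'.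
  move=> e; have := congr1 (@^~ i) e; have := congr1 (@^~ j) e.
  by rewrite /upd2 !eqxx ji.
rewrite leqNgt; apply/negP => nM.
(* No power (s_i s_j)^n with 0 < n < m_ij fixes the vector with coordinate 1 at i and 0
   elsewhere. *)
case: (cP ij) => -[m c1 c2]; rewrite m in nM;
  case: n n0 nM h => [|[|[|[|n]]]] // _ _ /(_ 1 0);
  rewrite /word_act /= !E c1 c2 => /V[]; lia.
Qed.

End Reflections.

(** * Alternating words and gaps *)

Section Gap.
Variable T : eqType.
Implicit Types (u v a b c : seq T) (i j : T).

(** Since [b] avoids i, the two letters are consecutive occurrences. The fc property is expressed by
    what must separate them. *)
Definition gap i b u := exists a c, u = a ++ i :: b ++ i :: c /\ i \notin b.

Lemma gap_sub i b u : gap i b u -> {subset b <= u}.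
Proof.
move=> [a [c [-> _]]] x xb; by rewrite mem_cat inE mem_cat xb !orbT.
Qed.

Lemma gap_trans i j b b' u : gap j b u -> gap i b' b -> gap i b' u.
Proof.
move=> [a [c [-> _]]] [a' [c' [-> ib]]]; exists (a ++ j :: a'), (c' ++ j :: c).
by split=> //; rewrite -?catA /= -?catA /= -?catA.
Qed.

Lemma gap_cat i b u v w : gap i b v -> gap i b (u ++ v ++ w).
Proof.
move=> [a [c [-> ib]]]; exists (u ++ a), (c ++ w).
by split=> //; rewrite -?catA /= -?catA /=.
Qed.

Lemma split_first i u : i \in u -> exists a c, u = a ++ i :: c /\ i \notin a.
Proof.
move=> iu; exists (take (index i u) u), (drop (index i u).+1 u); split.
  by rewrite -{1}(cat_take_drop (index i u) u) (drop_nth i) ?index_mem // nth_index.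
by apply: contraT => /negbNE; rewrite in_take // ltnn.
Qed.

Lemma split_last i u : i \in u -> exists a c, u = a ++ i :: c /\ i \notin c.
Proof.
rewrite -mem_rev => /split_first[a [c [e ia]]]; exists (rev c), (rev a).
by rewrite mem_rev -[u]revK e rev_cat rev_cons cat_rcons.
Qed.

Lemma gap_count i u : 2 <= count_mem i u -> exists b, gap i b u.
Proof.
move=> c2; have /split_first[a [u' [e ia]]] : i \in u.
  by rewrite -has_pred1 has_count (ltn_trans _ c2).
have /split_first[b [c [e' ib]]] : i \in u'.
  rewrite -has_pred1 has_count; move: c2.
  by rewrite e count_cat /= eqxx (count_memPn ia).
by exists b, a, c; rewrite e e'.
Qed.

Lemma gap_count_ge i b u : gap i b u -> 2 <= count_mem i u.
Proof. by move=> [a [c [-> _]]]; rewrite count_cat /= count_cat /= eqxx; lia. Qed.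

Lemma count_gap2 i a b c : count_mem i (a ++ i :: b ++ i :: c) = 2 ->
  [/\ i \notin a, i \notin b & i \notin c].
Proof.
rewrite count_cat /= count_cat /= eqxx => h.
by split; apply/count_memPn; lia.
Qed.

Lemma gap_ends i w b : i \notin w -> gap i b (i :: rcons w i) -> b = w.
Proof.
move=> iw [a [c [e ib]]].
have : count_mem i (i :: rcons w i) = 2.
  by rewrite /= -cats1 count_cat /= eqxx (count_memPn iw).
rewrite e => /count_gap2[ia _ ic].
case: a e ia => [|x a] /= [] => [e|<- _]; last by rewrite mem_head.
case/lastP: c e ic => [|c z]; first by rewrite cats1 => /rcons_inj[].
rewrite -rcons_cons -rcons_cat => /rcons_inj[_ <-].
by rewrite mem_rcons mem_head.
Qed.

Lemma gap_filter (P : pred T) i b u : P i -> gap i b u -> gap i (filter P b) (filter P u).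
Proof.
move=> Pi [a [c [-> ib]]]; exists (filter P a), (filter P c); split.
  by rewrite filter_cat /= Pi filter_cat /= Pi.
by rewrite mem_filter (negbTE ib) andbF.
Qed.

Lemma filter_cat_inv (P : pred T) i u a c : filter P u = a ++ i :: c ->
  exists a' c', [/\ u = a' ++ i :: c', filter P a' = a & filter P c' = c].
Proof.
elim: u a => [|x u ih] a /=; first by case: a.
case: ifP => Px; last first.
  by move=> /ih[a' [c' [-> e1 e2]]]; exists (x :: a'), c'; rewrite /= Px.
case: a => [|y a] /=.
  by move=> [<- <-]; exists [::], u.
by move=> [<- /ih[a' [c' [-> e1 e2]]]]; exists (x :: a'), c'; rewrite /= Px e1.
Qed.

Lemma gap_filter_inv (P : pred T) i b u : gap i b (filter P u) ->
  exists2 b0, gap i b0 u & filter P b0 = b.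
Proof.
move=> [a [c [e ib]]].
have Pi : P i.
  have : i \in filter P u by rewrite e mem_cat mem_head orbT.
  by rewrite mem_filter => /andP[].
have [a' [c' [-> _ e2]]] := filter_cat_inv e.
have [b0 [c0 [-> e3 _]]] := filter_cat_inv e2.
exists b0 => //; exists a', c0; split => //.
apply: contra ib => ib0; by rewrite -e3 mem_filter Pi.
Qed.

Lemma sorted_neq_gap i j u : all (pred2 i j) u ->
  (forall b, gap i b u -> j \in b) -> (forall b, gap j b u -> i \in b) ->
  sorted (fun x y => x != y) u.
Proof.
elim: u => // x u ih /= /andP[xij uij] hi hj.
have {ih} su : sorted (fun x y => x != y) u.
  by apply: ih => // b /(gap_cat [:: x] [::]); rewrite cats0 => /=; [exact: hi|exact: hj].
case: u uij hi hj su => //= y u /andP[yij uij] hi hj ->; rewrite andbT.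
apply/eqP => e; subst y; have g : gap x [::] [:: x, x & u] by exists [::], u.
by case/orP: xij => /eqP e; subst x; [have := hi _ g | have := hj _ g].
Qed.

Lemma sorted_neq_altw i j u : i != j -> all (pred2 i j) u ->
  sorted (fun x y => x != y) u ->
  u = altw i j (size u) \/ u = altw j i (size u).
Proof.
move=> ij; elim: u => [|x u ih]; first by left.
move=> /= /andP[xij uij] pu.
have [] := ih uij (path_sorted pu); case: u pu uij {ih} => [|y u] /=;
  try by (case/orP: xij => /eqP ->; [left|right]).
- move=> /andP[xy _] _ [ey eu]; case/orP: xij xy => /eqP ->; rewrite ey ?eqxx // => _.
  by right; rewrite eu size_altw.
- move=> /andP[xy _] _ [ey eu]; case/orP: xij xy => /eqP ->; rewrite ey ?eqxx // => _.
  by left; rewrite eu size_altw.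
Qed.

Lemma sorted_altw i j n : i != j -> sorted (fun x y => x != y) (altw i j n).
Proof.
elim: n i j => //= n ih i j ij; have := ih j i; rewrite eq_sym => /(_ ij).
by case: n {ih} => //= n ->; rewrite ij.
Qed.

Lemma count_altw i j n : i != j ->
  count_mem i (altw i j n) = uphalf n /\ count_mem j (altw i j n) = n./2.
Proof.
elim: n i j => //= n ih i j ij; have [] := ih j i; first by rewrite eq_sym.
by rewrite eqxx (negbTE ij) => -> -> ; split=> //; rewrite add1n.
Qed.

Lemma all_altw i j n : all (pred2 i j) (altw i j n).
Proof.
elim: n i j => //= n ih i j; rewrite eqxx /=; apply: sub_all (ih j i) => x /=.
by rewrite orbC.
Qed.

Lemma gap_altw i j n b : i != j ->
  (gap i b (altw i j n) -> j \in b) /\ (gap j b (altw i j n) -> i \in b).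
Proof.
have H k l u b' : all (pred2 k l) u -> sorted (fun x y => x != y) u -> gap k b' u -> l \in b'.
  move=> al su [a [c [e kb]]].
  case: b' kb e => [|x b'] kb e.
    by move: su; rewrite e => /(cat_sorted2)[_] /=; rewrite eqxx.
  have : x \in u by rewrite e mem_cat !inE eqxx !orbT.
  move=> /(allP al) /= /orP[]/eqP ex; last by rewrite ex mem_head.
  by rewrite ex mem_head in kb.
move=> ij; split; first exact: (H _ _ _ _ (all_altw _ _ _) (sorted_altw _ ij)).
apply: H (sorted_altw _ ij); apply: sub_all (all_altw i j n) => x /=; by rewrite orbC.
Qed.
End Gap.

Section Alternating.
Variables (o n : nat).
Hypothesis on : o != n.

(* All alternating words in o and n with h letters o, each with its number of
   letters n. *)
Definition alts h : seq (seq nat * nat) :=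
  [:: (altw n o h.*2.+1, h.+1); (altw o n h.*2, h)] ++
  (if h is h'.+1 then [:: (altw n o h.*2, h); (altw o n h'.*2.+1, h')] else [::]).

(** At the start of a peak the two letters n have no o between them. Consecutive letters o must
    enclose an n, so each side of nn carries at most one o, and h is at most 2. *)
Definition doublings h : seq (seq nat) :=
  match h with
  | 0 => [:: [:: n; n]]
  | 1 => [:: [:: o; n; n]; [:: n; n; o]]
  | 2 => [:: [:: o; n; n; o]]
  | _ => [::]
  end.

Lemma alts_altw h p : p \in alts h ->
  exists k, p.1 = altw o n k \/ p.1 = altw n o k.
Proof.
rewrite mem_cat => /orP[].
  by rewrite !inE => /orP[]/eqP ->; eexists; [right|left].
by case: h => // h; rewrite !inE => /orP[]/eqP ->; eexists; [right|left].
Qed.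

Lemma alts_spec h p : p \in alts h ->
  [/\ all (pred2 o n) p.1, count_mem o p.1 = h, count_mem n p.1 = p.2 &
      sorted (fun x y => x != y) p.1].
Proof.
have no : n != o by rewrite eq_sym.
have A k : all (pred2 o n) (altw n o k).
  by apply: sub_all (all_altw n o k) => x /=; rewrite orbC.
rewrite mem_cat => /orP[].
  rewrite !inE => /orP[]/eqP ->.
  - have [e1 e2] := count_altw h.*2.+1 no.
    rewrite e1 e2 A; split=> //; by [rewrite /= ?uphalf_double ?doubleK | exact: sorted_altw].
  - have [e1 e2] := count_altw h.*2 on.
    rewrite e1 e2 all_altw; split=> //; by [rewrite /= ?uphalf_double ?doubleK | exact: sorted_altw].
case: h => // h; rewrite !inE => /orP[]/eqP ->.
- have [e1 e2] := count_altw h.+1.*2 no.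
  rewrite e1 e2 A; split=> //; by [rewrite /= ?uphalf_double ?doubleK | exact: sorted_altw].
- have [e1 e2] := count_altw h.*2.+1 on.
  rewrite e1 e2 all_altw; split=> //; by [rewrite /= ?uphalf_double ?doubleK | exact: sorted_altw].
Qed.

Lemma alts_gap h p b : p \in alts h ->
  (gap o b p.1 -> n \in b) /\ (gap n b p.1 -> o \in b).
Proof.
have no : n != o by rewrite eq_sym.
move=> /alts_altw[k [|] ->]; first exact: gap_altw.
by have [] := gap_altw k b no.
Qed.

Lemma alts_complete p : all (pred2 o n) p -> sorted (fun x y => x != y) p ->
  (p, count_mem n p) \in alts (count_mem o p).
Proof.
have no : n != o by rewrite eq_sym.
move=> ap /(sorted_neq_altw on ap) []; move: (size p) => k ->.
  have [-> ->] := count_altw k on.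
  rewrite -[k in altw _ _ k]odd_double_half uphalf_half; case: (odd k).
    rewrite !add1n; case: (k./2) => [|h]; rewrite mem_cat !inE eqxx ?orbT //.
  rewrite !add0n; case: (k./2) => [|h]; by rewrite mem_cat !inE eqxx ?orbT.
have [-> ->] := count_altw k no.
rewrite -[k in altw _ _ k]odd_double_half uphalf_half; case: (odd k).
  by rewrite !add1n mem_cat mem_head.
by rewrite !add0n; case: (k./2) => [|h]; rewrite mem_cat !inE eqxx ?orbT.
Qed.

Lemma alts_uniq h : uniq (alts h).
Proof.
have no : (n == o) = false by rewrite eq_sym (negbTE on).
apply: (@map_uniq _ _ (fun p => (head 0 p.1, p.2))).
case: h => [|h]; rewrite /= !inE !xpair_eqE ?no ?(negbTE on) ?eqxx ?andbF //=.
lia.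
Qed.

Lemma doublings_spec h p : p \in doublings h ->
  [/\ all (pred2 o n) p, count_mem o p = h, count_mem n p = 2 &
      gap n [::] p].
Proof.
have no : (n == o) = false by rewrite eq_sym (negbTE on).
have on' := negbTE on.
case: h => [|[|[|h]]] //=; rewrite !inE ?orbF.
- by move=> /eqP ->; rewrite /= !eqxx no orbT; split=> //; exists [::], [::].
- move=> /orP[]/eqP ->; rewrite /= !eqxx no on' orbT; split=> //.
  + by exists [:: o], [::].
  + by exists [::], [:: o].
- by move=> /eqP ->; rewrite /= !eqxx no on' orbT; split=> //; exists [:: o], [:: o].
Qed.

Lemma doublings_gap h p b : p \in doublings h -> gap o b p -> b = [:: n; n].
Proof.
move=> ph g; have := gap_count_ge g; have [_ -> _ _] := doublings_spec ph.
move: ph g; case: h => [|[|[|h]]] //=; rewrite inE => /eqP -> g _.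
by apply: (gap_ends (w := [:: n; n]) _ g); rewrite !inE orbb.
Qed.

Lemma doublings_complete l r :
  all (pred1 o) l -> all (pred1 o) r -> size l <= 1 -> size r <= 1 ->
  l ++ [:: n, n & r] \in doublings (count_mem o (l ++ [:: n, n & r])).
Proof.
have no : (n == o) = false by rewrite eq_sym (negbTE on).
case: l => [|x [|]] //=; case: r => [|y [|]] //=; rewrite ?no ?andbT => *;
  repeat match goal with H : is_true (_ == o) |- _ => move/eqP: H => -> end;
  by rewrite ?eqxx ?no /= !inE eqxx ?orbT.
Qed.

Lemma doublings_uniq h : uniq (doublings h).
Proof.
case: h => [|[|[|h]]] //=; by rewrite inE !eqseq_cons (negbTE on).
Qed.

End Alternating.

(** * The automaton along a path of simple edges *)

(* [Some h]: letter o occurs h times and between two of its occurrences there is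
   an o-1; [None]: it occurs exactly twice, with no o-1 in between. *)
Notation state := (option nat).
Definition ht (s : state) := if s is Some h then h else 2.

(** A peak propagates: a gap of o without o-1 needs two letters o+1, and no further o+1 occurs
    elsewhere. There is no way back from [None]. *)
Definition trans o (s : state) : seq (seq nat * state) :=
  if s is Some h then
    [seq (p.1, Some p.2) | p <- alts o o.+1 h] ++
    [seq (p, None) | p <- doublings o o.+1 h]
  else [:: ([:: o; o.+1; o.+1; o], None)].

(** The letter 0 is not a generator. It serves as an absent neighbour below letter 1, so that every
    run starts at [Some 0]. *)
Fixpoint run m (u : seq nat) (s : state) : Prop :=
  if m is o.+1 then
    exists2 s', run o u s' & (filter (pred2 o o.+1) u, s) \in trans o s'
  else s = Some 0.

Lemma trans_spec o s p s' : (p, s') \in trans o s ->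
  [/\ all (pred2 o o.+1) p, count_mem o p = ht s & count_mem o.+1 p = ht s'].
Proof.
have oo : o != o.+1 by lia.
case: s => [h|]; rewrite /trans; last first.
  by rewrite inE xpair_eqE => /andP[/eqP -> /eqP ->] /=; rewrite !eqxx; split=> //; lia.
rewrite mem_cat => /orP[] /mapP[].
  by move=> [p0 h'] /(alts_spec oo) /= [h1 h2 h3 _] [-> ->].
by move=> p0 /(doublings_spec oo) [h1 h2 h3 _] [-> ->].
Qed.

Lemma trans_gap o s p s' b : (p, s') \in trans o s -> gap o b p ->
  o.+1 \in b /\ (s = None -> 2 <= count_mem o.+1 b).
Proof.
have oo : o != o.+1 by lia.
case: s => [h|]; rewrite /trans; last first.
  rewrite inE xpair_eqE => /andP[/eqP -> _] g.
  have -> : b = [:: o.+1; o.+1].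
    by apply: (doublings_gap oo _ g (h := 2)); rewrite mem_head.
  by rewrite mem_head /= eqxx.
rewrite mem_cat => /orP[] /mapP[].
  move=> [p0 h'] p0a [-> _] g; split=> //.
  by have [h1 _] := alts_gap oo b p0a; exact: h1.
by move=> p0 p0a [-> _] g; rewrite (doublings_gap oo p0a g) mem_head.
Qed.

Lemma trans_gapr o s p h b : (p, Some h) \in trans o s -> gap o.+1 b p -> o \in b.
Proof.
have oo : o != o.+1 by lia.
case: s => [h'|]; rewrite /trans; last by rewrite inE xpair_eqE andbF.
rewrite mem_cat => /orP[] /mapP[] // [p0 h0] p0a [-> _].
by have [_] := alts_gap oo b p0a.
Qed.

(** Determinism: the height is a multiplicity, and the empty gap of a doubled letter is impossible
    in an alternating word. A class is thus counted for one state only. *)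
Lemma trans_fun o s p s1 s2 : (p, s1) \in trans o s -> (p, s2) \in trans o s -> s1 = s2.
Proof.
have oo : o != o.+1 by lia.
case: s => [h|]; rewrite /trans; last first.
  by rewrite !inE !xpair_eqE => /andP[_ /eqP ->] /andP[_ /eqP ->].
rewrite !mem_cat => /orP[] /mapP[p0 h0 [-> ->]] /orP[] /mapP[p1 h1 [e ->]] //.
- have [_ _ <- _] := alts_spec oo h0; have [_ _ <- _] := alts_spec oo h1.
  by rewrite e.
- have [_ _ _ g] := doublings_spec oo h1; rewrite -e in g.
  by have [_ /(_ g)] := alts_gap oo [::] h0.
- have [_ _ _ g] := doublings_spec oo h0; rewrite e in g.
  by have [_ /(_ g)] := alts_gap oo [::] h1.
Qed.

Lemma trans_uniq o s : uniq (trans o s).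
Proof.
have oo : o != o.+1 by lia.
case: s => [h|]; rewrite /trans // cat_uniq !map_inj_uniq ?alts_uniq ?doublings_uniq //.
- rewrite andbT; apply/hasPn => x /mapP[p _ ->]; apply/negP => /mapP[q _ ] //.
- by move=> p p' [].
- by move=> [p h1] [p' h2] /= [-> ->].
Qed.

Lemma run_ext m u v s :
  (forall o, o < m -> filter (pred2 o o.+1) u = filter (pred2 o o.+1) v) ->
  run m u s -> run m v s.
Proof.
elim: m s => //= m ih s e [s' r t]; exists s'.
  by apply: ih r => o om; apply: e; rewrite ltnW.
by rewrite -e.
Qed.

Lemma run_low m u s : run m (filter (fun x => x <= m) u) s <-> run m u s.
Proof.
split; apply: run_ext => o om; rewrite -filter_predI; [|symmetry]; apply: eq_filter => x /=; lia.
Qed.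

(** * Fc words follow the automaton, the end of the diagram entering only through hypotheses *)

Section RunExists.
Variables (m : nat) (u : seq nat).
Hypothesis u0 : 0 \notin u.
Hypothesis gap_low : forall i b, 0 < i < m -> gap i b u ->
  2 <= count_mem i.-1 b + count_mem i.+1 b.
Hypothesis gap_m : forall b, 0 < m -> gap m b u ->
  has (fun x => m < x) b \/ 2 <= count_mem m.-1 b.

(** A gap of i without a neighbour above would contain two letters i-1, hence a gap of i-1; by
    induction that gap contains i, which is absurd inside a gap of i. *)
Lemma gap_up i b : i <= m -> gap i b u ->
  if i < m then i.+1 \in b else has (fun x => m < x) b.
Proof.
elim: i b => [|i ih] b im g.
  by have /(count_memPn) := u0; have := gap_count_ge g; lia.
have down : 2 <= count_mem i b -> False.
  move=> /gap_count[b' g']; have := ih b' (ltnW im) (gap_trans g g').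
  rewrite im => h; have := gap_sub g' h.
  by case: g => a [c [_ /negP]].
case: ltnP => [lim|mi].
  have := @gap_low i.+1 b lim g; have [//|nib] := boolP (i.+2 \in b).
  by rewrite (count_memPn nib) addn0 /= => /down.
have ei : i.+1 = m by lia.
rewrite ei in g; case: (gap_m _ g) => //; first by rewrite -ei.
by rewrite -ei => /down.
Qed.

Hypothesis gap_peak : forall b, 0 < m -> gap m b u -> m.-1 \notin b -> count_mem m u = 2.

Lemma gap_ascend i b : 0 < i < m -> gap i b u -> i.-1 \notin b ->
  exists2 b', gap i.+1 b' b & i \notin b'.
Proof.
move=> im g ib; have := gap_low im g; rewrite (count_memPn ib) add0n.
move=> /gap_count[b' g']; exists b' => //.
by case: g => a [c [_]]; apply: contra; exact: (gap_sub g').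
Qed.

(** Induction from the special end downwards. The gap contains a gap of i+1 without i, whose ends
    are by induction the only letters i+1 of [u]. A third i would create a neighbouring gap, and by
    [gap_up] another i+1. *)
Lemma peak_count2 i b : 0 < i <= m -> gap i b u -> i.-1 \notin b -> count_mem i u = 2.
Proof.
have [k ek] : exists k, k = m - i by eexists.
elim: k i b ek => [|k ih] i b ek im g ib.
  have ei : i = m by lia.
  by rewrite ei in g ib *; apply: gap_peak g ib; lia.
have lim : 0 < i < m by lia.
have [b' g' ib'] := gap_ascend lim g ib.
have c2 : count_mem i.+1 u = 2.
  by apply: (ih i.+1 b') => //; [lia | lia | exact: gap_trans g g'].
have up b1 : gap i b1 u -> 0 < count_mem i.+1 b1.
  move=> /gap_up; rewrite (_ : i < m) //; last by case/andP: lim.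
  by rewrite -has_count has_pred1; apply; lia.
have := gap_count_ge g'.
apply: contraPeq => nc; apply/negP; rewrite -ltnNge.
have : exists b1, gap i b1 u /\ count_mem i.+1 b1 + count_mem i.+1 b <= count_mem i.+1 u.
  case: (g) => a [c [e nib]].
  have [ia|ia] := boolP (i \in a).
    have [a1 [a2 [ea ia2]]] := split_last ia; exists a2; split.
      by exists a1, (b ++ i :: c); rewrite e ea -catA.
    by rewrite e ea !count_cat /= !count_cat /=; lia.
  have [ic|ic] := boolP (i \in c).
    have [c1 [c2' [ec ic1]]] := split_first ic; exists c1; split.
      by exists (a ++ i :: b), c2'; rewrite e ec -catA.
    by rewrite e ec !count_cat /= !count_cat /= !count_cat /=; lia.
  by exfalso; move/eqP: nc; apply; rewrite e count_cat /= count_cat /= eqxx !(count_memPn _).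
move=> [b1 [g1]]; rewrite c2; have := up _ g1; lia.
Qed.

Definition state_ok i (s : state) :=
  if s is Some h then count_mem i u = h /\ (forall b, gap i b u -> i.-1 \in b /\ 0 < i)
  else [/\ count_mem i u = 2, 0 < i & exists2 b, gap i b u & i.-1 \notin b].

Lemma count_pred2 i j (b : seq nat) k : i != j -> k \in [:: i; j] ->
  count_mem k (filter (pred2 i j) b) = count_mem k b.
Proof.
move=> ij; rewrite count_filter => kij; apply: eq_count => x /=.
by move: kij; rewrite !inE; case: (eqVneq x k) => //= ->.
Qed.

Lemma filter_pred2_nil i j (b : seq nat) : i \notin b -> j \notin b -> filter (pred2 i j) b = [::].
Proof.
move=> ib jb; apply/eqP; rewrite -(negbK (_ == _)) -has_filter; apply/hasPn => x xb /=.
by apply/orP => -[] /eqP e; subst x; [rewrite xb in ib | rewrite xb in jb].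
Qed.

Lemma run_step i s : i < m -> state_ok i s ->
  exists2 s', (filter (pred2 i i.+1) u, s') \in trans i s & state_ok i.+1 s'.
Proof.
move=> im; have ii : i != i.+1 by lia.
set p := filter _ _.
have ap : all (pred2 i i.+1) p by exact: filter_all.
have ci : count_mem i p = count_mem i u by apply: count_pred2; rewrite ?inE ?eqxx.
have ci1 : count_mem i.+1 p = count_mem i.+1 u by apply: count_pred2; rewrite ?inE ?eqxx ?orbT.
have up b : gap i b u -> i.+1 \in b by move=> /gap_up; rewrite im; apply; lia.
case: s => [h [eh hb]|[c2 i0 [b g ib]]]; rewrite /trans.
  have [al|/existsNP[b /not_implyP[g /negP ib]]] := pselect (forall b, gap i.+1 b u -> i \in b).
    exists (Some (count_mem i.+1 u)).
      rewrite mem_cat; apply/orP; left; apply/mapP; exists (p, count_mem i.+1 p) => //=.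
        rewrite -eh -ci; apply: alts_complete => //.
        apply: (sorted_neq_gap (i := i) (j := i.+1)) => // b /gap_filter_inv[b0 g <-].
          by rewrite mem_filter up //= eqxx orbT.
        by rewrite mem_filter al //= eqxx.
      by rewrite ci1.
    by split=> // b /al.
  have cc := peak_count2 (i := i.+1) im g ib.
  exists None; last by split=> //; exists b.
  rewrite mem_cat; apply/orP; right; apply/mapP; exists p => //.
  case: (g) => a [c [e ib1]].
  have [ia ic] : i.+1 \notin a /\ i.+1 \notin c.
    by move: cc; rewrite e => /count_gap2[].
  have ep : p = filter (pred2 i i.+1) a ++ [:: i.+1, i.+1 & filter (pred2 i i.+1) c].
    by rewrite /p e filter_cat /= eqxx orbT filter_cat (filter_pred2_nil ib ib1) /= eqxx orbT.
  (* A factor without i+1 has no gap of i, by [up], hence at most one i; this applies to both sides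
     of the doubled letter. *)
  have F (v : seq nat) : (exists v1 v2, u = v1 ++ v ++ v2) -> i.+1 \notin v ->
      all (pred1 i) (filter (pred2 i i.+1) v) /\ size (filter (pred2 i i.+1) v) <= 1.
    move=> [v1 [v2 ev]] iv; have av : all (pred1 i) (filter (pred2 i i.+1) v).
      apply/allP => x; rewrite mem_filter => /andP[/orP[]//= /eqP -> iv'].
      by rewrite iv' in iv.
    split=> //; rewrite leqNgt; apply/negP => s2.
    have : 2 <= count_mem i v.
      rewrite -(count_pred2 (i := i) (j := i.+1)) ?inE ?eqxx //.
      by move: av; rewrite all_count => /eqP ->.
    move=> /gap_count[b1 g1]; have := up b1; rewrite ev => h1.
    have := gap_sub g1 (h1 (gap_cat v1 v2 g1)); by apply/negP.
  have [a1 a2] := F a (ex_intro _ [::] (ex_intro _ _ e)) ia.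
  have [c1 c2] : all (pred1 i) (filter (pred2 i i.+1) c) /\ size (filter (pred2 i i.+1) c) <= 1.
    apply: F ic; exists (a ++ i.+1 :: b ++ [:: i.+1]), [::].
    by rewrite e cats0 -catA /= -catA.
  rewrite -eh -ci ep; apply: doublings_complete => //.
have [b' g' ib'] := gap_ascend (i := i) (b := b) (introT andP (conj i0 im)) g ib.
have g1 := gap_trans g g'.
have cc := peak_count2 (i := i.+1) im g1 ib'.
exists None; last by split=> //; exists b'.
rewrite inE xpair_eqE eqxx andbT /p; case: (g) => a [c [e nib]].
have [ia nib0 ic] : [/\ i \notin a, i \notin b & i \notin c].
  by move: c2; rewrite e => /count_gap2.
have [ja jc cb] : [/\ i.+1 \notin a, i.+1 \notin c & count_mem i.+1 b = 2].
  have := gap_count_ge g'; move: (cc); rewrite e count_cat /= count_cat /= (negbTE ii) => h1 h2.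
  have E (x y z : nat) : x + (0 + (y + (0 + z))) = 2 -> 1 < y -> x = 0 /\ z = 0 /\ y = 2.
    by lia.
  by have [x0 [z0 ->]] := E _ _ _ h1 h2; split=> //; apply/count_memPn.
rewrite e filter_cat /= eqxx filter_cat /= eqxx !(filter_pred2_nil ia, filter_pred2_nil ic) //=.
rewrite eqseq_cons eqxx /=.
have : all (pred1 i.+1) (filter (pred2 i i.+1) b).
  apply/allP => x; rewrite mem_filter => /andP[/orP[]//= /eqP -> iv'].
  by rewrite iv' in nib.
have : count_mem i.+1 (filter (pred2 i i.+1) b) = 2.
  by rewrite count_pred2 ?inE ?eqxx ?orbT.
move=> hc /all_pred1P e2; move: hc; rewrite e2 count_nseq /= eqxx mul1n => ->.
by rewrite !eqxx.
Qed.

Lemma run_exists i : i <= m -> exists2 s, run i u s & state_ok i s.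
Proof.
elim: i => [|i ih] im.
  exists (Some 0) => //=; split; first exact/count_memPn.
  by move=> b /gap_count_ge; rewrite (count_memPn u0).
have [s r ok] := ih (ltnW im); have [s' t ok'] := run_step im ok.
by exists s' => //; exists s.
Qed.

End RunExists.

(* Amalgamates u and p along the letter o, which occurs equally often in both. *)
Fixpoint weave (o : nat) (u p : seq nat) : seq nat :=
  match p with
  | [::] => u
  | c :: p' =>
    if c == o then take (index o u).+1 u ++ weave o (drop (index o u).+1 u) p'
    else c :: weave o u p'
  end.

Lemma filter_none (T : eqType) (P : pred T) s : {in s, forall y, ~~ P y} -> filter P s = [::].
Proof.
by move=> h; rewrite (eq_in_filter (a2 := pred0)) ?filter_pred0 // => y /h/negbTE.
Qed.

Definition le_word o := filter (fun y => y <= o).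
Definition ge_word o := filter (fun y => o <= y).

Lemma weave_low_high o u p : all (fun y => y <= o) u -> all (fun y => o <= y) p ->
  count_mem o u = count_mem o p ->
  le_word o (weave o u p) = u /\ ge_word o (weave o u p) = p.
Proof.
rewrite /le_word /ge_word.
elim: p u => [|c p ih] u au /=.
  move=> _ /count_memPn ou; split; first exact/all_filterP.
  apply: filter_none => y yu.
  rewrite -ltnNge ltn_neqAle (allP au) // andbT; by apply: contraNneq ou => <-.
move=> /andP[oc ap]; case: eqP => [->|co] cu.
  have /split_first[a [w [eu oa]]] : o \in u by rewrite -has_pred1 has_count cu.
  have -> : take (index o u).+1 u = rcons a o.
    rewrite eu index_cat (negbTE oa) /= eqxx addn0 take_cat ltnNge leqnSn /=.
    by rewrite subSn // subnn /= take0 cats1.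
  have -> : drop (index o u).+1 u = w.
    rewrite eu index_cat (negbTE oa) /= eqxx addn0 drop_cat ltnNge leqnSn /=.
    by rewrite subSn // subnn /= drop0.
  move: au cu; rewrite eu all_cat /= => /and3P[aa _ aw].
  rewrite count_cat /= eqxx (count_memPn oa) add0n => -[cw].
  have [e1 e2] := ih w aw ap cw.
  rewrite !filter_cat e1 e2 -!cats1 !filter_cat /= leqnn -catA; split=> /=.
    by congr (_ ++ _); apply/all_filterP.
  rewrite (filter_none (s := a)) // => y ya.
  by rewrite -ltnNge ltn_neqAle (allP aa) // andbT; apply: contraNneq oa => <-.
have [e1 e2] := ih u au ap cu.
rewrite /= e1 e2 oc; case: leqP => // co'; by case: co; lia.
Qed.

Lemma pred2_ge_word o u : all (fun y => 0 < y <= o.+1) u ->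
  filter (pred2 o o.+1) u = ge_word o u.
Proof.
move=> au; apply: eq_in_filter => y /(allP au) /andP[_ yo] /=.
by move: yo; clear; lia.
Qed.

Lemma size_weave o u p : all (fun y => y <= o) u -> all (fun y => o <= y) p ->
  count_mem o u = count_mem o p ->
  size (weave o u p) = size u + count (fun y => o < y) p.
Proof.
move=> au ap cu; have [e1 e2] := weave_low_high au ap cu.
rewrite -(count_predC (fun y => y <= o)) -size_filter -/(le_word _ _) e1; congr addn.
rewrite -[in RHS]e2 /ge_word count_filter; apply: eq_count => y /=; lia.
Qed.

Lemma mem_weave o u p y : all (fun y => y <= o) u -> all (fun y => o <= y) p ->
  count_mem o u = count_mem o p ->
  (y \in weave o u p) = (y \in u) || (y \in p).
Proof.
move=> au ap cu; have [e1 e2] := weave_low_high au ap cu.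
rewrite -{2}e1 -{3}e2 !mem_filter; case: leqP => yo /=; last by rewrite ltnW.
by case: leqP => /=; rewrite ?orbb ?orbF.
Qed.

Section PeqSplit.
Variables (mat : nat -> nat -> nat) (o : nat).
Hypothesis mat_split : forall i j, mat i j <> 2 -> (i <= o) && (j <= o) || (o <= i) && (o <= j).

Lemma peq_filter (P : pred nat) u v : peq mat u v -> peq mat (filter P u) (filter P v).
Proof.
move=> uv i j ij; have E w : filter (pred2 i j) (filter P w) = filter P (filter (pred2 i j) w).
  by rewrite -!filter_predI; apply: eq_filter => y /=; rewrite andbC.
by rewrite !E uv.
Qed.

(** The letter o cuts the diagram: no letter below it is joined to a letter above it, so every
    relevant projection lies on one side. *)
Lemma peq_glue u v : peq mat (le_word o u) (le_word o v) ->
  peq mat (ge_word o u) (ge_word o v) -> peq mat u v.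
Proof.
move=> h1 h2 i j ij.
case/orP: (mat_split ij) => /andP[ho hj].
  have E w : filter (pred2 i j) w = filter (pred2 i j) (le_word o w).
    rewrite -filter_predI; apply: eq_filter => y /=; case: eqP => [->|_]; first by rewrite ho.
    by case: eqP => [->|_] //=; rewrite hj.
  by rewrite (E u) (E v) h1.
have E w : filter (pred2 i j) w = filter (pred2 i j) (ge_word o w).
  rewrite -filter_predI; apply: eq_filter => y /=; case: eqP => [->|_]; first by rewrite ho.
  by case: eqP => [->|_] //=; rewrite hj.
by rewrite (E u) (E v) h2.
Qed.
End PeqSplit.

(** One representative for each class accepted up to letter m, with its final state; [weave] selects
    the representative. *)
Fixpoint tails m : seq (seq nat * state) :=
  if m is o.+1 then
    [seq (weave o us.1 ps.1, ps.2) | us <- tails o, ps <- trans o us.2]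
  else [:: ([::], Some 0)].

Lemma trans_le o s p s' : (p, s') \in trans o s -> all (fun y => o <= y) p.
Proof. by move=> /trans_spec[ap _ _]; apply: sub_all ap => y /= /orP[]/eqP ->. Qed.

Lemma tails_spec m u s : (u, s) \in tails m ->
  [/\ all (fun y => 0 < y <= m) u, run m u s & count_mem m u = ht s].
Proof.
elim: m u s => [|o ih] u s; first by rewrite inE => /eqP[-> ->].
move=> /allpairsPdep[[w s1] [[p s2] [/ih[aw rw cw] pt] [-> ->]]] /=.
rewrite /= in pt; have [ap cp cp'] := trans_spec pt; have gp := trans_le pt.
have lw : all (fun y => y <= o) w by apply: sub_all aw => y /andP[].
rewrite -cp in cw; have [e1 e2] := weave_low_high lw gp cw.
have ew : filter (pred2 o o.+1) (weave o w p) = p.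
  rewrite -[RHS]e2 /ge_word; apply: eq_in_filter => y.
  rewrite (mem_weave y lw gp cw) => /orP[/(allP lw)|/(allP ap)] /=; lia.
split.
- apply/allP => y; rewrite (mem_weave y lw gp cw) => /orP[/(allP aw)|]; first by lia.
  move=> yp; have := allP ap _ yp => /= /orP[]/eqP ey; last by lia.
  rewrite ey in yp *; move: yp; rewrite -has_pred1 has_count -cw -has_count has_pred1 => /(allP aw).
  by lia.
- exists s1; last by rewrite ew.
  by apply/run_low; rewrite -/(le_word _ _) e1.
- by rewrite -cp' -[in RHS]ew count_pred2 ?inE ?eqxx ?orbT //; lia.
Qed.

(** * The representatives are complete and pairwise inequivalent *)

Section Tails.
Variables (mat : nat -> nat -> nat) (m : nat).
Hypothesis mat_split : forall o i j, o <= m -> mat i j <> 2 ->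
  (i <= o) && (j <= o) || (o <= i) && (o <= j).
Hypothesis mat_succ : forall o, o < m -> mat o o.+1 <> 2.
Hypothesis mat_diag : forall i, mat i i = 1.

Lemma run_peq o u v s : o <= m -> peq mat u v -> run o u s -> run o v s.
Proof.
move=> om uv; apply: run_ext => i io; apply: uv; apply: mat_succ; exact: leq_trans om.
Qed.

Lemma tails_complete o v s : o <= m -> all (fun y => 0 < y <= o) v -> run o v s ->
  exists2 u, (u, s) \in tails o & peq mat u v.
Proof.
elim: o v s => [|o ih] v s om av /=.
  move=> ->; exists [::]; first by rewrite mem_head.
  case: v av => //= y v /andP[]; lia.
move=> [s1 r t].
have [|w wt wv] := ih (le_word o v) s1 (ltnW om) _ (proj2 (run_low _ _ _) r).
  apply/allP => y; rewrite mem_filter => /andP[yo /(allP av)]; lia.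
have [ap cp cp'] := trans_spec t; have gp := trans_le t.
have [aw rw cw] := tails_spec wt.
set p := filter _ v in ap cp cp' gp t.
have lw : all (fun y => y <= o) w by apply: sub_all aw => y /andP[].
rewrite -cp in cw; have [e1 e2] := weave_low_high lw gp cw.
exists (weave o w p); first by apply/allpairsPdep; exists (w, s1), (p, s).
apply: (peq_glue (fun i j h => mat_split (ltnW om) h)).
  by rewrite e1.
rewrite e2 /p; suff -> : filter (pred2 o o.+1) v = ge_word o v by [].
apply: eq_in_filter => y /(allP av) /=; lia.
Qed.

Lemma tails_inj o : o <= m ->
  {in tails o &, forall us vs, peq mat us.1 vs.1 -> us = vs}.
Proof.
elim: o => [|o ih] om; first by move=> us vs; rewrite !inE => /eqP -> /eqP ->.
move=> [u s] [v s'] hu hv /= uv.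
have [au [s1 ru tu] _] := tails_spec hu; have [av [s2 rv tv] _] := tails_spec hv.
case/allpairsPdep: hu => -[w s3] [[p s4] [hw hp [eu es]]].
case/allpairsPdep: hv => -[w' s3'] [[p' s4'] [hw' hp' [ev es']]].
rewrite /= in hp hp' eu ev es es'; subst s4 s4'.
have [aw rw cw] := tails_spec hw; have [aw' rw' cw'] := tails_spec hw'.
have [ap cp _] := trans_spec hp; have gp := trans_le hp.
have [ap' cp' _] := trans_spec hp'; have gp' := trans_le hp'.
have lw : all (fun y => y <= o) w by apply: sub_all aw => y /andP[].
have lw' : all (fun y => y <= o) w' by apply: sub_all aw' => y /andP[].
rewrite -cp in cw; rewrite -cp' in cw'.
have [e1 e2] := weave_low_high lw gp cw; have [e1' e2'] := weave_low_high lw' gp' cw'.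
have ww : (w, s3) = (w', s3').
  apply: ih; rewrite ?hw ?hw' ?(ltnW om) //= -e1 -e1' -eu -ev.
  exact: peq_filter.
case: ww => ? ?; subst w' s3'.
have pp : p = p'.
  have oo : mat o o.+1 <> 2 by exact: mat_succ.
  have := uv o o.+1 oo.
  rewrite (pred2_ge_word au) (pred2_ge_word av).
  by rewrite eu ev e2 e2'.
subst p'; by rewrite eu ev (trans_fun hp hp').
Qed.

Lemma weave_trans_inj o us vs ps qs : o <= m ->
  us \in tails o -> vs \in tails o -> ps \in trans o us.2 -> qs \in trans o vs.2 ->
  weave o us.1 ps.1 = weave o vs.1 qs.1 -> us = vs /\ ps.1 = qs.1.
Proof.
move: us vs ps qs => [w s] [w' s'] [p t] [p' t'] om hw hw' /= hp hp' e.
have [aw rw cw] := tails_spec hw; have [aw' rw' cw'] := tails_spec hw'.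
have [ap cp _] := trans_spec hp; have gp := trans_le hp.
have [ap' cp' _] := trans_spec hp'; have gp' := trans_le hp'.
have lw : all (fun y => y <= o) w by apply: sub_all aw => y /andP[].
have lw' : all (fun y => y <= o) w' by apply: sub_all aw' => y /andP[].
rewrite -cp in cw; rewrite -cp' in cw'.
have [e1 e2] := weave_low_high lw gp cw; have [e1' e2'] := weave_low_high lw' gp' cw'.
split; last by rewrite -e2 e e2'.
by apply: (tails_inj om hw hw'); rewrite /= -e1 e e1'.
Qed.

Lemma tails_uniq o : o <= m -> uniq (tails o).
Proof.
elim: o => // o ih om; apply: allpairs_uniq_dep; first exact: ih (ltnW om).
  by move=> us _; exact: trans_uniq.
move=> p1 p2 /allpairsPdep[us [ps [h1 h2 ->]]] /allpairsPdep[vs [qs [h3 h4 ->]]] /= [e e'].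
have [eu ep] := weave_trans_inj (ltnW om) h1 h3 h2 h4 e.
by subst vs; move: ps qs ep e' {h2 h4 e} => [p t] [p' t'] /= -> ->.
Qed.
End Tails.

Local Notation X := (fpsX int).

Lemma fcoefXn (R : comNzRingType) n k : fcoef (fpsX R ^+ n)%R k = (k == n)%:R%R.
Proof.
elim: n k => [|n ih] k; first by rewrite expr0.
rewrite exprS fcoefM; case: k => [|k]; first by rewrite big_ord1 /= mul0r.
rewrite !big_ord_recl /= mul0r add0r /bump /= add1n subn1 /= ih mul1r eqSS.
by rewrite big1 ?addr0 // => i _; rewrite !add1n mul0r.
Qed.

(** * From representatives of classes to the length series *)

Section Engine.
Variables (I : finType) (M : coxMatrix I) (f : I -> nat) (mat : nat -> nat -> nat).
Variables (m N : nat) (fin : state -> seq (seq nat)).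
Hypothesis mN : m <= N.
Hypothesis f_inj : injective f.
Hypothesis mat_f : forall i j, mat (f i) (f j) = M i j.
Hypothesis codom_f : forall y, (y \in codom f) = (0 < y <= N).
Hypothesis mat_diag : forall a, mat a a = 1.
Hypothesis mat_ge2 : forall a b, a != b -> 2 <= mat a b.
Hypothesis mat_split : forall o i j, o <= m -> mat i j <> 2 ->
  (i <= o) && (j <= o) || (o <= i) && (o <= j).
Hypothesis mat_succ : forall o, o < m -> mat o o.+1 <> 2.
Hypothesis ord_ok : forall i j (c : nat), i != j -> 0 < c ->
  ((cox_gen M i * cox_gen M j) ^+ c = 1)%g -> M i j <= c.
Hypothesis fin_spec : forall s p, p \in fin s ->
  all (fun y => m <= y <= N) p /\ count_mem m p = ht s.
Hypothesis fin_uniq : forall s, uniq (fin s).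
Hypothesis fin_inj : forall s, {in fin s &, forall p p', peq mat p p' -> p = p'}.
Hypothesis fin_sound : forall v s p, all (fun y => 0 < y <= N) v -> run m v s ->
  p \in fin s -> peq mat (ge_word m v) p -> braid_free mat v.
Hypothesis fin_complete : forall u, all (fun y => 0 < y <= N) u -> fc_word mat u ->
  exists s p, [/\ run m u s, p \in fin s & peq mat (ge_word m u) p].

Definition fc_words := [seq weave m us.1 p | us <- tails m, p <- fin us.2].

Lemma fin_weave us p : us \in tails m -> p \in fin us.2 ->
  [/\ le_word m (weave m us.1 p) = us.1, ge_word m (weave m us.1 p) = p,
      all (fun y => 0 < y <= N) (weave m us.1 p) &
      size (weave m us.1 p) = size us.1 + count (fun y => m < y) p].
Proof.
case: us => u s /tails_spec[au ru cu] /fin_spec[ap cp] /=.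
have lu : all (fun y => y <= m) u by apply: sub_all au => y /andP[].
have gp : all (fun y => m <= y) p by apply: sub_all ap => y /andP[].
rewrite -cp in cu; have [e1 e2] := weave_low_high lu gp cu.
split=> //; last exact: size_weave.
apply/allP => y; rewrite (mem_weave y lu gp cu) => /orP[/(allP au)|yp]; first by lia.
have := allP ap _ yp => /= /andP[my yN].
have [ey|ny] := eqVneq y m; last by lia.
rewrite ey in yp *; move: yp; rewrite -has_pred1 has_count -cu -has_count has_pred1 => /(allP au).
by lia.
Qed.

(** The table [fin s] lists the restrictions to letters at least m that may follow the state [s].
    The letters m are already counted in the tail, so a continuation only weighs its letters above
    m. *)
Lemma FC_series_engine : FC_series M =
  (\sum_(us <- tails m) X ^+ size us.1 * \sum_(p <- fin us.2) X ^+ count (fun y => m < y)%N p)%R.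
Proof.
have mat_split_m := fun i j h => @mat_split m i j (leqnn _) h.
have inj_w us vs p p' : us \in tails m -> vs \in tails m -> p \in fin us.2 -> p' \in fin vs.2 ->
    peq mat (weave m us.1 p) (weave m vs.1 p') -> us = vs /\ p = p'.
  move=> hu hv hp hp' e.
  have [e1 e2 _ _] := fin_weave hu hp; have [e1' e2' _ _] := fin_weave hv hp'.
  have euv : us = vs.
    apply: (tails_inj mat_succ (leqnn m) hu hv).
    by rewrite -e1 -e1'; exact: peq_filter.
  split=> //; subst vs; apply: (fin_inj hp hp'); rewrite -e2 -e2'; exact: peq_filter.
have fpsE k : fcoef (FC_series M) k = (count (fun u => size u == k) fc_words)%:R%R.
  rewrite /= -(card_fc_of_length_words f_inj mat_f mat_diag mat_ge2 ord_ok (s := fc_words)) ?natz //.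
  - apply: allpairs_uniq_dep; first exact: (tails_uniq mat_succ (leqnn m)).
      by move=> us _; exact: fin_uniq.
    move=> p1 p2 /allpairsPdep[us [p [h1 h2 ->]]] /allpairsPdep[vs [p' [h3 h4 ->]]] /= e.
    have [|e1 e2] := inj_w us vs p p' h1 h3 h2 h4; first by rewrite e.
    by subst vs p'.
  - move=> u /allpairsPdep[us [p [h1 h2 eu]]].
    have [e1 e2 e3 _] := fin_weave h1 h2; split.
      rewrite eu; apply: sub_all e3 => y; by rewrite -codom_f.
    rewrite eu => v uv; apply: (fin_sound (s := us.2) (p := p)) => //.
    + by rewrite -(eq_all_r (perm_mem (peq_perm mat_diag uv))).
    + apply: (run_peq mat_succ (leqnn m) uv); apply/run_low.
      rewrite -/(le_word _ _) e1; case: (us) h1 => w s /tails_spec[] //.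
    + by rewrite -[X in peq _ _ X]e2; apply: peq_filter; exact: peq_sym.
  - move=> u v /allpairsPdep[us [p [h1 h2 ->]]] /allpairsPdep[vs [p' [h3 h4 ->]]] e.
    by have [-> ->] := inj_w us vs p p' h1 h3 h2 h4 e.
  - move=> u au fu; have {}au : all (fun y => 0 < y <= N) u.
      by apply: sub_all au => y; rewrite codom_f.
    have [s [p [ru hp up]]] := fin_complete au fu.
    have [|w wt wu] := tails_complete mat_split (leqnn m) (v := le_word m u) (s := s) _ (proj2 (run_low _ _ _) ru).
      by apply/allP => y; rewrite mem_filter => /andP[ym /(allP au)]; lia.
    exists (weave m w p); first by apply/allpairsPdep; exists (w, s), p.
    have [e1 e2 _ _] := fin_weave wt hp.
    apply: (peq_glue mat_split_m); rewrite ?e1 ?e2 //; exact: peq_sym.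
apply/fpsP => k; rewrite fpsE fcoef_sum.
transitivity (\sum_(u <- fc_words) fcoef (X ^+ size u) k)%R.
  rewrite -sum1_count natr_sum big_mkcond /=; apply: eq_bigr => u _.
  by rewrite fcoefXn eq_sym; case: eqP.
rewrite /fc_words big_allpairs_dep [LHS]big_seq [RHS]big_seq.
apply: eq_bigr => us ust. rewrite mulr_sumr fcoef_sum big_seq [RHS]big_seq.
apply: eq_bigr => p hp; have [_ _ _ ->] := fin_weave ust hp.
by rewrite exprD.
Qed.
End Engine.

(** * What a gap of an fc word contains *)

Section FcGap.
Variables (T : eqType) (mat : T -> T -> nat).
Implicit Types (u v a b c : seq T) (i j : T).
Hypothesis mat_sym : forall i j, mat i j = mat j i.
Hypothesis mat_diag : forall i, mat i i = 1.

Lemma peq_move i b : {in b, forall y, mat i y = 2} -> peq mat (i :: b) (b ++ [:: i]).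
Proof.
move=> ib k l kl; rewrite filter_cat /=; case: (boolP (_ || _)) => [ikl|_]; last by rewrite cats0.
suff -> : filter (pred2 k l) b = [::] by [].
apply: filter_none => y yb /=; apply/negP => ykl.
have iy := ib y yb.
have niy : i != y by apply/eqP => e; rewrite e mat_diag in iy.
move: ikl ykl niy iy => /orP[]/eqP-> /orP[]/eqP->; rewrite ?eqxx // => _ //.
by rewrite mat_sym.
Qed.

Lemma peq_move_in i a b c : {in b, forall y, mat i y = 2} ->
  peq mat (a ++ i :: b ++ c) (a ++ b ++ i :: c).
Proof.
move=> ib; apply: peq_cat => //; rewrite -cat_cons -(cat1s i c) catA.
by apply: peq_cat => //; exact: peq_move.
Qed.

Definition nb i y := (y != i) && (mat i y != 2).

(** With no neighbour in the gap, commutations bring the two letters i together. With a single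
    neighbour j they produce iji, a braid when the label is 3; a larger label is the exception in
    the second alternative. *)
Lemma fc_gap u i b : fc_word mat u -> gap i b u ->
  2 <= count (nb i) b \/
  exists2 j, j \in b & [/\ nb i j, mat i j != 3 & count (nb i) b = 1].
Proof.
move=> fu [a [c [eu ib]]].
have N b' : {subset b' <= b} -> ~~ has (nb i) b' -> {in b', forall y, mat i y = 2}.
  move=> sb /hasPn nb' y yb; have := nb' y yb; rewrite negb_and negbK.
  by case/orP => [/eqP e|/negbNE/eqP //]; rewrite -e sb in ib.
have [c2|c2] := leqP 2 (count (nb i) b); [by left | right; move: c2].
rewrite ltnS leq_eqVlt ltnS leqn0 => /orP[/eqP c1|/eqP c0]; last first.
  have nh : ~~ has (nb i) b by rewrite has_count c0.
  have [|h _] := fu (a ++ b ++ [:: i, i & c]).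
    by rewrite eu; apply: peq_move_in; exact: N.
  by case: (h (a ++ b) c i); rewrite -catA.
have /hasP[j jb ij] : has (nb i) b by rewrite has_count c1.
exists j => //; split=> //; apply/eqP => ij3.
have [b1 [b2 [eb _]]] := split_first jb.
have : count (nb i) b1 + count (nb i) b2 = 0.
  by move: c1; rewrite eb count_cat /= ij; lia.
move=> /eqP; rewrite addn_eq0 -!leqn0 ![_ <= 0]leqNgt -!has_count => /andP[n1 n2].
have s1 : {subset b1 <= b} by move=> y; rewrite eb mem_cat => ->.
have s2 : {subset b2 <= b} by move=> y; rewrite eb mem_cat inE => ->; rewrite !orbT.
have [|_ h] := fu (a ++ b1 ++ altw i j 3 ++ b2 ++ c).
  rewrite eu eb -!catA /=; apply: (peq_trans (peq_move_in a _ (N _ s1 n1))).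
  rewrite (catA a b1) (catA a b1) -![_ ++ [:: i, j & _]]/(_ ++ [:: i; j] ++ _).
  by apply: peq_cat => //; apply: (peq_cat (u := [:: i; j])) => //;
    apply: peq_sym; apply: (peq_move_in [::] c (N _ s2 n2)).
case/andP: ij => ji /eqP ij.
by apply: (h (a ++ b1) (b2 ++ c) i j); rewrite ?ij3 1?eq_sym -?catA.
Qed.
End FcGap.

(** * Types A and B *)

Lemma run_trans m v s o : run m v s -> o < m ->
  exists s1 s2, [/\ run o v s1, (filter (pred2 o o.+1) v, s2) \in trans o s1 &
                    run o.+1 v s2].
Proof.
elim: m s => //= m ih s [s' r t]; rewrite ltnS leq_eqVlt => /orP[/eqP ->|om].
  by exists s', s; split=> //; exists s'.
exact: ih r om.
Qed.

Lemma run_gap_top m v h b : 0 < m -> run m v (Some h) -> gap m b v -> m.-1 \in b.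
Proof.
case: m => //= m _ [s' r t] g.
have := trans_gapr t (gap_filter (P := pred2 m m.+1) _ g).
by rewrite /= eqxx orbT mem_filter => /(_ isT) /andP[].
Qed.

(** In an alternating state the gap has a neighbour on each side; at a peak it has both from
    above. *)
Lemma run_gap m v s i b : run m v s -> 0 < i < m -> gap i b v ->
  2 <= count_mem i.-1 b + count_mem i.+1 b.
Proof.
move=> r /andP[i0 im] g; have [s1 [s2 [r1 t _]]] := run_trans r im.
have ii : i != i.+1 by lia.
have Pi : pred2 i i.+1 i by rewrite /= eqxx.
have [t1 t2] := trans_gap t (gap_filter Pi g).
rewrite count_pred2 ?inE ?eqxx ?orbT // in t2.
have i1 : 0 < count_mem i.+1 b.
  by rewrite -has_count has_pred1; move: t1; rewrite mem_filter => /andP[].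
case: s1 t t1 t2 r1 => [h|] _ _ t2 r1; last by rewrite (leq_trans (t2 erefl)) // leq_addl.
have := run_gap_top i0 r1 g; rewrite -has_pred1 has_count => i2.
exact: (leq_add i2 i1).
Qed.

(** * Paths whose last edge is labelled 3 or 4 *)

Section Linear.
Variables (m c : nat).
Hypothesis c34 : (c == 3) || (c == 4).

Definition matL (a b : nat) : nat :=
  if a == b then 1 else
  if (b == a.+1) || (a == b.+1) then if maxn a b == m.+1 then c else 3 else 2.

Lemma matL_sym a b : matL a b = matL b a.
Proof. by rewrite /matL eq_sym maxnC orbC. Qed.

Lemma matL_diag a : matL a a = 1.
Proof. by rewrite /matL eqxx. Qed.

Lemma matL_ge2 a b : a != b -> 2 <= matL a b.
Proof.
rewrite /matL => /negbTE ->; case: ifP => // _; case: ifP => // _.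
by case/orP: c34 => /eqP ->.
Qed.

Lemma matL2 a b : (matL a b == 2) = ~~ [|| a == b, b == a.+1 | a == b.+1].
Proof.
rewrite /matL; case: (eqVneq a b) => // _; rewrite orFb.
case: ((b == a.+1) || _) => //; case: (maxn a b == _) => //.
by case/orP: c34 => /eqP ->.
Qed.

Lemma matL_split o a b : o <= m -> matL a b <> 2 ->
  (a <= o) && (b <= o) || (o <= a) && (o <= b).
Proof. by move=> _ /eqP; rewrite matL2 negbK; lia. Qed.

Lemma matL_succ o : o < m -> matL o o.+1 <> 2.
Proof. by move=> _; apply/eqP; rewrite matL2 negbK eqxx orbT. Qed.

Lemma matL3 a b : matL a b != 2 -> a != b -> matL a b != 3 -> c = 4 /\
  (a == m) && (b == m.+1) || (a == m.+1) && (b == m).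
Proof.
rewrite /matL => h /negbTE nab; rewrite nab in h *; move: h.
case: ifP => // ab; case: ifP => // mx _ c3; split; first by case/orP: c34 c3 => /eqP ->.
by case/orP: ab => /eqP e; move: mx; rewrite e; lia.
Qed.

Lemma count_nbL i b : 0 < i ->
  count (nb matL i) b = count_mem i.-1 b + count_mem i.+1 b.
Proof.
move=> i0; rewrite -[RHS]addn0 -[X in _ + X](count_pred0 b) -count_predUI.
have -> : count (predI (pred1 i.-1) (pred1 i.+1)) b = 0.
  apply/eqP; rewrite -leqn0 leqNgt -has_count; apply/hasPn => y _ /=; lia.
rewrite count_pred0 !addn0; apply: eq_count => y.
by rewrite /nb matL2 negbK /=; lia.
Qed.

Let mv := peq_move_in matL_sym matL_diag.

Section Word.
Variable u : seq nat.
Hypothesis au : all (fun y => 0 < y <= m.+1) u.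

Lemma letter0 : 0 \notin u.
Proof. by apply/negP => /(allP au). Qed.

Lemma sub_letter (b : seq nat) y : {subset b <= u} -> y \in b -> 0 < y <= m.+1.
Proof. by move=> h /h/(allP au). Qed.

Lemma gap_pos i b : gap i b u -> 0 < i <= m.+1.
Proof.
move=> [a [d [e _]]]; apply: (allP au); by rewrite e mem_cat mem_head orbT.
Qed.

Lemma has_top (b : seq nat) : {subset b <= u} -> has (fun x => m < x) b = (m.+1 \in b).
Proof.
move=> sb; apply/hasP/idP => [[y yb my]|h]; last by exists m.+1.
have /andP[_ yN] := sub_letter sb yb; have <- : y = m.+1 by apply/eqP; rewrite eqn_leq yN my.
by [].
Qed.

Hypothesis fu : fc_word matL u.
Let gapL i b g := fc_gap (i := i) (b := b) matL_sym matL_diag fu g.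

Lemma gapL_low i b : 0 < i < m -> gap i b u -> 2 <= count_mem i.-1 b + count_mem i.+1 b.
Proof.
move=> im g; case: (gapL g); first by rewrite count_nbL; lia.
move=> [j jb [/andP[ji nij] n3 _]].
rewrite eq_sym in ji; have [_] := matL3 nij ji n3; lia.
Qed.

Lemma gapL_m b : 0 < m -> gap m b u ->
  2 <= count_mem m.-1 b + count_mem m.+1 b \/
  [/\ c = 4, count_mem m.-1 b = 0 & count_mem m.+1 b = 1].
Proof.
move=> m0 g; case: (gapL g) => [h|]; first by left; move: h; rewrite count_nbL.
move=> [j jb [/andP[ji nij] n3 c1]]; right.
rewrite eq_sym in ji; have [c4] := matL3 nij ji n3; rewrite eqxx /=.
have ej : (m == m.+1) = false by lia.
rewrite ej orbF => /eqP ejm; rewrite ejm -has_pred1 has_count in jb.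
have E (x y : nat) : x + y = 1 -> 0 < y -> x = 0 /\ y = 1 by lia.
by rewrite count_nbL // in c1; have [] := E _ _ c1 jb.
Qed.

Lemma gapL_top b : gap m.+1 b u -> m \in b /\ (c = 3 -> 2 <= count_mem m b).
Proof.
move=> g; have n2 : m.+2 \notin b.
  by apply/negP => /(sub_letter (gap_sub g)); rewrite ltnn andbF.
case: (gapL g) => [|].
  rewrite count_nbL // (count_memPn n2) addn0 /= => h; split=> //.
  by rewrite -has_pred1 has_count; exact: ltnW h.
move=> [j jb [/andP[ji nij] n3 _]].
rewrite eq_sym in ji; have [c4] := matL3 nij ji n3.
have -> : (m.+1 == m) = false by lia.
by rewrite eqxx /= => /eqP <-; split=> //; rewrite c4.
Qed.

Lemma gapL_m' b : 0 < m -> gap m b u ->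
  has (fun x => m < x) b \/ 2 <= count_mem m.-1 b.
Proof.
move=> m0 g; rewrite (has_top (gap_sub g)) -has_pred1 has_count.
case: (gapL_m m0 g) => [h|[_ _ ->]]; last by left.
by case: posnP h => [->|]; [rewrite addn0; right | left].
Qed.

Lemma gapL_up b : gap m b u -> m.+1 \in b.
Proof.
move=> g; rewrite -(has_top (gap_sub g)).
by have := gap_up letter0 gapL_low gapL_m' (leqnn m) g; rewrite ltnn.
Qed.

(** Two end generators inside the gap would enclose an m by [gapL_top], impossible inside a gap of
    m. So there is a single neighbour, and the label must be 4. *)
Lemma gapL_peak b : gap m b u -> m.-1 \notin b ->
  c = 4 /\ count_mem m.+1 b = 1.
Proof.
move=> g nm; have m0 : 0 < m by case/andP: (gap_pos g).
case: (gapL_m m0 g) => [|[]//]; rewrite (count_memPn nm) add0n => /gap_count[b' g'].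
have [h _] := gapL_top (gap_trans g g'); have := gap_sub g' h.
by case: g => a [d [_ /negP]].
Qed.

(* Two occurrences of the 4-valent end generator around a gap of its neighbour
   that contains no other neighbour produce one of the two braids of length 4. *)
Lemma gapL_peak_count b : gap m b u -> m.-1 \notin b ->
  count_mem m.+1 u = 1 /\ count_mem m u = 2.
Proof.
move=> g nm; have [c4 tb] := gapL_peak g nm.
have m0 : 0 < m by case/andP: (gap_pos g).
have mt4 : matL m m.+1 = 4.
  rewrite /matL eqxx (_ : (m == m.+1) = false); last by lia.
  by rewrite (_ : maxn m m.+1 = m.+1) ?eqxx //; lia.
have tm4 : matL m.+1 m = 4 by rewrite matL_sym.
have mt2 : matL m m.+1 <> 2 by rewrite mt4.
have tm2 : matL m.+1 m <> 2 by rewrite tm4.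
have mt : m != m.+1 by lia.
have tm : m.+1 != m by lia.
case: (g) => a [d [eu mb]].
have : m.+1 \in b by rewrite -has_pred1 has_count tb.
move=> /split_first[b1 [b2 [eb _]]].
have [tb1 tb2] : m.+1 \notin b1 /\ m.+1 \notin b2.
  have E (x y : nat) : x + (1 + y) = 1 -> x = 0 /\ y = 0 by lia.
  move: tb; rewrite eb count_cat /= eqxx => /E[h1 h2].
  by split; apply/count_memPn.
have sub1 : {subset b1 <= b} by move=> y; rewrite eb mem_cat => ->.
have sub2 : {subset b2 <= b} by move=> y; rewrite eb mem_cat inE => ->; rewrite !orbT.
have sb := gap_sub g.
have M (b' : seq nat) : {subset b' <= b} -> m.+1 \notin b' -> {in b', forall y, matL m y = 2}.
  move=> s1 t1 y yb'; apply/eqP; rewrite matL2; apply/negP => /or3P[]/eqP e.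
  - by rewrite e (s1 _ yb') in mb.
  - by rewrite -e yb' in t1.
  - by rewrite e /= (s1 _ yb') in nm.
have Tc (b' : seq nat) : {subset b' <= u} -> m.+1 \notin b' -> m \notin b' ->
    {in b', forall y, matL m.+1 y = 2}.
  move=> s1 t1 m1 y yb'; apply/eqP; rewrite matL2; apply/negP => /or3P[]/eqP e.
  - by rewrite e yb' in t1.
  - by have := sub_letter s1 yb'; lia.
  - by case: e => e; rewrite e yb' in m1.
have mb1 : m \notin b1 by apply: contra mb; exact: sub1.
have mb2 : m \notin b2 by apply: contra mb; exact: sub2.
have sa : {subset a <= u} by move=> y ya; rewrite eu mem_cat ya.
have sd : {subset d <= u} by move=> y ya; rewrite eu mem_cat inE mem_cat inE ya !orbT.
(* No m follows the last m+1 of [a] within [a], since the gap of m thus created would contain m+1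
   again. Commutations then bring this m+1 next to the peak and form the braid (m+1) m (m+1) m. The
   argument for [d] is its mirror image. *)
have ta : m.+1 \notin a.
  apply/negP => /split_last[a1 [a2 [ea ta2]]].
  have sa2 : {subset a2 <= a} by move=> y; rewrite ea mem_cat inE => ->; rewrite !orbT.
  have ma2 : m \notin a2.
    apply/negP => /split_last[z [y [ez my]]].
    have /gapL_up : gap m y u.
      by exists (a1 ++ m.+1 :: z), (b ++ m :: d); rewrite eu ea ez -?catA /= -?catA.
    by move=> ty; move: ta2; rewrite ez mem_cat inE ty !orbT.
  have [|_ h] := fu (v := a1 ++ a2 ++ b1 ++ [:: m.+1; m; m.+1; m] ++ b2 ++ d).
    have ta2' : {in a2, forall y, matL m.+1 y = 2} by apply: Tc => // y /sa2/sa.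
    rewrite eu ea eb -?catA /= -?catA /=.
    apply: (peq_trans (mv a1 _ ta2')).
    apply: peq_cat => //; apply: peq_cat => //.
    apply: (peq_trans (v := m.+1 :: b1 ++ m :: m.+1 :: b2 ++ m :: d)).
      by apply: peq_cons; apply: (mv [::]); exact: M.
    apply: (peq_trans (mv [::] _ (Tc _ _ tb1 mb1))) => [y /sub1/sb //|] /=.
    apply: peq_cat => //; do 3!apply: peq_cons.
    by apply: peq_sym; apply: (mv [::]); exact: M.
  by apply: (h (a1 ++ a2 ++ b1) (b2 ++ d) m.+1 m) => //; rewrite tm4 -?catA.
have td : m.+1 \notin d.
  apply/negP => /split_first[d1 [d2 [ed td1]]].
  have sd1 : {subset d1 <= d} by move=> y; rewrite ed mem_cat => ->.
  have md1 : m \notin d1.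
    apply/negP => /split_first[z [y [ez mz]]].
    have /gapL_up : gap m z u.
      by exists (a ++ m :: b), (y ++ m.+1 :: d2); rewrite eu ed ez -?catA /= -?catA /= -?catA.
    by move=> tz; move: td1; rewrite ez mem_cat tz.
  have [|_ h] := fu (v := a ++ b1 ++ b2 ++ [:: m; m.+1; m; m.+1] ++ d1 ++ d2).
    have td1' : {in d1, forall y, matL m.+1 y = 2} by apply: Tc => // y /sd1/sd.
    rewrite eu ed eb -?catA /= -?catA /=.
    apply: peq_cat => //.
    apply: (peq_trans (mv [::] _ (M _ sub1 tb1))) => /=.
    apply: peq_cat => //.
    apply: (peq_trans (v := b2 ++ m :: m.+1 :: m :: d1 ++ m.+1 :: d2)).
      apply: (peq_trans (v := m :: b2 ++ m.+1 :: m :: d1 ++ m.+1 :: d2)).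
        apply: peq_cons; apply: (mv [::]); apply: Tc => // y /sub2/sb //.
      by apply: (mv [::]); exact: M.
    apply: peq_cat => //; do 3!apply: peq_cons.
    by apply: peq_sym; apply: (mv [::]).
  by apply: (h (a ++ b1 ++ b2) (d1 ++ d2) m m.+1) => //; rewrite mt4 -?catA.
have ct : count_mem m.+1 u = 1.
  by rewrite eu count_cat /= count_cat /= tb (count_memPn ta) (count_memPn td) (negbTE mt).
split=> //.
have ma : m \notin a.
  apply/negP => /split_last[z [y [ez my]]].
  have /gapL_up : gap m y u by exists z, (b ++ m :: d); rewrite eu ez -catA.
  by move=> ty; move: ta; rewrite ez mem_cat inE ty !orbT.
have md : m \notin d.
  apply/negP => /split_first[z [y [ez my]]].
  have /gapL_up : gap m z u by exists (a ++ m :: b), y; rewrite eu ez -?catA /= -?catA.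
  by move=> ty; move: td; rewrite ez mem_cat ty.
by rewrite eu count_cat /= count_cat /= eqxx !(count_memPn _).
Qed.

Lemma runL_exists : exists2 s, run m u s & state_ok u m s.
Proof.
apply: (run_exists letter0 gapL_low gapL_m') => // b m0 g nm.
by have [] := gapL_peak_count g nm.
Qed.

Lemma ge_wordL : ge_word m u = filter (pred2 m m.+1) u.
Proof. by apply: eq_in_filter => y /(allP au) /=; lia. Qed.

Lemma runL_final : exists2 s, run m u s &
  if s is Some h then
    (ge_word m u, count_mem m.+1 u) \in alts m m.+1 h /\ (c = 3 -> count_mem m.+1 u <= 1)
  else c = 4 /\ ge_word m u = [:: m; m.+1; m].
Proof.
have mt : m != m.+1 by lia.
have [s r ok] := runL_exists; exists s => //.
rewrite ge_wordL; case: s r ok => [h|] r [e].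
  move=> gm; split.
    have := @alts_complete m m.+1 mt (filter (pred2 m m.+1) u) (filter_all _ _).
    rewrite !count_pred2 ?inE ?eqxx ?orbT // e; apply.
    apply: (sorted_neq_gap (i := m) (j := m.+1)); first exact: filter_all.
      move=> b /gap_filter_inv[b0 /gapL_up tb <-].
      by rewrite mem_filter /= eqxx orbT.
    move=> b /gap_filter_inv[b0 /gapL_top[mb _] <-].
    by rewrite mem_filter /= eqxx.
  (* In type A a gap of the end generator contains two m, hence a gap of m, hence the end generator
     itself. *)
  move=> c3; rewrite leqNgt; apply/negP => /gap_count[b g].
  have [_ /(_ c3) /gap_count[b' g']] := gapL_top g.
  have := gap_sub g' (gapL_up (gap_trans g g')).
  by case: g => a [d [_ /negP]].
move=> m0 [b g nm]; have [c4 tb] := gapL_peak g nm.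
have [ct cm] := gapL_peak_count g nm; split=> //.
case: (g) => a [d [eu mb]].
have [ma _ md] : [/\ m \notin a, m \notin b & m \notin d].
  by move: cm; rewrite eu => /count_gap2.
have E (x z : nat) : x + (0 + (1 + (0 + z))) = 1 -> x = 0 /\ z = 0 by lia.
move: ct; rewrite eu count_cat /= count_cat /= tb (negbTE mt) => /E[/count_memPn ta /count_memPn td].
rewrite filter_cat /= eqxx filter_cat /= eqxx !(filter_pred2_nil ma, filter_pred2_nil md) //=.
have : all (pred1 m.+1) (filter (pred2 m m.+1) b).
  apply/allP => y; rewrite mem_filter => /andP[/orP[]//= /eqP -> yb].
  by rewrite yb in mb.
have : count_mem m.+1 (filter (pred2 m m.+1) b) = 1.
  by rewrite count_pred2 ?inE ?eqxx ?orbT.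
by move=> hc /all_pred1P e2; move: hc; rewrite e2 count_nseq /= eqxx mul1n => ->.
Qed.

End Word.

Lemma runL_sound v s : all (fun y => 0 < y <= m.+1) v -> run m v s ->
  (forall b, gap m b v -> m.+1 \in b) ->
  (forall b, gap m.+1 b v -> m \in b /\ c = 4) ->
  (s = None -> c = 4 /\ count_mem m.+1 v = 1) -> braid_free matL v.
Proof.
move=> av r gm gt sN.
have gp i b : gap i b v -> 0 < i <= m.+1.
  by move=> [a [d [e _]]]; apply: (allP av); rewrite e mem_cat mem_head orbT.
have low i b : gap i b v -> i <= m -> m.+1 \in b \/ 2 <= count_mem i.-1 b + count_mem i.+1 b.
  move=> g; rewrite leq_eqVlt => /orP[/eqP ei|im]; first by left; apply: gm; rewrite -ei.
  by right; apply: (run_gap r) => //; rewrite im andbT; case/andP: (gp _ _ g).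
have nn i : ~ gap i [::] v.
  move=> g; case/andP: (gp _ _ g) => i0; rewrite leq_eqVlt => /orP[/eqP ei|im].
    by rewrite ei in g; have [] := gt _ g.
  by have [] := low _ _ g im.
have n3 i j : i != j -> matL i j = 3 -> ~ gap i [:: j] v.
  move=> ij m3 g; case/andP: (gp _ _ g) => i0; rewrite leq_eqVlt => /orP[/eqP ei|im].
    rewrite ei in g m3; have [] := gt _ g; rewrite inE => /eqP e c4.
    move: m3; rewrite /matL -e c4 (_ : m.+1 == m = false) ?eqxx ?orbT /=; last by lia.
    by rewrite (_ : maxn m.+1 m = m.+1) ?eqxx //; lia.
  have [] := low _ _ g im; last first.
    rewrite /= !addn0; case: eqP => // e1; case: eqP => // e2; lia.
  rewrite inE => /eqP ej.
  have eim : i = m.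
    apply/eqP; move: m3; rewrite -ej /matL; case: eqP => [|_] //.
    case: (boolP (_ || _)) => // h _; lia.
  rewrite eim -ej in m3 g; have c3 : c = 3.
    move: m3; rewrite /matL (_ : m == m.+1 = false) ?eqxx /=; last by lia.
    by rewrite (_ : maxn m m.+1 = m.+1) ?eqxx //; lia.
  case: s r sN => [h|] r; last by case=> // c4; rewrite c4 in c3.
  have := run_gap_top (b := [:: m.+1]) _ r g; rewrite -eim i0 inE => /(_ isT); lia.
split=> [a b i e|a b i j ij mij e]; first by apply: (nn i); exists a, b; rewrite e.
have [m3|m3] := eqVneq (matL i j) 3.
  apply: (n3 i j ij m3); exists a, b; rewrite e m3; split=> //.
  by rewrite inE.
have [c4 ijm] := matL3 (introN eqP mij) ij m3.
have m4 : matL i j = 4.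
  rewrite /matL (negbTE ij); case/orP: ijm => /andP[/eqP -> /eqP ->]; rewrite eqxx ?orbT.
    by rewrite (_ : maxn m m.+1 = m.+1) ?eqxx //; lia.
  by rewrite (_ : maxn m.+1 m = m.+1) ?eqxx //; lia.
(* Either braid of length 4 contains this gap. An alternating state would put m-1 into it, and a
   peak leaves only one m+1 in the word while the braid has two. *)
have g : gap m [:: m.+1] v.
  rewrite m4 in e; case/orP: ijm => /andP[/eqP ei /eqP ej]; rewrite e ei ej.
    by exists a, (m.+1 :: b); rewrite inE; split=> //; lia.
  by exists (a ++ [:: m.+1]), b; rewrite -catA inE; split=> //; lia.
case: s r sN => [h|] r sN.
  have := run_gap_top (b := [:: m.+1]) _ r g; case/andP: (gp _ _ g) => -> _.
  by rewrite inE => /(_ isT); lia.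
have [_] := sN erefl; rewrite e m4 !count_cat.
by case/orP: ijm => /andP[/eqP -> /eqP ->]; rewrite /= !eqxx; case: eqP; lia.
Qed.

End Linear.

(** In type A the end generator occurs at most once and no peak survives. In type B every
    alternating continuation is allowed, and a peak is closed by one end generator between its two
    letters m. *)
Definition finA m (s : state) : seq (seq nat) :=
  if s is Some h then [seq p.1 | p <- alts m m.+1 h & p.2 <= 1] else [::].

Definition finB m (s : state) : seq (seq nat) :=
  if s is Some h then [seq p.1 | p <- alts m m.+1 h] else [:: [:: m; m.+1; m]].

Lemma finA_sub m s p : p \in finA m s -> p \in finB m s.
Proof.
case: s => [h|]; rewrite /finA /finB // => /mapP[x]; rewrite mem_filter => /andP[_ xa] ->; exact: map_f.
Qed.

Lemma finB_spec m s p : p \in finB m s ->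
  all (pred2 m m.+1) p /\ count_mem m p = ht s.
Proof.
have mt : m != m.+1 by lia.
case: s => [h|]; rewrite /finB.
  by move=> /mapP[x /(alts_spec mt)[h1 h2 _ _] ->].
by rewrite inE => /eqP -> /=; rewrite !eqxx !orbT; split=> //; lia.
Qed.

Lemma finB_uniq m s : uniq (finB m s).
Proof.
have mt : m != m.+1 by lia.
case: s => [h|]; rewrite /finB // map_inj_in_uniq ?alts_uniq //.
move=> [p k] [p' k'] /(alts_spec mt)[_ _ /= <- _] /(alts_spec mt)[_ _ /= <- _] /= ->; by [].
Qed.

Lemma finA_uniq m s : uniq (finA m s).
Proof.
case: s => [h|] //; rewrite /finA.
by have := finB_uniq m (Some h); apply: subseq_uniq; apply: map_subseq; exact: filter_subseq.
Qed.

Lemma finB_peq m c s u p : (c == 3) || (c == 4) -> all (fun y => 0 < y <= m.+1) u ->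
  p \in finB m s -> peq (matL m c) (ge_word m u) p -> filter (pred2 m m.+1) u = p.
Proof.
move=> c34 au /finB_spec[ap _] h.
have h2 : matL m c m m.+1 <> 2 by apply/eqP; rewrite matL2 // negbK eqxx orbT.
have := h _ _ h2; rewrite (all_filterP ap) => <-; rewrite (ge_wordL c34) //.
by rewrite -filter_predI; apply: eq_filter => y /=; rewrite andbb.
Qed.

Lemma finB_count m p u : all (fun y => 0 < y <= m.+1) u ->
  filter (pred2 m m.+1) u = p -> count_mem m.+1 u = count_mem m.+1 p.
Proof. by move=> au <-; rewrite count_pred2 ?inE ?eqxx ?orbT //; lia. Qed.

Section Sound.
Variables (m : nat) (v p : seq nat) (s : state).
Hypothesis av : all (fun y => 0 < y <= m.+1) v.
Hypothesis rv : run m v s.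
Hypothesis pv : filter (pred2 m m.+1) v = p.

Let Pm : pred2 m m.+1 m. Proof. by rewrite /= eqxx. Qed.
Let Pt : pred2 m m.+1 m.+1. Proof. by rewrite /= eqxx orbT. Qed.
Let mt : m != m.+1. Proof. by lia. Qed.

Lemma finB_gap b : p \in finB m s -> (gap m b v -> m.+1 \in b) /\ (gap m.+1 b v -> m \in b).
Proof.
move=> hp.
have H b' : (gap m b' p -> m.+1 \in b') /\ (gap m.+1 b' p -> m \in b').
  case: (s) hp => [h|]; rewrite /finB.
    by move=> /mapP[x hx ->]; exact: (alts_gap mt b' hx).
  rewrite inE => /eqP ->; split; last first.
    by move/gap_count_ge; rewrite /= eqxx (negbTE mt).
  by move/(gap_ends (w := [:: m.+1])); rewrite inE => -> //; rewrite mem_head.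
split=> g.
  have [h _] := H (filter (pred2 m m.+1) b).
  by have := h; rewrite -pv mem_filter => /(_ (gap_filter Pm g)) /andP[].
have [_ h] := H (filter (pred2 m m.+1) b).
by have := h; rewrite -pv mem_filter => /(_ (gap_filter Pt g)) /andP[].
Qed.

Lemma finA_sound : p \in finA m s -> braid_free (matL m 3) v.
Proof.
move=> hp; apply: (@runL_sound m 3 isT v s av rv) => //.
- by move=> b; have [] := finB_gap b (finA_sub hp).
- move=> b /gap_count_ge; rewrite (finB_count av pv).
  case: (s) hp => [h|] //; rewrite /finA => /mapP[x]; rewrite mem_filter => /andP[x1 /(alts_spec mt)[_ _ e _] ->].
  by rewrite e leqNgt ltnS x1.
- by move=> s0; rewrite s0 in hp.
Qed.

Lemma finB_sound : p \in finB m s -> braid_free (matL m 4) v.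
Proof.
move=> hp; apply: (@runL_sound m 4 isT v s av rv) => //.
- by move=> b; have [] := finB_gap b hp.
- by move=> b; have [_ h] := finB_gap b hp => /h.
- move=> s0; rewrite s0 /finB inE in hp; split=> //.
  by rewrite (finB_count av pv) (eqP hp) /= eqxx (negbTE mt).
Qed.
End Sound.

(** * Orders and numbering for the three diagrams *)

Section Diagrams.
Variables (N : nat) (lab : nat -> nat -> nat) (lab_neq1 : forall i j, lab i j != 1).
Hypothesis lab234 : forall i j, [|| lab i j == 2, lab i j == 3 | lab i j == 4].

Lemma diagram_order (i j : 'I_N) (n : nat) : i != j -> 0 < n ->
  let M := diagram_cox N lab_neq1 in
  ((cox_gen M i * cox_gen M j) ^+ n = 1)%g -> M i j <= n.
Proof.
(* For a label 4 the two entries must be 1 and 2; the order of the nodes decides which is which. *)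
move=> ij n0 M; pose c (i j : 'I_N) : int :=
  if M i j == 4 then (if (i < j)%N then 1 else 2)%R else if M i j == 3 then 1%R else 0%R.
apply: (@gen_order _ M c) => // k l kl; rewrite /c (cox_sym M l k).
have e : M k l = lab (minn k l) (maxn k l) by rewrite /= /diagram_m (negbTE kl).
case/or3P: (lab234 (minn k l) (maxn k l)) => /eqP e'; rewrite e e' /=.
- by constructor 1.
- by constructor 2.
- case: ltngtP => h; [by constructor 3 | by constructor 4|].
  by case/eqP: kl; exact: val_inj.
Qed.

(* The nodes are renumbered from the end opposite to t, resp. to the fork; 0 is not
   a letter. *)
Definition node (i : 'I_N) : nat := N - i.

Lemma node_inj : injective node.
Proof.
move=> i j; rewrite /node => e; apply: val_inj => /=; have := ltn_ord i; have := ltn_ord j; lia.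
Qed.

Lemma codom_node y : (y \in codom node) = (0 < y <= N).
Proof.
apply/codomP/idP => [[i ->]|h]; first by rewrite /node; have := ltn_ord i; lia.
have h' : N - y < N by lia.
by exists (Ordinal h'); rewrite /node /=; lia.
Qed.
End Diagrams.

Lemma labA_234 i j : [|| labA i j == 2, labA i j == 3 | labA i j == 4].
Proof. by rewrite /labA; case: ifP. Qed.

Lemma labB_234 i j : [|| labB i j == 2, labB i j == 3 | labB i j == 4].
Proof. by rewrite /labB; do 2?case: ifP. Qed.

Lemma matL_A m (i j : 'I_m.+1) : matL m 3 (node i) (node j) = coxA m.+1 i j.
Proof.
have := ltn_ord i; have := ltn_ord j; rewrite /matL /node /= /diagram_m /labA if_same => hj hi.
have -> : (m.+1 - i == m.+1 - j) = (i == j) by rewrite -val_eqE /=; lia.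
case: eqP => // _; congr (if _ then _ else _); lia.
Qed.

Lemma matL_B m (i j : 'I_m.+1) : matL m 4 (node i) (node j) = coxB m.+1 i j.
Proof.
have := ltn_ord i; have := ltn_ord j; rewrite /matL /node /= /diagram_m /labB => hj hi.
have -> : (m.+1 - i == m.+1 - j) = (i == j) by rewrite -val_eqE /=; lia.
case: eqP => // _.
have -> : (m.+1 - j == (m.+1 - i).+1) || (m.+1 - i == (m.+1 - j).+1) =
          (maxn i j == (minn i j).+1) by lia.
case: eqP => // e; congr (if _ then _ else _); lia.
Qed.

Theorem FC_series_A m : FC_series (coxA m.+1) =
  (\sum_(us <- tails m) fpsX int ^+ size us.1 *
    \sum_(p <- finA m us.2) fpsX int ^+ count (fun y => m < y)%N p)%R.
Proof.
apply: (FC_series_engine (f := @node m.+1) (mat := matL m 3) (N := m.+1)) => //.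
- exact: node_inj.
- exact: matL_A.
- exact: codom_node.
- exact: matL_diag.
- exact: matL_ge2.
- by move=> o i j; exact: matL_split.
- by move=> o; exact: matL_succ.
- by move=> i j c ij c0; exact: (diagram_order labA_234).
- move=> s p /finA_sub/finB_spec[ap cp]; split=> //.
  by apply: sub_all ap => y /= /orP[]/eqP ->; lia.
- exact: finA_uniq.
- move=> s p p' /finA_sub/finB_spec[ap _] /finA_sub/finB_spec[ap' _] h.
  have := h m m.+1; rewrite (all_filterP ap) (all_filterP ap'); apply.
  by apply/eqP; rewrite matL2 // negbK eqxx orbT.
- move=> v s p av rv hp e; apply: (finA_sound av rv _ hp).
  exact: (finB_peq (c := 3) _ av (finA_sub hp) e).
- move=> u au fu; have [s r] := runL_final (c := 3) isT au fu.
  case: s r => [h|] r; last by case.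
  move=> [h1 /(_ erefl) h2]; exists (Some h), (ge_word m u); split=> //.
  apply/mapP; exists (ge_word m u, count_mem m.+1 u) => //.
  by rewrite mem_filter h1 andbT.
Qed.

Theorem FC_series_B m : FC_series (coxB m.+1) =
  (\sum_(us <- tails m) fpsX int ^+ size us.1 *
    \sum_(p <- finB m us.2) fpsX int ^+ count (fun y => m < y)%N p)%R.
Proof.
apply: (FC_series_engine (f := @node m.+1) (mat := matL m 4) (N := m.+1)) => //.
- exact: node_inj.
- exact: matL_B.
- exact: codom_node.
- exact: matL_diag.
- exact: matL_ge2.
- by move=> o i j; exact: matL_split.
- by move=> o; exact: matL_succ.
- by move=> i j c ij c0; exact: (diagram_order labB_234).
- move=> s p /finB_spec[ap cp]; split=> //.
  by apply: sub_all ap => y /= /orP[]/eqP ->; lia.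
- exact: finB_uniq.
- move=> s p p' /finB_spec[ap _] /finB_spec[ap' _] h.
  have := h m m.+1; rewrite (all_filterP ap) (all_filterP ap'); apply.
  by apply/eqP; rewrite matL2 // negbK eqxx orbT.
- move=> v s p av rv hp e; apply: (finB_sound av rv _ hp).
  exact: (finB_peq (c := 4) _ av hp e).
- move=> u au fu; have [s r] := runL_final (c := 4) isT au fu.
  case: s r => [h|] r.
    move=> [h1 _]; exists (Some h), (ge_word m u); split=> //.
    by apply/mapP; exists (ge_word m u, count_mem m.+1 u).
  move=> [_ h1]; exists None, (ge_word m u); split=> //.
  by rewrite h1 mem_head.
Qed.

(** * Type D *)

Lemma gap_rev (T : eqType) (i : T) b u : gap i b u -> gap i (rev b) (rev u).
Proof.
move=> [a [c [-> ib]]]; exists (rev c), (rev a); split; last by rewrite mem_rev.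
by rewrite !(rev_cat, rev_cons) -!cats1 -!catA.
Qed.

(** * Gap conditions around the fork *)

Section Fork.
Variable m : nat.
Hypothesis m0 : 0 < m.
Local Notation t1 := m.+1.
Local Notation t2 := m.+2.

Definition adjD (a b : nat) : bool :=
  [|| (b == a.+1) && (b <= m.+1), (a == b.+1) && (a <= m.+1),
      (a == m) && (b == m.+2) | (a == m.+2) && (b == m)].

Definition matD (a b : nat) : nat := if a == b then 1 else if adjD a b then 3 else 2.

Lemma matD_sym a b : matD a b = matD b a.
Proof. by rewrite /matD eq_sym; do 2?congr (if _ then _ else _); rewrite /adjD; lia. Qed.

Lemma matD_diag a : matD a a = 1.
Proof. by rewrite /matD eqxx. Qed.

Lemma matD_ge2 a b : a != b -> 2 <= matD a b.
Proof. by rewrite /matD => /negbTE ->; case: ifP. Qed.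

Lemma matD2 a b : (matD a b == 2) = ~~ ((a == b) || adjD a b).
Proof. by rewrite /matD; case: (a == b) => //=; case: adjD. Qed.

Lemma matD_split o a b : o <= m -> matD a b <> 2 ->
  (a <= o) && (b <= o) || (o <= a) && (o <= b).
Proof. by move=> om /eqP; rewrite matD2 negbK /adjD; lia. Qed.

Lemma matD_succ o : o < m -> matD o o.+1 <> 2.
Proof. by move=> om; apply/eqP; rewrite matD2 negbK /adjD; lia. Qed.

Lemma matD_top t : m < t <= m.+2 -> matD m t <> 2.
Proof. by move=> mt; apply/eqP; rewrite matD2 negbK /adjD; lia. Qed.

Lemma nbD i y : nb matD i y = adjD i y.
Proof. by rewrite /nb matD2 negbK /adjD; lia. Qed.

Lemma count_disjoint (a b c : pred nat) s : (forall y, c y = a y || b y) ->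
  (forall y, ~~ (a y && b y)) -> count c s = count a s + count b s.
Proof.
move=> h d; rewrite -count_predUI [X in _ + X](@eq_count _ _ pred0) ?count_pred0 ?addn0.
  by apply: eq_count => y; rewrite h.
by move=> y; exact/negbTE/d.
Qed.

Lemma count_nbD_low i b : 0 < i < m ->
  count (nb matD i) b = count_mem i.-1 b + count_mem i.+1 b.
Proof. by move=> im; apply: count_disjoint => y; rewrite ?nbD /adjD /=; lia. Qed.

Lemma count_nbD_m b :
  count (nb matD m) b = count_mem m.-1 b + (count_mem t1 b + count_mem t2 b).
Proof.
rewrite -(count_disjoint (c := pred2 t1 t2)) //.
  by apply: count_disjoint => y; rewrite ?nbD /adjD /=; lia.
by move=> y /=; lia.
Qed.

Lemma count_nbD_top t b : m < t <= m.+2 ->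
  count (nb matD t) b = count_mem m b.
Proof. by move=> mt; apply: eq_count => y; rewrite nbD /adjD /=; lia. Qed.

(** The part of the fc property visible on the letters m, m+1, m+2. The neighbour m-1 is absent here
    because the run controls it. *)
Definition fork_gaps (p : seq nat) :=
  (forall b, gap m b p -> has (fun y => m < y) b) /\
  (forall t b, m < t -> gap t b p -> 2 <= count_mem m b).

Section Word.
Variable u : seq nat.
Hypothesis au : all (fun y => 0 < y <= m.+2) u.
Hypothesis gu : forall i b, gap i b u -> 2 <= count (nb matD i) b.

Lemma letterD0 : 0 \notin u.
Proof. by apply/negP => /(allP au). Qed.

Lemma gapD_pos i b : gap i b u -> 0 < i <= m.+2.
Proof.
by move=> [a [d [e _]]]; apply: (allP au); rewrite e mem_cat mem_head orbT.
Qed.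

Lemma gapD_low i b : 0 < i < m -> gap i b u -> 2 <= count_mem i.-1 b + count_mem i.+1 b.
Proof. by move=> im /gu; rewrite count_nbD_low. Qed.

Lemma gapD_top t b : m < t -> gap t b u -> 2 <= count_mem m b.
Proof.
move=> mt g; have tm : m < t <= m.+2 by rewrite mt; case/andP: (gapD_pos g).
by move: (gu g); rewrite count_nbD_top.
Qed.

Lemma gapD_m b : 0 < m -> gap m b u -> has (fun x => m < x) b \/ 2 <= count_mem m.-1 b.
Proof.
move=> _ /gu; rewrite count_nbD_m; case: (boolP (has _ _)) => [|h]; first by left.
have n t : m < t -> count_mem t b = 0.
  move=> mt; apply/count_memPn; apply: contra h => tb; by apply/hasP; exists t.
by rewrite (n t1) // (n t2) ?addn0; [right | lia].
Qed.

Lemma gapD_up b : gap m b u -> has (fun x => m < x) b.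
Proof.
by move=> g; have := gap_up letterD0 gapD_low gapD_m (leqnn m) g; rewrite ltnn.
Qed.

Lemma fork_gapsD : fork_gaps (ge_word m u).
Proof.
split.
  move=> b /gap_filter_inv[b0 /gapD_up /hasP[y yb my] <-].
  by apply/hasP; exists y => //; rewrite mem_filter yb (ltnW my).
move=> t b mt /gap_filter_inv[b0 /(gapD_top mt) h <-].
suff -> : count_mem m [seq y <- b0 | m <= y] = count_mem m b0 by [].
rewrite count_filter; apply: eq_count => y /=.
by case: eqP => // ->; rewrite leqnn.
Qed.

Lemma gapD_top_once t b : m < t -> gap m b u -> count_mem t b <= 1.
Proof.
move=> mt g; rewrite leqNgt; apply/negP => /gap_count[b' g'].
have := gapD_top mt (gap_trans g g').
have /count_memPn -> // : m \notin b'.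
by case: g => a [d [_]]; apply: contra; exact: (gap_sub g').
Qed.

Lemma gapD_peak b t : gap m b u -> m.-1 \notin b -> m < t <= m.+2 -> count_mem t b = 1.
Proof.
move=> g nm mt; have := gu g; rewrite count_nbD_m (count_memPn nm) add0n.
have h1 := gapD_top_once (ltnSn m) g.
have h2 := gapD_top_once (ltnW (ltnSn t1)) g.
have E (x y : nat) : x <= 1 -> y <= 1 -> 2 <= x + y -> x = 1 /\ y = 1 by lia.
move=> h3; have [e1 e2] := E _ _ h1 h2 h3.
have [->|->] // : t = t1 \/ t = t2 by lia.
Qed.

(** The gap from the last t of [a] to the t inside the peak needs two letters m, so [a] has a gap of
    m after that t. The top in this gap can only be t', and between its last occurrence there and
    the t' inside the peak there is just one m, a contradiction. *)
Lemma gapD_peak_left t t' a b d : m < t <= m.+2 -> m < t' <= m.+2 -> t != t' ->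
  u = a ++ m :: b ++ m :: d -> m \notin b -> m.-1 \notin b -> t \notin a.
Proof.
move=> mt mt' tt eu mb nm; have g : gap m b u by exists a, d.
have tb := gapD_peak g nm mt; have tb' := gapD_peak g nm mt'.
have m_t : m != t by lia.
have m_t' : m != t' by lia.
have tl : m < t by case/andP: mt.
have tl' : m < t' by case/andP: mt'.
apply/negP => /split_last[a1 [a2 [ea ta2]]].
have /split_first[b1 [b2 [eb tb1]]] : t \in b by rewrite -has_pred1 has_count tb.
have mb1 : m \notin b1 by apply: contra mb; rewrite eb mem_cat => ->.
have g1 : gap t (a2 ++ m :: b1) u.
  exists a1, (b2 ++ m :: d); rewrite eu ea eb -?catA /= -?catA /= -?catA.
  by rewrite mem_cat inE (negbTE ta2) (negbTE tb1) orbF eq_sym.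
have := gapD_top tl g1; rewrite count_cat /= eqxx (count_memPn mb1).
have ma2 : 2 <= count_mem m a2 + (1 + 0) -> m \in a2.
  by rewrite -has_pred1 has_count; case: (count _ a2).
move=> /ma2/split_last[z [y [ez my]]].
have g2 : gap m y u.
  by exists (a1 ++ t :: z), (b ++ m :: d); rewrite eu ea ez -?catA /= -?catA.
have /hasP[s sy ms] := gapD_up g2.
have es : s = t'.
  have : s \in u by exact: (gap_sub g2).
  move=> /(allP au) /andP[_ sm].
  have : s != t by apply: contraNneq ta2 => <-; rewrite ez mem_cat inE sy !orbT.
  by move: mt mt' tt ms sm; lia.
rewrite es in sy; have /split_last[y1 [y2 [ey ty2]]] := sy.
have /split_first[c1 [c2 [ec tc1]]] : t' \in b by rewrite -has_pred1 has_count tb'.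
have g3 : gap t' (y2 ++ m :: c1) u.
  exists (a1 ++ t :: z ++ m :: y1), (c2 ++ m :: d).
  rewrite eu ea ez ey ec -?catA /= -?catA /= -?catA /= -?catA; split=> //.
  by rewrite mem_cat inE (negbTE ty2) (negbTE tc1) orbF eq_sym.
have := gapD_top tl' g3; rewrite count_cat /= eqxx.
have -> : count_mem m y2 = 0.
  by apply/count_memPn; apply: contra my; rewrite ey mem_cat inE => ->; rewrite !orbT.
by rewrite (count_memPn _) //; apply: contra mb; rewrite ec mem_cat => ->.
Qed.

End Word.

Lemma gapD_peak_right u t t' a b d : all (fun y => 0 < y <= m.+2) u ->
  (forall i b, gap i b u -> 2 <= count (nb matD i) b) ->
  m < t <= m.+2 -> m < t' <= m.+2 -> t != t' ->
  u = a ++ m :: b ++ m :: d -> m \notin b -> m.-1 \notin b -> t \notin d.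
Proof.
move=> au gu mt mt' tt eu mb nm; rewrite -mem_rev.
apply: (@gapD_peak_left (rev u) _ _ t t' (rev d) (rev b) (rev a)) => //.
- by rewrite all_rev.
- by move=> i b' /gap_rev; rewrite revK => /gu; rewrite count_rev.
- by rewrite eu !(rev_cat, rev_cons) -!cats1 -!catA.
- by rewrite mem_rev.
- by rewrite mem_rev.
Qed.

Lemma gapD_peak_counts u b : all (fun y => 0 < y <= m.+2) u ->
  (forall i b, gap i b u -> 2 <= count (nb matD i) b) ->
  gap m b u -> m.-1 \notin b ->
  [/\ count_mem m u = 2, count_mem t1 u = 1 & count_mem t2 u = 1].
Proof.
move=> au gu g nm; case: (g) => a [d [eu mb]].
have h1 : m < t1 <= m.+2 by lia.
have h2 : m < t2 <= m.+2 by lia.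
have h12 : t1 != t2 by lia.
have h21 : t2 != t1 by lia.
have L t t' mt mt' tt := gapD_peak_left au gu (t := t) (t' := t') mt mt' tt eu mb nm.
have R t t' mt mt' tt := gapD_peak_right au gu (t := t) (t' := t') mt mt' tt eu mb nm.
have up b' : gap m b' u -> t1 \in b' \/ t2 \in b'.
  move=> g'; have /hasP[s sb ms] := gapD_up au gu g'.
  have /(allP au) /andP[_ sm] : s \in u by exact: (gap_sub g').
  have [es|es] : s = t1 \/ s = t2 by move: ms sm; lia.
    by left; rewrite -es.
  by right; rewrite -es.
have [a1 a2] : t1 \notin a /\ t2 \notin a by split; [exact: (L _ _ h1 h2 h12) | exact: (L _ _ h2 h1 h21)].
have [d1 d2] : t1 \notin d /\ t2 \notin d by split; [exact: (R _ _ h1 h2 h12) | exact: (R _ _ h2 h1 h21)].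
have ct t : m < t <= m.+2 -> t \notin a -> t \notin d -> count_mem t u = 1.
  move=> mt ta td; rewrite eu count_cat /= count_cat /= (gapD_peak au gu g nm mt).
  rewrite (count_memPn ta) (count_memPn td); case: eqP => // e.
  by move: mt; rewrite e ltnn.
split; [|exact: ct|exact: ct].
have ma : m \notin a.
  apply/negP => /split_last[z [y [ez my]]].
  have /up : gap m y u by exists z, (b ++ m :: d); rewrite eu ez -catA.
  have sy : {subset y <= a} by move=> k; rewrite ez mem_cat inE => ->; rewrite !orbT.
  by case=> /sy; apply/negP.
have md : m \notin d.
  apply/negP => /split_first[z [y [ez mz]]].
  have /up : gap m z u by exists (a ++ m :: b), y; rewrite eu ez -?catA /= -?catA.
  have sz : {subset z <= d} by move=> k; rewrite ez mem_cat => ->.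
  by case=> /sz; apply/negP.
by rewrite eu count_cat /= count_cat /= eqxx !(count_memPn _).
Qed.

(** All edges are simple: the forbidden factors ii and iji are gaps with fewer than two neighbours,
    and [fc_gap] has no exceptional label. *)
Lemma fc_gapD u : fc_word matD u <-> forall v, peq matD u v ->
  forall i b, gap i b v -> 2 <= count (nb matD i) b.
Proof.
split=> [fu v uv i b g|h v uv].
  have [//|[j _ [/andP[ji nij] n3 _]]] := fc_gap matD_sym matD_diag (fc_word_peq uv fu) g.
  by move: nij n3; rewrite /matD (eq_sym i j) (negbTE ji); case: adjD.
split=> [a b i e|a b i j ij mij e].
  have g : gap i [::] v by exists a, b; rewrite e.
  by have := h v uv i [::] g.
have m3 : matD i j = 3 by move: mij; rewrite /matD (negbTE ij); case: adjD.
have g : gap i [:: j] v by exists a, b; rewrite e m3 inE.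
by have := h v uv i [:: j] g; rewrite /=; case: nb.
Qed.

Lemma runD_exists u : all (fun y => 0 < y <= m.+2) u ->
  (forall i b, gap i b u -> 2 <= count (nb matD i) b) ->
  exists2 s, run m u s & state_ok u m s.
Proof.
move=> au gu; apply: (run_exists (letterD0 au) (gapD_low gu) (gapD_m au gu)) => // b _ g nm.
by have [] := gapD_peak_counts au gu g nm.
Qed.

End Fork.

(** * Normal forms of words at the fork *)

Section ForkWords.
Variable m : nat.
Local Notation t1 := m.+1.
Local Notation t2 := m.+2.
Implicit Types (p w : seq nat) (a b : nat).

(** Two tops separated by a single m must differ, since a gap of a top contains two m. The letters
    t1 of an alternating word are therefore renamed a, b, a, b, and so on. *)
Fixpoint fork_alt a b p : seq nat :=
  if p is c :: p' then
    if c == t1 then a :: fork_alt b a p' else c :: fork_alt a b p'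
  else [::].

(** The remaining case, where the two commuting tops are adjacent; in [finD] it is applied to words
    with a single t1. *)
Fixpoint fork_both p : seq nat :=
  if p is c :: p' then
    if c == t1 then [:: t1, t2 & fork_both p'] else c :: fork_both p'
  else [::].

Definition fork_merge w : seq nat := map (fun y => if y == t2 then t1 else y) w.

Definition tops a b := (a == t1) && (b == t2) || (a == t2) && (b == t1).

(* No two adjacent m's, no two adjacent tops, no t m t. *)
Fixpoint fork_local w : bool :=
  if w is c :: w' then
    (if w' is d :: w'' then ((c == m) != (d == m)) &&
       (if w'' is e :: _ then (c == m) || (c != e) else true) else true) && fork_local w'
  else true.

Lemma topsC a b : tops a b = tops b a.
Proof. by rewrite /tops; lia. Qed.

Lemma fork_altK a b p : tops a b -> all (pred2 m t1) p -> fork_merge (fork_alt a b p) = p.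
Proof.
rewrite /fork_merge; elim: p a b => //= c p ih a b ab /andP[cm ap].
case: (eqVneq c t1) cm => [->|ct] cm /=.
  rewrite ih 1?topsC //; congr (_ :: _); move: ab; rewrite /tops.
  by case: (eqVneq a t2); lia.
rewrite ih //; congr (_ :: _); case: (eqVneq c t2) => // e.
by move: cm; rewrite e; lia.
Qed.

Lemma fork_bothK p : all (pred2 m t1) p -> filter (fun y => y != t2) (fork_both p) = p.
Proof.
have e12 : (t1 == t2) = false by lia.
elim: p => //= c p ih /andP[cm ap]; case: (eqVneq c t1) cm => [->|ct] cm.
  by rewrite [filter _ _]/= e12 eqxx /= ih.
rewrite [filter _ _]/= ih //; case: (eqVneq c t2) => // e.
by move: cm; rewrite e; lia.
Qed.

Lemma all_fork_alt a b p : tops a b -> all (pred2 m t1) p ->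
  all (fun y => m <= y <= t2) (fork_alt a b p).
Proof.
elim: p a b => //= c p ih a b ab /andP[cm ap].
have := ab; rewrite /tops => ab'.
have ba : tops b a by rewrite topsC.
by case: (eqVneq c t1) cm => [->|ct] cm /=; rewrite ih // ?andbT; lia.
Qed.

Lemma all_fork_both p : all (pred2 m t1) p -> all (fun y => m <= y <= t2) (fork_both p).
Proof.
elim: p => //= c p ih /andP[cm ap].
by case: (eqVneq c t1) cm => [->|ct] cm /=; rewrite ih // ?andbT; lia.
Qed.

Lemma count_fork_alt a b p : tops a b -> all (pred2 m t1) p ->
  count_mem m (fork_alt a b p) = count_mem m p /\
  count (fun y => m < y) (fork_alt a b p) = count_mem t1 p.
Proof.
elim: p a b => //= c p ih a b ab /andP[cm ap].
have := ab; rewrite /tops => ab'.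
have ba : tops b a by rewrite topsC.
case: (eqVneq c t1) cm => [->|ct] cm /=.
  by have [-> ->] := ih b a ba ap; split; lia.
by have [-> ->] := ih a b ab ap; split; lia.
Qed.

Lemma count_fork_both p : all (pred2 m t1) p ->
  count_mem m (fork_both p) = count_mem m p /\
  count (fun y => m < y) (fork_both p) = (count_mem t1 p).*2.
Proof.
elim: p => //= c p ih /andP[cm ap].
have [e1 e2] := ih ap.
by case: (eqVneq c t1) cm => [->|ct] cm /=; rewrite e1 e2; split; lia.
Qed.

Lemma fork_local_altw a b n : tops a b ->
  fork_local (fork_alt a b (altw m t1 n)) /\ fork_local (fork_alt a b (altw t1 m n)).
Proof.
have mt : (m == t1) = false by lia.
elim: n a b => //= n ih a b ab; have ab' := ab; rewrite /tops in ab'.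
have ba : tops b a by rewrite topsC.
have [ih1 _] := ih b a ba; have [_ ih2] := ih a b ab.
rewrite mt eqxx /= ih1 ih2 !andbT.
have am : (a == m) = false by lia.
have bm : (b == m) = false by lia.
have nab : a != b by lia.
by case: n {ih ih1 ih2} => [|[|n]] //=; rewrite ?mt ?eqxx /= ?mt ?eqxx /= am ?bm ?eqxx ?nab.
Qed.

Lemma fork_local_alt a b p : tops a b -> all (pred2 m t1) p ->
  sorted (fun x y => x != y) p -> fork_local (fork_alt a b p).
Proof.
move=> ab ap /(@sorted_neq_altw _ m t1) []; rewrite ?(ltn_eqF (ltnSn m)) // => ->.
  by have [] := fork_local_altw (size p) ab.
by have [_] := fork_local_altw (size p) ab.
Qed.

Lemma fork_local_cat u w : fork_local (u ++ w) -> fork_local w.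
Proof. by elim: u => //= c u ih /andP[_ /ih]. Qed.

Lemma fork_local_gaps p : all (fun y => m <= y <= t2) p -> fork_local p -> fork_gaps m p.
Proof.
move=> ap lp; split.
  move=> c [a [d [e mc]]]; move: lp; rewrite e => /fork_local_cat.
  case: c e mc => [|x c] e mc; first by rewrite /= !eqxx.
  move=> _; apply/hasP; exists x; first exact: mem_head.
  have : x \in p by rewrite e mem_cat !inE eqxx !orbT.
  move=> /(allP ap); move: mc; rewrite inE; lia.
move=> t c mt [a [d [e tc]]]; have := lp; rewrite e => /fork_local_cat.
have tm : (t == m) = false by lia.
have sc : {subset c <= p} by move=> y yc; rewrite e mem_cat inE mem_cat yc !orbT.
case: c {e} tc sc => [|x c] tc sc; first by rewrite /= tm eqxx.
rewrite /= tm; case: (eqVneq x m) => [->|//] /=.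
case: c tc sc => [|y c] tc sc /=; first by rewrite eqxx.
case: (eqVneq y m) => [//|ym].
case: c tc sc => [|z c] tc sc /=; first by rewrite tm !andbF.
by case: (eqVneq z m) => //= zm; rewrite !andbF.
Qed.

(** The first top determines all the others, because tops are never adjacent and the factor t m t is
    excluded. *)
Lemma fork_local_inv p a b : all (fun y => m <= y <= t2) p -> fork_local p -> tops a b ->
  (forall l t r, p = l ++ t :: r -> m < t -> ~~ has (fun y => m < y) l -> t = a) ->
  p = fork_alt a b (fork_merge p) /\ sorted (fun x y => x != y) (fork_merge p).
Proof.
elim: p a b => //= x p ih a b /andP[xm ap] /andP[l1 lp] ab fa.
have ab' := ab; rewrite /tops in ab'.
have ba : tops b a by rewrite topsC.
have mt : (m == t2) = false by lia.
have mt1 : (m == t1) = false by lia.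
have [ex|nx] := eqVneq x m.
  subst x; rewrite mt mt1.
  have [|e s] := ih a b ap lp ab.
    move=> l t r e mt' nl; apply: (fa (m :: l) t r) => //; first by rewrite e.
    by rewrite /= ltnn.
  rewrite -e; split=> //; case: p e s l1 {ih fa ap lp} => //= y p _ -> .
  by rewrite eqxx /= => /andP[ym _]; rewrite andbT; case: (eqVneq y t2) => _; lia.
have xa : x = a by apply: (fa [::] x p) => //=; lia.
have -> : (if x == t2 then t1 else x) = t1 by case: (eqVneq x t2); lia.
rewrite eqxx /=.
have [|e s] := ih b a ap lp ba.
  move=> l t r e mt' nl.
  case: p e l1 ap lp {ih fa} => [|y p] e l1 ap lp; first by case: l e {nl}.
  have ey : y = m by apply/eqP; case/andP: l1; rewrite (negbTE nx); case: (y == m).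
  subst y; case: l e nl => [|y' l] [ey e] nl; first by move: mt'; rewrite -ey ltnn.
  case: p e l1 ap lp => [|z p] e l1 ap lp; first by case: l e {nl}.
  have xz : x != z by case/andP: l1 => _; rewrite (negbTE nx).
  have zm : z != m by case/andP: lp => /andP[+ _] _; rewrite eqxx; case: (z == m).
  have /and3P[_ zr _] := ap.
  case: l e nl => [|z' l] [ez e] nl; first by rewrite -ez; move: xz; rewrite xa; lia.
  by move: nl; rewrite /= -ez !negb_or => /and3P[_]; lia.
rewrite -e xa; split=> //.
case: p e s l1 {ih fa ap lp} => //= y p _ ->.
rewrite (negbTE nx) /= andbT => /andP[ym _]; case: (eqVneq y t2) => h; lia.
Qed.

Lemma split_has (P : pred nat) w : has P w ->
  exists (l r : seq nat) (z : nat), [/\ w = l ++ z :: r, P z & ~~ has P l].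
Proof.
elim: w => //= x w ih; case: (boolP (P x)) => Px /= h.
  by exists [::], w, x.
have [l [r [z [-> Pz nl]]]] := ih h.
by exists (x :: l), r, z; split=> //=; rewrite negb_or Px.
Qed.

Lemma notin_small x w : m < x -> ~~ has (fun y => m < y) w -> x \notin w.
Proof. by move=> mx; apply: contra => xw; apply/hasP; exists x. Qed.

Lemma fork_gaps_rev p : fork_gaps m p -> fork_gaps m (rev p).
Proof.
move=> [g1 g2]; split=> [b|t b mt] /gap_rev; rewrite revK.
  by move=> /g1; rewrite has_rev.
by move=> /(g2 _ _ mt); rewrite count_rev.
Qed.

(** A stretch without tops has at most one m, since a gap of m needs a top. Another top after x y
    would thus close a gap of x or y with at most one m; so [r] has no top, and hence at most one
    m. *)
Lemma fork_adj_right p l x y r : all (fun y => m <= y <= t2) p -> fork_gaps m p ->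
  p = l ++ [:: x, y & r] -> m < x -> m < y -> r = [::] \/ r = [:: m].
Proof.
move=> ap [g1 g2] e mx my.
have sub z : z \in [:: x, y & r] -> m <= z <= t2.
  by move=> zr; apply: (allP ap); rewrite e mem_cat zr orbT.
have xy : x != y.
  apply/eqP => exy; have := g2 x [::] mx; rewrite /= => h; have // : 1 < 0.
  by apply: h; exists l, r; rewrite e exy.
have cm s : (exists s1 s2, r = s1 ++ s ++ s2) -> ~~ has (fun y => m < y) s -> count_mem m s <= 1.
  move=> [s1 [s2 es]] ns; rewrite leqNgt; apply/negP => /gap_count[b g].
  have /g1 /hasP[z zb mz] : gap m b p.
    by have := gap_cat (l ++ [:: x, y & s1]) s2 g; rewrite e es -catA.
  by move/hasP: ns; apply; exists z => //; exact: (gap_sub g).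
have nr : ~~ has (fun y => m < y) r.
  apply/negP => /split_has[r1 [r2 [z [er mz nr1]]]].
  have c1 : count_mem m r1 <= 1 by apply: cm => //; exists [::], (z :: r2).
  have [ez|ez] : z = y \/ z = x.
    have hz : m <= z <= t2 by apply: sub; rewrite er !inE mem_cat mem_head !orbT.
    have hx : m <= x <= t2 by apply: sub; rewrite mem_head.
    have hy : m <= y <= t2 by apply: sub; rewrite !inE eqxx orbT.
    by move: xy mx my mz; lia.
  - have : gap y r1 p.
      exists (rcons l x), r2; rewrite e er ez -cats1 -catA; split=> //.
      exact: notin_small.
    by move=> /(g2 _ _ my); rewrite leqNgt ltnS c1.
  - have : gap x (y :: r1) p.
      exists l, r2; rewrite e er ez; split=> //.
      by rewrite inE negb_or xy notin_small.
    move=> /(g2 _ _ mx) /=; rewrite (_ : (y == m) = false); last by lia.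
    by rewrite add0n leqNgt ltnS c1.
have : all (pred1 m) r.
  apply/allP => z zr /=; have := sub z; rewrite !inE zr !orbT => /(_ isT).
  move=> /andP[mz _]; rewrite eqn_leq mz andbT leqNgt; apply: contra nr => h.
  by apply/hasP; exists z.
have : count_mem m r <= 1 by apply: cm => //; exists [::], [::]; rewrite cats0.
case: r {e sub cm nr} => [|z [|z' r]] /=; [by left | by move=> _ /andP[/eqP -> _]; right|].
by move=> h /and3P[/eqP ez /eqP ez' _]; move: h; rewrite ez ez' eqxx.
Qed.

Lemma fork_adj p : all (fun y => m <= y <= t2) p -> fork_gaps m p ->
  ~~ sorted (fun x y => ~~ ((m < x) && (m < y))) p ->
  exists l r x y, [/\ p = l ++ [:: x, y & r], tops x y,
     l = [::] \/ l = [:: m] & r = [::] \/ r = [:: m]].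
Proof.
move=> ap gp ns.
have [l [r [x [y [e mx my]]]]] : exists l r x y, [/\ p = l ++ [:: x, y & r], m < x & m < y].
  elim: p ns {ap gp} => //= x p ih; case: p ih => //= y p ih.
  rewrite negb_and negbK; case: (boolP ((m < x) && (m < y))) => [/andP[mx my] _|_ /= /ih].
    by exists [::], p, x, y.
  by move=> [l [r [x' [y' [-> mx my]]]]]; exists (x :: l), r, x', y'.
exists l, r, x, y; split=> //; last exact: (fork_adj_right ap gp e).
  have xy : x != y.
    apply/eqP => exy; have [_ /(_ x [::] mx)] := gp; rewrite /= => h; have // : 1 < 0.
    by apply: h; exists l, r; rewrite e exy.
  have h1 : m <= x <= t2 by apply: (allP ap); rewrite e mem_cat mem_head orbT.
  have h2 : m <= y <= t2 by apply: (allP ap); rewrite e mem_cat !inE eqxx !orbT.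
  by move: xy mx my h1 h2; rewrite /tops; lia.
have e' : rev p = rev r ++ [:: y, x & rev l].
  by rewrite e !(rev_cat, rev_cons) -!cats1 -!catA.
have ar : all (fun y => m <= y <= t2) (rev p) by rewrite all_rev.
have [h|h] := fork_adj_right ar (fork_gaps_rev gp) e' my mx.
  by left; rewrite -[l]revK h.
by right; rewrite -[l]revK h.
Qed.

Lemma fork_gaps_local p : all (fun y => m <= y <= t2) p -> fork_gaps m p ->
  sorted (fun x y => ~~ ((m < x) && (m < y))) p -> fork_local p.
Proof.
move=> ap [g1 g2] sp.
suff H w u : p = u ++ w -> fork_local w by exact: (H p [::]).
elim: w u => //= c w ih u e.
rewrite (ih (rcons u c)) ?andbT; last by rewrite cat_rcons.
case: w e {ih} => // d w e.
have [dp cp] : d \in p /\ c \in p by rewrite e !mem_cat !inE !eqxx !orbT.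
have := allP ap d dp; have := allP ap c cp => /= hc hd.
have cd : (c == m) != (d == m).
  apply/negP => /eqP h; have [ec|nc] := eqVneq c m.
    rewrite ec eqxx in h; have ed : d = m by apply/eqP; rewrite -h.
    suff : has (fun y => m < y) [::] by [].
    by apply: g1; exists u, w; rewrite e ec ed.
  have nd : d != m by rewrite -h (negbTE nc).
  move: sp; rewrite e => /cat_sorted2[_] /= /andP[]; lia.
rewrite cd /=; case: w e => // x w e.
have [//|nc] := eqVneq c m; apply/eqP => cx.
have ed : d = m by apply/eqP; move: cd; rewrite (negbTE nc); case: (d == m).
have := g2 c [:: d]; rewrite /= ed eqxx => h; have // : 1 < 1.
apply: h; first by lia.
by exists u, w; rewrite e ed -cx inE.
Qed.

Hypothesis m0 : 0 < m.

(** The condition [0 < z.2] avoids listing twice the words without tops, for which the first top is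
    not a choice. *)
Definition finD (s : state) : seq (seq nat) :=
  if s is Some h then
    [seq fork_alt t1 t2 z.1 | z <- alts m t1 h] ++
    [seq fork_alt t2 t1 z.1 | z <- alts m t1 h & 0 < z.2] ++
    [seq fork_both z.1 | z <- alts m t1 h & z.2 == 1]
  else [:: [:: m; t1; t2; m]].

Lemma peq_tops x y : tops x y -> peq (matD m) [:: x; y] [:: t1; t2].
Proof.
case/orP => /andP[/eqP -> /eqP ->] //.
apply: (peq_comm (matD_sym m0)); apply/eqP; rewrite matD2 /adjD; lia.
Qed.

Lemma finD_complete p : all (fun y => m <= y <= t2) p -> fork_gaps m p ->
  exists2 p0, p0 \in finD (Some (count_mem m p)) & peq (matD m) p p0.
Proof.
move=> ap gp; have mt : m != t1 by lia.
have [sp|ns] := boolP (sorted (fun x y => ~~ ((m < x) && (m < y))) p); last first.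
  have [l [r [x [y [e xy hl hr]]]]] := fork_adj ap gp ns.
  have ms : all (pred2 m t1) (l ++ t1 :: r) /\ sorted (fun x y => x != y) (l ++ t1 :: r).
    by case: hl => ->; case: hr => -> /=; rewrite ?eqxx ?orbT /=; split=> //; lia.
  have := alts_complete mt ms.1 ms.2.
  have -> : count_mem t1 (l ++ t1 :: r) = 1.
    by case: hl => ->; case: hr => -> /=; rewrite ?eqxx ?(negbTE mt).
  have -> : count_mem m (l ++ t1 :: r) = count_mem m p.
    rewrite e !count_cat /=; case/orP: xy => /andP[/eqP -> /eqP ->]; lia.
  move=> h; exists (fork_both (l ++ t1 :: r)).
    rewrite !mem_cat; apply/orP; right; apply/orP; right; apply/mapP.
    by exists (l ++ t1 :: r, 1) => //; rewrite mem_filter eqxx.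
  have -> : fork_both (l ++ t1 :: r) = l ++ [:: t1; t2] ++ r.
    by case: hl => ->; case: hr => -> /=; rewrite ?eqxx ?(negbTE mt).
  rewrite e; apply: peq_cat => //; rewrite -[[:: x, y & r]]/([:: x; y] ++ r).
  by apply: peq_cat => //; exact: peq_tops.
have lp := fork_gaps_local ap gp sp.
have aq : all (pred2 m t1) (fork_merge p).
  by apply/allP => z /mapP[z' /(allP ap) /= h ->]; case: (eqVneq z' t2); lia.
have fin a b : tops a b ->
  (forall l t r, p = l ++ t :: r -> m < t -> ~~ has (fun y => m < y) l -> t = a) ->
  p = fork_alt a b (fork_merge p) /\
  (fork_merge p, count (fun y => m < y) p) \in alts m t1 (count_mem m p).
  move=> ab fa; have [e s] := fork_local_inv ap lp ab fa; split=> //.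
  have [e1 e2] := count_fork_alt ab aq; rewrite -e in e1 e2; rewrite e1 e2.
  exact: alts_complete.
have [hp|np] := boolP (has (fun y => m < y) p); last first.
  have [||e h] := fin t1 t2; first by rewrite /tops !eqxx.
    by move=> l t r e mt' _; move/hasP: np; case; exists t => //; rewrite e mem_cat mem_head orbT.
  exists p => //; rewrite e !mem_cat; apply/orP; left; apply/mapP.
  by exists (fork_merge p, count (fun y => m < y) p) => //=; rewrite -e.
have [l [r [t [e mt' nl]]]] := split_has hp.
have un l' t' r' : p = l' ++ t' :: r' -> m < t' -> ~~ has (fun y => m < y) l' -> t' = t.
  move=> e' mt'' nl'; have : l ++ t :: r = l' ++ t' :: r' by rewrite -e -e'.
  elim: l l' nl nl' {e e'} => [|z l ih] [|z' l'] /=; first by move=> _ _ [].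
  - by move=> _; rewrite negb_or => /andP[h _] [e _]; rewrite -e mt' in h.
  - by rewrite negb_or => /andP[h _] _ [e _]; rewrite e mt'' in h.
  - by rewrite !negb_or => /andP[_ h1] /andP[_ h2] [_ /ih]; exact.
have : t = t1 \/ t = t2.
  have /(allP ap) : t \in p by rewrite e mem_cat mem_head orbT.
  by move: mt' => /=; lia.
case=> et; rewrite et in un.
  have [|e1 h] := fin t1 t2 _ un; first by rewrite /tops !eqxx.
  exists p => //; rewrite [in X in X \in _]e1 !mem_cat; apply/orP; left; apply/mapP.
  by exists (fork_merge p, count (fun y => m < y) p).
have [|e1 h] := fin t2 t1 _ un; first by rewrite /tops !eqxx orbT.
exists p => //; rewrite [in X in X \in _]e1 !mem_cat; apply/orP; right; apply/orP; left; apply/mapP.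
exists (fork_merge p, count (fun y => m < y) p) => //.
by rewrite mem_filter h -has_count hp.
Qed.
End ForkWords.

Section ForkFinal.
Variable m : nat.
Local Notation t1 := m.+1.
Local Notation t2 := m.+2.
Let mt : m != t1. Proof. by lia. Qed.
Let mt1 : (m == t1) = false. Proof. by lia. Qed.
Let mt2 : (m == t2) = false. Proof. by lia. Qed.
Let tm1 : (t1 == m) = false. Proof. by lia. Qed.
Let tm2 : (t2 == m) = false. Proof. by lia. Qed.
Let t12 : (t1 == t2) = false. Proof. by lia. Qed.
Let t21 : (t2 == t1) = false. Proof. by lia. Qed.
Let tops12 : tops m t1 t2. Proof. by rewrite /tops !eqxx. Qed.
Let tops21 : tops m t2 t1. Proof. by rewrite /tops !eqxx orbT. Qed.

Variant finD_shape h : seq nat -> Prop :=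
  | FinDAlt a b p k of tops m a b & (p, k) \in alts m t1 h :
      finD_shape h (fork_alt m a b p)
  | FinDBoth p of (p, 1) \in alts m t1 h : finD_shape h (fork_both m p).

Lemma finD_someP h p : p \in finD m (Some h) -> finD_shape h p.
Proof.
rewrite /finD !mem_cat => /or3P[] /mapP[[p0 k]].
- by move=> hp ->; exact: FinDAlt tops12 hp.
- by rewrite mem_filter => /andP[_ hp] ->; exact: FinDAlt tops21 hp.
- by rewrite mem_filter /= => /andP[/eqP -> hp] ->; exact: FinDBoth.
Qed.

Lemma finD_spec s p : p \in finD m s ->
  all (fun y => m <= y <= t2) p /\ count_mem m p = ht s.
Proof.
case: s => [h|].
  case/finD_someP => [a b p0 k ab|p0] /(alts_spec mt)[/= ap <- _ _].
    by split; [exact: all_fork_alt | have [] := count_fork_alt ab ap].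
  by split; [exact: all_fork_both | have [] := count_fork_both ap].
by rewrite inE => /eqP -> /=; rewrite eqxx; lia.
Qed.

Lemma finD_uniq s : uniq (finD m s).
Proof.
case: s => [h|] //; rewrite /finD.
have inj1 : {in alts m t1 h &, injective fst}.
  move=> [p k] [p' k'] /(alts_spec mt)[_ _ /= <- _] /(alts_spec mt)[_ _ /= <- _] /= ->; by [].
have fl (P : pred (seq nat * nat)) : {subset filter P (alts m t1 h) <= alts m t1 h}.
  by move=> z; rewrite mem_filter => /andP[].
have inj2 a b : tops m a b -> {in alts m t1 h &, injective (fun z => fork_alt m a b z.1)}.
  move=> ab z z' hz hz' e; apply: inj1 => //.
  have [az _ _ _] := alts_spec mt hz; have [az' _ _ _] := alts_spec mt hz'.
  by rewrite -(fork_altK ab az) e fork_altK.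
have inj3 : {in alts m t1 h &, injective (fun z => fork_both m z.1)}.
  move=> z z' hz hz' e; apply: inj1 => //.
  have [az _ _ _] := alts_spec mt hz; have [az' _ _ _] := alts_spec mt hz'.
  by rewrite -(fork_bothK az) e fork_bothK.
have ft a b p : tops m a b -> all (pred2 m t1) p ->
    head t1 (filter (fun y => m < y) (fork_alt m a b p)) = if count_mem t1 p == 0 then t1 else a.
  elim: p a b => //= c p ih a b ab /andP[cm ap].
  have ab' := ab; rewrite /tops in ab'.
  case: (eqVneq c t1) cm => [->|ct] cm /=; first by rewrite (_ : m < a) //; lia.
  by rewrite (_ : (m < c) = false) ?ih //; lia.
have nb p : (p, 1) \in alts m t1 h -> ~~ fork_local m (fork_both m p).
  move=> /(alts_spec mt)[/= ap _ c1 _].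
  elim: p ap c1 => //= c p ih /andP[cm ap].
  case: (eqVneq c t1) cm => [->|ct] cm /=.
    by rewrite tm1 tm2.
  by rewrite add0n => /(ih ap) h'; rewrite negb_and h' orbT.
have lo a b p k : tops m a b -> (p, k) \in alts m t1 h -> fork_local m (fork_alt m a b p).
  by move=> ab /(alts_spec mt)[ap _ _ sp]; exact: fork_local_alt.
rewrite !cat_uniq !map_inj_in_uniq ?filter_uniq ?alts_uniq //; last first.
- exact: inj2 tops12.
- by move=> z z' /fl hz /fl hz'; exact: inj2 tops21 _ _ hz hz'.
- by move=> z z' /fl hz /fl hz'; exact: inj3.
rewrite !andTb !andbT; apply/andP; split.
  apply/hasPn => w; rewrite mem_cat => /orP[] /mapP[[p k]]; rewrite mem_filter => /andP[k0 hp] ->.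
    apply/negP => /mapP[[p' k'] hp' e].
    have [ap _ ck _] := alts_spec mt hp; have [ap' _ _ _] := alts_spec mt hp'.
    have := congr1 (fun w => head t1 (filter (fun y => m < y) w)) e.
    rewrite !ft // ck (gtn_eqF k0); case: ifP => _; lia.
  apply/negP => /mapP[[p' k'] hp' e]; have := lo _ _ _ _ tops12 hp'.
  by move: e => /= <-; apply/negP/nb; rewrite -(eqP k0).
apply/hasPn => w /mapP[[p k]]; rewrite mem_filter => /andP[k0 hp] ->.
apply/negP => /mapP[[p' k']]; rewrite mem_filter => /andP[_ hp'] e.
have := lo _ _ _ _ tops21 hp'.
by move: e => /= <-; apply/negP/nb; rewrite -(eqP k0).
Qed.

(** The tops t1, t2 are the only commuting pair at the fork, so forbidding t2 t1 leaves at most one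
    word of each class. *)
Definition canonical (w : seq nat) := sorted (fun x y => ~~ ((x == t2) && (y == t1))) w.

Lemma fork_local_canonical w : fork_local m w -> canonical w.
Proof.
rewrite /canonical; elim: w => //= c w ih /andP[h /ih]; case: w h {ih} => //= d w /andP[cd _] ->.
rewrite andbT; apply/negP => /andP[/eqP e1 /eqP e2]; move: cd; rewrite e1 e2.
by rewrite tm1 tm2.
Qed.

Lemma alts_one h p : (p, 1) \in alts m t1 h ->
  [\/ p = [:: t1], p = [:: m; t1], p = [:: t1; m] | p = [:: m; t1; m]].
Proof.
case: h => [|[|[|h]]]; rewrite /alts /= !inE !xpair_eqE ?andbF ?orbF ?andbT /=.
- by move=> /eqP ->; constructor 1.
- by case/orP => /eqP ->; [constructor 2 | constructor 3].
- by move=> /eqP ->; constructor 4.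
- by [].
Qed.

Lemma finD_canonical s p : p \in finD m s -> canonical p.
Proof.
case: s => [h|]; last first.
  by rewrite inE => /eqP ->; rewrite /canonical /=; lia.
case/finD_someP => [a b p0 k ab /(alts_spec mt)[/= ap _ _ sp]|p0 /alts_one hp].
  exact: fork_local_canonical (fork_local_alt ab ap sp).
by rewrite /canonical; case: hp => -> /=; rewrite ?eqxx /= ?(negbTE mt) /= ?eqxx /=; lia.
Qed.

Lemma canonical_peq w w' : 0 < m -> all (fun y => m <= y <= t2) w -> all (fun y => m <= y <= t2) w' ->
  canonical w -> canonical w' -> peq (matD m) w w' -> w = w'.
Proof.
move=> m0; have m1 : matD m m t1 <> 2 by apply: matD_top; lia.
have m2 : matD m m t2 <> 2 by apply: matD_top; lia.
(* In a canonical word beginning with t2, only t2 can precede the first m, so the projection on m,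
   t1 cannot begin with t1. *)
have bad z z' : all (fun y => m <= y <= t2) z' -> canonical (t2 :: z') ->
    filter (pred2 m t1) (t1 :: z) <> filter (pred2 m t1) (t2 :: z').
  move=> az cz; rewrite /= t21 tm2 eqxx orbT /=.
  elim: z' az cz => //= c z' ih /andP[hc az] /andP[c1 cz].
  have [ec|nc] := eqVneq c t2.
    by rewrite ec in cz; rewrite ec tm2 t21 /=; exact: ih.
  have ecm : c = m by move: c1 nc; rewrite eqxx /=; lia.
  by rewrite ecm eqxx /= => -[]; lia.
elim: w w' => [|c w ih] [|c' w'] //.
- by move=> _ _ _ _ /(peq_size (matD_diag m)).
- by move=> _ _ _ _ /(peq_size (matD_diag m)).
move=> /= /andP[hc aw] /andP[hc' aw'] cw cw' e.
have [ecc|ncc] := eqVneq c c'.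
  subst c'; congr (_ :: _); apply: ih => //; first exact: path_sorted cw.
    exact: path_sorted cw'.
  exact: peq_cons_inv e.
have H1 := e _ _ m1; have H2 := e _ _ m2; exfalso.
have C x : m <= x <= t2 -> [\/ x = m, x = t1 | x = t2].
  move=> hx; have [->|xm] := eqVneq x m; first by constructor 1.
  by have [->|x1] := eqVneq x t1; [constructor 2 | constructor 3; lia].
case: (C _ hc) (C _ hc') ncc H1 H2 cw cw' => -> [] -> ncc H1 H2 cw cw'.
- by rewrite eqxx in ncc.
- by move: H1; rewrite /= !eqxx tm1 orbT => -[]; lia.
- by move: H2; rewrite /= !eqxx tm2 orbT => -[]; lia.
- by move: H1; rewrite /= !eqxx tm1 orbT => -[]; lia.
- by rewrite eqxx in ncc.
- exact: (bad w w' aw' cw' H1).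
- by move: H2; rewrite /= !eqxx tm2 orbT => -[]; lia.
- exact: (bad w' w aw cw (esym H1)).
- by rewrite eqxx in ncc.
Qed.

Lemma fork_gaps_both p : [\/ p = [:: t1], p = [:: m; t1], p = [:: t1; m] | p = [:: m; t1; m]] ->
  fork_gaps m (fork_both m p).
Proof.
move=> hp; split=> [c|t c mt' /gap_count_ge].
  case: hp => -> /=; rewrite ?eqxx ?mt1 => g.
  - by have := gap_count_ge g; rewrite /=; lia.
  - by have := gap_count_ge g; rewrite /=; lia.
  - by have := gap_count_ge g; rewrite /=; lia.
  - rewrite (gap_ends (w := [:: t1; t2]) _ g) /= ?ltnSn //.
    by rewrite !inE; lia.
by case: hp => -> /=; rewrite ?eqxx ?mt1 /=; lia.
Qed.

Lemma finD_gaps s p : p \in finD m s -> fork_gaps m p.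
Proof.
case: s => [h|]; last first.
  rewrite inE => /eqP ->; have := @fork_gaps_both [:: m; t1; m].
  by rewrite /= !eqxx (negbTE mt); apply; constructor 4.
case/finD_someP => [a b p0 k ab /(alts_spec mt)[/= ap _ _ sp]|p0 /alts_one hp].
  exact: fork_local_gaps (all_fork_alt ab ap) (fork_local_alt ab ap sp).
exact: fork_gaps_both.
Qed.

Lemma cat_cons_count_inj (a a' x x' : seq nat) i : a ++ i :: x = a' ++ i :: x' ->
  count_mem i a = count_mem i a' -> a = a' /\ x = x'.
Proof.
elim: a a' => [|y a ih] [|y' a'] /=.
- by move=> [->].
- by move=> [<- _]; rewrite eqxx.
- by move=> [-> _]; rewrite eqxx.
- by move=> [-> e] /addnI h; have [-> ->] := ih a' e h.
Qed.

Hypothesis m0 : 0 < m.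

(** A gap of m without tops shows as mm in both projections, on m, t1 and on m, t2. The number of
    letters m before it identifies the same gap of [p] in both cases, and this gap then has no top
    either. *)
Lemma fork_gaps_peq p p' : all (fun y => m <= y <= t2) p -> all (fun y => m <= y <= t2) p' ->
  peq (matD m) p p' -> fork_gaps m p -> fork_gaps m p'.
Proof.
move=> ap ap' pp [g1 g2]; split; last first.
  move=> t c mt' g.
  have tp : t <= t2.
    have /(allP ap') /andP[] // : t \in p'.
    by case: g => a [d [-> _]]; rewrite mem_cat mem_head orbT.
  have mat_t : matD m m t <> 2 by apply: matD_top => //; rewrite mt'.
  have Pt : pred2 m t t by rewrite /= eqxx orbT.
  have := gap_filter Pt g; rewrite -pp // => /gap_filter_inv[c0 /(g2 _ _ mt') h e].
  have mnt : m != t by lia.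
  by rewrite -(count_pred2 (i := m) (j := t)) ?inE ?eqxx // -e count_pred2 ?inE ?eqxx.
move=> c [l [r [e mc]]]; apply: contraT => nc.
have D t : m < t <= t2 -> exists a b d, [/\ p = a ++ m :: b ++ m :: d, m \notin b,
    t \notin b & count_mem m a = count_mem m l].
  move=> mt'; have mat_t := matD_top m0 mt'.
  have fc : filter (pred2 m t) c = [::].
    apply: filter_pred2_nil => //; apply: contra nc => tc; apply/hasP; exists t => //.
    by case/andP: mt'.
  have := pp m t mat_t; rewrite e filter_cat /= eqxx filter_cat fc /= eqxx.
  move=> /filter_cat_inv[a [x [-> ea /(@filter_cat_inv _ _ m _ [::])[b [d [-> eb ed]]]]]].
  exists a, b, d; have mnt : m != t by lia.
  split=> //.
  - apply/negP => mb; have : m \in filter (pred2 m t) b by rewrite mem_filter mb /= eqxx.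
    by rewrite eb.
  - apply/negP => tb; have : t \in filter (pred2 m t) b by rewrite mem_filter tb /= eqxx orbT.
    by rewrite eb.
  - by rewrite -(count_pred2 (i := m) (j := t)) ?inE ?eqxx // ea count_pred2 ?inE ?eqxx.
have [|a [b [d [e1 mb tb ca]]]] := D t1; first by lia.
have [|a' [b' [d' [e2 mb' tb' ca']]]] := D t2; first by lia.
have [_ ebd] : a = a' /\ b ++ m :: d = b' ++ m :: d'.
  by apply: (@cat_cons_count_inj _ _ _ _ m); [rewrite -e1 | rewrite ca].
have [eb _] : b = b' /\ d = d'.
  by apply: (@cat_cons_count_inj _ _ _ _ m) => //; rewrite (count_memPn mb) (count_memPn mb').
have g : gap m b p by exists a, d.
have /hasP[y yb my] := g1 _ g.
have /(allP ap) /andP[_ yt] : y \in p by exact: (gap_sub g).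
have [ey|ey] : y = t1 \/ y = t2 by move: my yt; clear; lia.
  by rewrite -ey yb in tb.
by rewrite -eb -ey yb in tb'.
Qed.

Lemma finD_sound v s p : all (fun y => 0 < y <= t2) v -> run m v s ->
  p \in finD m s -> peq (matD m) (ge_word m v) p ->
  forall i b, gap i b v -> 2 <= count (nb (matD m) i) b.
Proof.
move=> av rv hp pv i b g.
have [ap cp] := finD_spec hp.
have av' : all (fun y => m <= y <= t2) (ge_word m v).
  by apply/allP => y; rewrite mem_filter => /andP[my /(allP av)]; lia.
have [G1 G2] := fork_gaps_peq ap av' (peq_sym pv) (finD_gaps hp).
have /andP[i0 iN] : 0 < i <= t2.
  by case: g => a [d [e _]]; apply: (allP av); rewrite e mem_cat mem_head orbT.
case: (ltngtP i m) => im.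
- by rewrite count_nbD_low ?(run_gap rv) ?i0.
- rewrite count_nbD_top ?im //.
  have Pi : (fun y => m <= y) i by exact: ltnW.
  have := G2 i _ im (gap_filter Pi g).
  suff -> : count_mem m [seq y <- b | m <= y] = count_mem m b by [].
  rewrite count_filter; apply: eq_count => y /=.
  by case: eqP => // ->; rewrite leqnn.
subst i; rewrite count_nbD_m //.
case: s {cp} rv hp => [h|] rv hp.
  have := run_gap_top m0 rv g; rewrite -has_pred1 has_count => h1.
  have Pm : (fun y => m <= y) m by exact: leqnn.
  have /hasP[y] := G1 _ (gap_filter Pm g); rewrite mem_filter => /andP[_ yb] my.
  have /(allP av) /andP[_ yN] : y \in v by exact: (gap_sub g).
  have c1 : 0 < count_mem t1 b + count_mem t2 b.
    have : 0 < count_mem y b by rewrite -has_count has_pred1.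
    have [->|->] : y = t1 \/ y = t2 by move: my yN => /=; clear; lia.
      by move=> h2; rewrite addn_gt0 h2.
    by move=> h2; rewrite addn_gt0 h2 orbT.
  exact: (leq_add h1 c1).
move: hp; rewrite inE => /eqP ep.
have C t : m < t <= t2 -> 0 < count_mem t b.
  move=> mt'; have := pv m t (matD_top m0 mt').
  have -> : filter (pred2 m t) (ge_word m v) = filter (pred2 m t) v.
    rewrite -filter_predI; apply: eq_filter => y /=.
    by case: (eqVneq y m) => [->|_] /=; [rewrite leqnn | case: eqP => //= ->; rewrite ltnW //; case/andP: mt'].
  have Pm : pred2 m t m by rewrite /= eqxx.
  have mnt : m != t by lia.
  have -> : filter (pred2 m t) p = m :: rcons [:: t] m.
    rewrite ep /= eqxx /=; have [->|->] : t = t1 \/ t = t2 by lia.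
      by rewrite eqxx orbT tm2 t21.
    by rewrite tm1 t12 eqxx orbT.
  move=> e; have := gap_filter Pm g; rewrite e => /gap_ends; rewrite inE => /(_ mnt) eb.
  rewrite -has_count has_pred1.
  have : t \in filter (pred2 m t) b by rewrite eb mem_head.
  by rewrite mem_filter => /andP[].
have h1 : 0 < count_mem t1 b by apply: C; lia.
have h2 : 0 < count_mem t2 b by apply: C; lia.
exact: (leq_trans (leq_add h1 h2) (leq_addl _ _)).
Qed.
End ForkFinal.

Lemma labD_234 i j : [|| labD i j == 2, labD i j == 3 | labD i j == 4].
Proof. by rewrite /labD; case: ifP. Qed.

Lemma matD_node m (i j : 'I_m.+2) : 0 < m -> matD m (node i) (node j) = coxD m.+2 i j.
Proof.
move=> m0; have := ltn_ord i; have := ltn_ord j.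
rewrite /matD /node /= /diagram_m /labD => hj hi.
have -> : (m.+2 - i == m.+2 - j) = (i == j) by rewrite -val_eqE /=; lia.
case: eqP => // e; have {}e : (i : nat) <> j by move=> h; apply: e; exact: val_inj.
congr (if _ then _ else _); rewrite /adjD; lia.
Qed.

Theorem FC_series_D m : 0 < m -> FC_series (coxD m.+2) =
  (\sum_(us <- tails m) fpsX int ^+ size us.1 *
    \sum_(p <- finD m us.2) fpsX int ^+ count (fun y => m < y)%N p)%R.
Proof.
move=> m0.
apply: (FC_series_engine (f := @node m.+2) (mat := matD m) (N := m.+2)) => //.
- by rewrite ltnW.
- exact: node_inj.
- by move=> i j; exact: matD_node.
- exact: codom_node.
- exact: matD_diag.
- exact: matD_ge2.
- by move=> o i j; exact: matD_split.
- by move=> o; exact: matD_succ.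
- by move=> i j c ij c0; exact: (diagram_order labD_234).
- by move=> s p; exact: finD_spec.
- exact: finD_uniq.
- move=> s p p' hp hp'; have [ap _] := finD_spec hp; have [ap' _] := finD_spec hp'.
  exact: (canonical_peq m0 ap ap' (finD_canonical hp) (finD_canonical hp')).
- move=> v s p av rv hp e; suff fv : fc_word (matD m) v by exact: fv.
  apply/(fc_gapD m0) => w vw; apply: (finD_sound m0 (s := s) (p := p)) => //.
  + by rewrite -(eq_all_r (perm_mem (peq_perm (matD_diag m) vw))).
  + exact: (run_peq (matD_succ m0) (leqnn m) vw).
  + by apply: (peq_trans (v := ge_word m v)) => //; apply: peq_filter; exact: peq_sym.
- move=> u au fu.
  have gu := proj1 (fc_gapD m0 u) fu u (@peq_refl _ (matD m) u).
  have [s r ok] := runD_exists m0 au gu.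
  have au' : all (fun y => m <= y <= m.+2) (ge_word m u).
    by apply/allP => y; rewrite mem_filter => /andP[my /(allP au)]; lia.
  have [p hp up] := finD_complete m0 au' (fork_gapsD m0 au gu).
  have em : count_mem m (ge_word m u) = count_mem m u.
    rewrite count_filter; apply: eq_count => y /=.
    by case: eqP => // ->; rewrite leqnn.
  rewrite em in hp.
  case: s r ok => [h|] r [e _]; first by exists (Some h), p; rewrite e in hp.
  move=> [b g nm].
  have [c2 ct1 ct2] := gapD_peak_counts m0 au gu g nm.
  exists None, [:: m; m.+1; m.+2; m]; split=> //; first exact: mem_head.
  case: (g) => a [d [eu mb]].
  have [ma _ md] : [/\ m \notin a, m \notin b & m \notin d].
    by move: c2; rewrite eu => /count_gap2.
  have N t : m < t <= m.+2 -> count_mem t u = 1 -> [/\ t \notin a, t \notin d & count_mem t b = 1].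
    move=> mt ct; have tb := gapD_peak m0 au gu g nm mt.
    have mt' : (m == t) = false by move: mt; clear; lia.
    have E (x z : nat) : x + (0 + (1 + (0 + z))) = 1 -> x = 0 /\ z = 0 by clear; lia.
    move: ct; rewrite eu count_cat /= count_cat /= tb mt'.
    by move=> /E[/count_memPn ta /count_memPn td].
  have [|ta1 td1 tb1] := N _ _ ct1; first by clear; lia.
  have [|ta2 td2 tb2] := N _ _ ct2; first by clear; lia.
  have F (w : seq nat) : {subset w <= u} -> m \notin w -> m.+1 \notin w -> m.+2 \notin w -> ge_word m w = [::].
    move=> wu n0 n1 n2; apply: filter_none => y yw; apply/negP => my.
    have /andP[_ yN] := allP au _ (wu _ yw).
    have [ey|[ey|ey]] : y = m \/ y = m.+1 \/ y = m.+2 by move: my yN; clear; lia.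
    - by rewrite -ey yw in n0.
    - by rewrite -ey yw in n1.
    - by rewrite -ey yw in n2.
  have -> : ge_word m u = m :: ge_word m b ++ [:: m].
    have := F a; have := F d; rewrite /ge_word eu filter_cat /= leqnn filter_cat /= leqnn.
    move=> -> //; last by move=> y yd; rewrite mem_cat inE mem_cat inE yd !orbT.
    by move=> -> // y ya; rewrite mem_cat ya.
  apply: peq_cons; rewrite -[[:: m.+1; m.+2; m]]/([:: m.+1; m.+2] ++ [:: m]).
  apply: peq_cat => //.
  have ab : all (pred2 m.+1 m.+2) (ge_word m b).
    apply/allP => y; rewrite mem_filter => /andP[my yb] /=.
    have /(allP au) /andP[_ yN] : y \in u by exact: (gap_sub g).
    have : y != m by apply: contraNneq mb => <-.
    by move: my yN; clear; lia.
  have C t : m < t -> count_mem t (ge_word m b) = count_mem t b.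
    move=> mt; rewrite count_filter; apply: eq_count => y /=.
    by case: eqP => // ->; rewrite ltnW.
  have sz : size (ge_word m b) = 2.
    have := C m.+1 (ltnSn m); have := C m.+2 (ltnW (ltnSn m.+1)); rewrite tb1 tb2.
    move: ab; rewrite all_count => /eqP <- h1 h2.
    by rewrite (count_disjoint (a := pred1 m.+1) (b := pred1 m.+2)) ?h1 ?h2 // => y /=; clear; lia.
  have := C m.+1 (ltnSn m); rewrite tb1; case: (ge_word m b) sz ab => [|x [|y []]] //= _.
  move=> /and3P[/orP[]/eqP -> /orP[]/eqP -> _] h; apply: peq_tops => //; move: h; rewrite /tops; clear; lia.
Qed.

(** * Recurrences for the words of the automaton *)

Local Open Scope ring_scope.

Definition tail_sum m (phi : state -> fps int) : fps int :=
  \sum_(us <- tails m) X ^+ size us.1 * phi us.2.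

(** The transfer matrix of the automaton acting on functions of the state; 1, 2, 1 are the numbers
    of doublings at heights 0, 1, 2. *)
Definition step_sum (phi : state -> fps int) (s : state) : fps int :=
  if s is Some h then
    X ^+ h.+1 * phi (Some h.+1) + X ^+ h * phi (Some h) +
    (if h is h'.+1 then X ^+ h * phi (Some h) + X ^+ h' * phi (Some h') else 0) +
    (match h with 0%N => 1 | 1%N => 2 | 2%N => 1 | _ => 0 end) * (X ^+ 2 * phi None)
  else X ^+ 2 * phi None.

Lemma sum_alts m h (g : nat -> fps int) :
  \sum_(z <- alts m m.+1 h) g z.2 =
  g h.+1 + g h + (if h is h'.+1 then g h + g h' else 0).
Proof.
by case: h => [|h]; rewrite /alts !(big_cat, big_cons, big_nil) /= ?big_cons ?big_nil ?addr0 ?addrA.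
Qed.

Lemma sum_trans m s phi :
  \sum_(z <- trans m s) X ^+ ht z.2 * phi z.2 = step_sum phi s.
Proof.
case: s => [h|]; rewrite /trans; last by rewrite big_seq1.
rewrite big_cat !big_map /= (sum_alts m h (fun k => X ^+ k * phi (Some k))); congr (_ + _).
case: h => [|[|[|h]]]; rewrite ?(big_cons, big_nil, big_seq1) /=; ring.
Qed.

Lemma tail_sum_ext m phi psi : phi =1 psi -> tail_sum m phi = tail_sum m psi.
Proof. by move=> e; apply: eq_bigr => us _; rewrite e. Qed.

Lemma tail_sumD m phi psi :
  tail_sum m (fun s => phi s + psi s) = tail_sum m phi + tail_sum m psi.
Proof. by rewrite -big_split; apply: eq_bigr => us _; rewrite mulrDr. Qed.

Lemma tail_sumZ m a phi : tail_sum m (fun s => a * phi s) = a * tail_sum m phi.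
Proof. by rewrite mulr_sumr; apply: eq_bigr => us _; rewrite mulrCA. Qed.

Lemma tail_sum0 phi : tail_sum 0 phi = phi (Some 0%N).
Proof. by rewrite /tail_sum big_seq1 mul1r. Qed.

Lemma tail_sumS m phi : tail_sum m.+1 phi = tail_sum m (step_sum phi).
Proof.
rewrite /tail_sum [tails m.+1]/= big_allpairs_dep [LHS]big_seq [RHS]big_seq.
apply: eq_bigr => -[u s] hu; rewrite -(sum_trans m) mulr_sumr [LHS]big_seq [RHS]big_seq.
apply: eq_bigr => -[p s'] hp; rewrite mulrA -exprD; congr (_ ^+ _ * _).
have [au _ cu] := tails_spec hu; have [ap cp cp'] := trans_spec hp.
have lu : all (fun y => y <= m)%N u by apply: sub_all au => y /andP[].
rewrite /= size_weave ?(trans_le hp) // ?cu //; congr addn.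
by rewrite -cp'; apply: eq_in_count => y /(allP ap) /=; clear; lia.
Qed.

Definition at_state (s0 s : state) : fps int := (s == s0)%:R.

Definition tail_alt m h := tail_sum m (at_state (Some h)).
Definition tail_peak m := tail_sum m (at_state None).

Lemma tail_alt0 h : tail_alt 0 h = (h == 0%N)%:R.
Proof. by rewrite /tail_alt tail_sum0 /at_state eq_sym. Qed.

Lemma tail_peak0 : tail_peak 0 = 0.
Proof. by rewrite /tail_peak tail_sum0. Qed.

Lemma expX_eq (a b : nat) : X ^+ a * (a == b)%:R = X ^+ b * (a == b)%:R.
Proof. by case: eqP => [->|_]; rewrite ?mulr0. Qed.

Lemma tail_altS m h : tail_alt m.+1 h =
  X ^+ h * ((if h is h'.+1 then tail_alt m h' + tail_alt m h else 0) +
            tail_alt m h + tail_alt m h.+1).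
Proof.
rewrite /tail_alt tail_sumS.
have E s : step_sum (at_state (Some h)) s =
  X ^+ h * ((if h is h'.+1 then at_state (Some h') s + at_state (Some h) s else 0) +
            at_state (Some h) s + at_state (Some h.+1) s).
  case: s => [k|]; rewrite /step_sum /at_state /=; last by case: h => *; rewrite !mulr0n; ring.
  have S (a b : nat) : (Some a == Some b :> state) = (a == b) by [].
  rewrite !S mulr0 mulr0 addr0 !expX_eq.
  case: h => [|h].
    by case: k => [|k]; rewrite ?eqxx ?eqSS /= ?expX_eq ?mulr0n; ring.
  case: k => [|k]; rewrite ?eqSS /= ?expX_eq ?mulr0n; first by ring.
  by rewrite !S; ring.
rewrite (tail_sum_ext _ E) tail_sumZ !tail_sumD; congr (_ * (_ + _ + _)).
case: h {E} => [|h]; last by rewrite tail_sumD.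
by rewrite /tail_sum big1 // => us _; rewrite mulr0.
Qed.

(** Doubling the only letter m+1 of an alternating word yields precisely the doublings, at the cost
    of one factor X. *)
Lemma tail_peakS m : tail_peak m.+1 = X * tail_alt m.+1 1 + X ^+ 2 * tail_peak m.
Proof.
rewrite tail_altS /tail_peak tail_sumS /tail_alt.
have E s : step_sum (at_state None) s = X ^+ 2 * (at_state (Some 0%N) s +
  (at_state (Some 1%N) s + at_state (Some 1%N) s) + at_state (Some 2%N) s + at_state None s).
  case: s => [k|]; rewrite /step_sum /at_state /=; last by rewrite !mulr0n; ring.
  by case: k => [|[|[|k]]] /=; rewrite ?mulr0n ?mulr1n; ring.
by rewrite (tail_sum_ext _ E) tail_sumZ !tail_sumD; ring.
Qed.

(** The height grows by at most one per letter. This makes the sums over heights finite, and the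
    series of height h divisible by x^h. *)
Lemma tails_height m u h : (u, Some h) \in tails m -> (h <= m)%N.
Proof.
elim: m u h => [|m ih] u h; first by rewrite inE => /eqP[_ ->].
move=> /allpairsPdep[[w s] [[p s'] [hw hp [_ es]]]].
rewrite /= in hp; have mm : m != m.+1 by lia.
case: s hw hp => [k|] hw; rewrite /trans -es; last by rewrite inE xpair_eqE andbF.
rewrite mem_cat => /orP[] /mapP[] // [p0 k0] hp [_ ->].
have := ih _ _ hw; have := map_f snd hp.
by clear; case: k => [|k]; rewrite /alts /= !inE; lia.
Qed.

Lemma tail_alt_gt m h : (m < h)%N -> tail_alt m h = 0.
Proof.
move=> mh; rewrite /tail_alt /tail_sum big_seq big1 // => -[u s] hu /=.
rewrite /at_state; case: eqP => [es|_]; last by rewrite mulr0.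
by rewrite es in hu; have := tails_height hu; rewrite leqNgt mh.
Qed.

Lemma tail_sum_isSome m :
  tail_sum m (fun s => (s != None)%:R) = \sum_(h < m.+1) tail_alt m h.
Proof.
rewrite /tail_alt /tail_sum exchange_big /= big_seq [RHS]big_seq; apply: eq_bigr => -[u s] hu.
rewrite -mulr_sumr; congr (_ * _) => /=; case: s hu => [k|] hu /=.
  have km : (k < m.+1)%N by rewrite ltnS (tails_height hu).
  rewrite (bigD1 (Ordinal km)) //= /at_state eqxx big1 ?addr0 // => i ik.
  rewrite (_ : (Some k == Some (i : nat)) = false) //.
  by apply/negbTE; apply: contra ik => /eqP[e]; apply/eqP/val_inj.
by rewrite big1.
Qed.

(** The end of the diagram acts as one more step of the automaton into alternating states; only the
    closing of a peak, with weight X, is extra. *)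
Lemma sum_finB m s :
  \sum_(p <- finB m s) X ^+ count (fun y => m < y)%N p =
  step_sum (fun s => (s != None)%:R) s + X * at_state None s.
Proof.
have mm : m != m.+1 by lia.
case: s => [h|]; rewrite /finB; last first.
  by rewrite big_seq1 /= ltnn ltnSn /= /at_state eqxx /=; ring.
rewrite big_map (eq_big_seq (fun z => X ^+ z.2)); last first.
  move=> z /(alts_spec mm)[az _ <- _]; congr (_ ^+ _).
  by apply: eq_in_count => y /(allP az) /=; clear; lia.
rewrite (sum_alts m h (fun k => X ^+ k)) /step_sum /at_state /= mulr0n.
by case: h => [|h]; rewrite ?mulr1n; ring.
Qed.

Lemma sum_finA m s :
  \sum_(p <- finA m s) X ^+ count (fun y => m < y)%N p =
  step_sum (fun s => at_state (Some 0%N) s + at_state (Some 1%N) s) s.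
Proof.
have mm : m != m.+1 by lia.
case: s => [h|]; rewrite /finA; last by rewrite big_nil /= /at_state /= ?mulr0n; ring.
rewrite big_map big_filter big_mkcond.
rewrite (eq_big_seq (fun z => if (z.2 <= 1)%N then X ^+ z.2 else 0)); last first.
  move=> z /(alts_spec mm)[az _ <- _]; case: ifP => // _; congr (_ ^+ _).
  by apply: eq_in_count => y /(allP az) /=; clear; lia.
rewrite (sum_alts m h (fun k => if (k <= 1)%N then X ^+ k else 0)) /step_sum /at_state /=.
case: h => [|[|[|h]]] /=; rewrite ?mulr0n ?mulr1n; ring.
Qed.

(** A positive height counts twice, for the choice of the first top. The adjacent tops give X^2
    where height 1 gives X, hence the additional factor X there. *)
Lemma sum_finD m s :
  \sum_(p <- finD m s) X ^+ count (fun y => m < y)%N p =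
  step_sum (fun s => 2 * (s != None)%:R - at_state (Some 0%N) s + X * at_state (Some 1%N) s) s
  + X ^+ 2 * at_state None s.
Proof.
have mm : m != m.+1 by lia.
case: s => [h|]; rewrite /finD; last first.
  by rewrite big_seq1 /= ltnn ltnSn (ltnW (ltnSn m.+1)) /= /at_state /= ?mulr0n ?mulr1n; ring.
have t12 : tops m m.+1 m.+2 by rewrite /tops !eqxx.
have t21 : tops m m.+2 m.+1 by rewrite /tops !eqxx orbT.
have C z : z \in alts m m.+1 h ->
  [/\ count (fun y => m < y)%N (fork_alt m m.+1 m.+2 z.1) = z.2,
      count (fun y => m < y)%N (fork_alt m m.+2 m.+1 z.1) = z.2 &
      count (fun y => m < y)%N (fork_both m z.1) = z.2.*2].
  move=> /(alts_spec mm)[az _ <- _].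
  have [_ ->] := count_fork_alt t12 az; have [_ ->] := count_fork_alt t21 az.
  by have [_ ->] := count_fork_both az.
move: (alts m m.+1 h) (sum_alts m h) C => L SA C.
rewrite !big_cat !big_map !big_filter /= [X in _ + (X + _)]big_mkcond [X in _ + (_ + X)]big_mkcond /=.
have -> : \sum_(z <- L) X ^+ count (fun y => m < y)%N (fork_alt m m.+1 m.+2 z.1) =
    \sum_(z <- L) X ^+ z.2 by apply: eq_big_seq => z /C[->].
have -> : \sum_(z <- L) (if (0 < z.2)%N then
      X ^+ count (fun y => m < y)%N (fork_alt m m.+2 m.+1 z.1) else 0) =
    \sum_(z <- L) (if (0 < z.2)%N then X ^+ z.2 else 0).
  by apply: eq_big_seq => z /C[_ ->].
have -> : \sum_(z <- L) (if z.2 == 1%N then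
      X ^+ count (fun y => m < y)%N (fork_both m z.1) else 0) =
    \sum_(z <- L) (if z.2 == 1%N then X ^+ 2 else 0).
  by apply: eq_big_seq => z /C[_ _ ->]; case: eqP => // ->.
rewrite (SA (fun k => X ^+ k)).
rewrite (SA (fun k => if (0 < k)%N then X ^+ k else 0)).
rewrite (SA (fun k => if k == 1%N then X ^+ 2 else 0)).
rewrite /step_sum /at_state /=.
by case: h {C SA} => [|[|[|h]]] /=; rewrite ?mulr0n ?mulr1n; ring.
Qed.

Lemma FC_series_ord0 (M : coxMatrix 'I_0) : FC_series M = 1.
Proof.
pose fin (s : state) : seq (seq nat) := if s is Some 0%N then [:: [::]] else [::].
have nilP (u : seq nat) : all (fun y => 0 < y <= 0)%N u -> u = [::].
  by case: u => //= y u /andP[]; lia.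
rewrite (FC_series_engine (f := fun i : 'I_0 => 0%N) (mat := matL 0 3) (m := 0%N) (N := 0%N) (fin := fin)).
- by rewrite big_seq1 big_seq1 mul1r.
- by [].
- by case.
- by case.
- by move=> y; apply/codomP/idP => [[[]]|] //; lia.
- exact: matL_diag.
- exact: matL_ge2.
- by move=> o i j; exact: matL_split.
- by [].
- by case.
- by case=> [[|h]|] p //; rewrite inE => /eqP ->.
- by case=> [[|h]|].
- by case=> [[|h]|] p p' //; rewrite !inE => /eqP -> /eqP ->.
- move=> v s p /nilP -> _ _ _; split=> [a b i|a b i j ij _].
    by move=> /(congr1 size); rewrite !size_cat /=; lia.
  move=> /(congr1 size); rewrite !size_cat size_altw.
  by have := @matL_ge2 0 3 isT _ _ ij; rewrite /=; lia.
- by move=> u /nilP -> _; exists (Some 0%N), [::].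
Qed.

Lemma A_FC_tail n : A_FC n = tail_alt n 0 + tail_alt n 1.
Proof.
case: n => [|m]; first by rewrite /A_FC FC_series_ord0 !tail_alt0 addr0.
rewrite /A_FC FC_series_A /tail_alt -tail_sumD tail_sumS.
by apply: eq_bigr => us _; rewrite sum_finA.
Qed.

Lemma B_FC_tail n : B_FC n = \sum_(h < n.+1) tail_alt n h +
  (if n is m.+1 then X * tail_peak m else 0).
Proof.
case: n => [|m]; first by rewrite /B_FC FC_series_ord0 big_ord1 tail_alt0 addr0.
rewrite /B_FC FC_series_B -tail_sum_isSome tail_sumS /tail_peak -tail_sumZ -tail_sumD.
by apply: eq_bigr => us _; rewrite sum_finB.
Qed.

(** The conventions for D_1 and D_2 are the values of the formula at n = 0 and n = 1, checked
    directly; the fork takes over from n = 2. *)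
Lemma D_FC_tail n : D_FC n.+1 = 2 * \sum_(h < n.+1) tail_alt n h -
  tail_alt n 0 + X * tail_alt n 1 + (if n is m.+1 then X ^+ 2 * tail_peak m else 0).
Proof.
case: n => [|[|m]].
- by rewrite /D_FC big_ord1 !tail_alt0 /=; ring.
- by rewrite /D_FC !big_ord_recl big_ord0 /bump /= !tail_altS tail_peak0 /= !tail_alt0 /=; ring.
rewrite /D_FC FC_series_D // -tail_sum_isSome /tail_peak /tail_alt -mulN1r -!tail_sumZ.
rewrite -!tail_sumD tail_sumS -tail_sumD.
apply: eq_bigr => us _; rewrite sum_finD; congr (_ * (_ + _)).
congr step_sum; apply/funext => s; by rewrite mulN1r.
Qed.

(** * Sums of formal power series *)

Section FpsSum.
Variable R : comNzRingType.
Implicit Types (F G : nat -> fps R) (g : fps R).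

Definition summable F := forall n k, (k < n)%N -> fcoef (F n) k = 0.

Lemma summableM F G : summable F -> summable (fun n => G n * F n).
Proof.
move=> sF n k kn; rewrite fcoefM big1 // => i _.
by rewrite sF ?mulr0 //; apply: leq_ltn_trans kn; exact: leq_subr.
Qed.

Lemma summable_exp g (G : nat -> fps R) : fcoef g 0 = 0 -> summable (fun n => g ^+ n * G n).
Proof.
move=> g0 n k kn; rewrite fcoefM big1 // => i _.
rewrite fcoef_exp_small ?mul0r //.
apply: leq_ltn_trans kn; by rewrite -ltnS.
Qed.

Lemma fps_sum_ext F G : F =1 G -> fps_sum F = fps_sum G.
Proof. by move=> e; apply/fpsP => n /=; apply: eq_bigr => i _; rewrite e. Qed.

Lemma fps_sumD F G : fps_sum (fun n => F n + G n) = fps_sum F + fps_sum G.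
Proof. by apply/fpsP => n; rewrite fcoefD /= -big_split. Qed.

Lemma fps_sumZ F g : summable F -> fps_sum (fun n => g * F n) = g * fps_sum F.
Proof.
move=> sF; apply/fpsP => m; rewrite (fps_sumE (summableM (fun=> g) sF) (leqnn m)).
rewrite -mulr_sumr !fcoefM; apply: eq_bigr => i _; congr (_ * _).
by rewrite (fps_sumE (N := m) sF) // leq_subr.
Qed.

Lemma fps_sum_shift F : F 0%N = 0 -> summable F -> fps_sum F = fps_sum (fun n => F n.+1).
Proof.
move=> F0 sF; apply/fpsP => m /=; rewrite big_ord_recl F0 fcoef0 add0r [RHS]big_ord_recr /=.
by rewrite (sF m.+1) // addr0.
Qed.

Lemma fps_sum_diag (c : nat -> nat -> fps R) :
  (forall h k n, (n < h + k)%N -> fcoef (c h k) n = 0) ->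
  fps_sum (fun h => fps_sum (c h)) = fps_sum (fun n => \sum_(k < n.+1) c (n - k)%N k).
Proof.
move=> c0; apply/fpsP => m /=.
transitivity (\sum_(0 <= h < m.+1) \sum_(0 <= k < m.+1) fcoef (c h k) m).
  by rewrite big_mkord; apply: eq_bigr => h _; rewrite big_mkord.
transitivity (\sum_(0 <= n < m.+1) \sum_(0 <= k < m.+1 | (k <= n)%N) fcoef (c (n - k)%N k) m);
  last first.
  rewrite big_mkord; apply: eq_bigr => n _; rewrite fcoef_sum -(big_mkord xpredT (fun k => fcoef (c (n - k)%N k) m)).
  rewrite [RHS](big_nat_widen _ _ m.+1) ?ltn_ord //; apply: eq_bigl => k.
rewrite exchange_big [RHS](exchange_big_dep_nat xpredT) //=.
apply: eq_big_nat => k /andP[_ km].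
have -> : \sum_(0 <= n < m.+1 | (k <= n)%N) fcoef (c (n - k)%N k) m =
    \sum_(k <= n < m.+1) fcoef (c (n - k)%N k) m by rewrite [RHS](big_nat_widenl k 0).
rewrite -{2}[k]add0n [RHS]big_addn.
rewrite (@big_cat_nat _ _ _ (m.+1 - k)) //=; last by rewrite leq_subr.
rewrite [X in _ + X]big_nat_cond [X in _ + X]big1 ?addr0.
  by apply: eq_bigr => h _; rewrite addnK.
move=> h; rewrite andbT => /andP[kh _]; apply: c0; lia.
Qed.
End FpsSum.

(** * Solution of the recurrences *)

Lemma divr_eq_cross (R : comUnitRingType) (a b u v : R) :
  u \is a GRing.unit -> v \is a GRing.unit -> a * v = b * u -> a / u = b / v.
Proof.
move=> uu uv e; apply: (mulIr uu); rewrite mulrVK // mulrAC; apply: (mulIr uv).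
by rewrite mulrVK.
Qed.

(** * Identities between summands, with inverses abstracted for [ring] *)

Section TermIdentities.
Variable R : comUnitRingType.
Implicit Types y z q Y C Q U V W : R.

(** The n-th summand of [theta_J_step]: Y = (-y)^n, C = q^C(n,2), Q = q^n, and U, V, W are (q;q)_n,
    (yq;q)_n, (yq^2;q)_n. *)
Lemma theta_J_term y q Y C Q U V W :
  U \is a GRing.unit -> V \is a GRing.unit -> W \is a GRing.unit ->
  V * (1 - y * q * Q) = (1 - y * q) * W ->
  (1 - y * q) * (Y * (C * Q) / (U * V)) =
  Y * Q * C / (U * W) + - (y * q) * (Y * Q * (C * Q) / (U * W)).
Proof.
move=> uU uV uW e.
have key : (1 - y * q) / V = (1 - y * q * Q) / W.
  by apply: divr_eq_cross; rewrite // -e mulrC.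
rewrite !invrM //; move: key; move: U^-1 V^-1 W^-1 => iU iV iW key.
transitivity (Y * C * Q * iU * ((1 - y * q) * iV)); first by ring.
by rewrite key; ring.
Qed.

(** Compares term n+1 of theta(y) - J(y) with term n of J(yq); here z = yq. *)
Lemma theta_J_shift_term y z q Y C Q U W :
  U \is a GRing.unit -> W \is a GRing.unit ->
  1 - z \is a GRing.unit -> 1 - q * Q \is a GRing.unit ->
  - y * Y * (C * Q * (q * Q)) / (U * (1 - q * Q) * ((1 - z) * W)) +
  -1 * (- y * Y * (C * Q) / (U * (1 - q * Q) * ((1 - z) * W))) =
  y / (1 - z) * (Y * Q * C / (U * W)).
Proof.
move=> uU uW uz uQ; rewrite !invrM ?unitrM ?uU ?uW ?uz ?uQ //.
have key : (q * Q - 1) / (1 - q * Q) = -1 by rewrite -opprB mulNr divrr.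
move: key; move: (1 - q * Q)^-1 U^-1 (1 - z)^-1 W^-1 => a b c d key.
transitivity (- y * Y * C * Q * b * c * d * ((q * Q - 1) * a)); first by ring.
by rewrite key; ring.
Qed.

Lemma theta_rec_alg y z (J0 T0 T1 : R) : 1 - z \is a GRing.unit ->
  T0 = J0 + y / (1 - z) * ((1 - z) * T0 + z * T1) ->
  (1 - y) * T0 = J0 + y * z / (1 - z) * T1.
Proof.
move=> uz e; rewrite mulrBl mul1r {1}e mulrDr [y / _ * (_ * T0)]mulrA mulrVK //.
by move: (1 - z)^-1 => a; ring.
Qed.

End TermIdentities.

Lemma fcoefXM0 (R : comNzRingType) (f : fps R) : fcoef (fpsX R * f) 0 = 0.
Proof. by rewrite fcoefM big_ord1 /= mul0r. Qed.

Lemma fcoefXMS (R : comNzRingType) (f : fps R) n : fcoef (fpsX R * f) n.+1 = fcoef f n.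
Proof.
rewrite fcoefM !big_ord_recl /= mul0r add0r /bump /= add1n subn1 /= mul1r.
by rewrite big1 ?addr0 // => i _; rewrite !add1n mul0r.
Qed.

Lemma fcoefCM (R : comNzRingType) (a : R) (f : fps R) n : fcoef (fpsC a * f) n = a * fcoef f n.
Proof.
by rewrite fcoefM big_ord_recl subn0 big1 ?addr0 // => i _; rewrite /= mul0r.
Qed.

Lemma qXE h : q ^+ h = fpsC (fpsX int ^+ h).
Proof.
elim: h => [|h ih]; first by rewrite !expr0 fpsC1.
by rewrite !exprS ih fpsCM.
Qed.

Lemma unit_1sub (a : Zqx) : fcoef (fcoef a 0) 0 = 0 -> 1 - a \is a GRing.unit.
Proof.
by move=> a0; have := @qpoch_unit a 1 a0; rewrite /qpoch big_ord1 expr0 mulr1.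
Qed.

Lemma qpochS (a : Zqx) n : qpoch a n.+1 = qpoch a n * (1 - a * q ^+ n).
Proof. by rewrite /qpoch big_ord_recr. Qed.

Lemma qpochSl (a : Zqx) n : qpoch a n.+1 = (1 - a) * qpoch (a * q) n.
Proof.
rewrite /qpoch big_ord_recl expr0 mulr1; congr (_ * _); apply: eq_bigr => i _.
by rewrite lift0 exprS mulrA.
Qed.

Lemma qpochD (a : Zqx) m n : qpoch a (m + n) = qpoch a m * qpoch (a * q ^+ m) n.
Proof.
elim: n => [|n ih]; first by rewrite addn0 /qpoch big_ord0 mulr1.
by rewrite addnS !qpochS ih -mulrA -[a * q ^+ m * _]mulrA -exprD.
Qed.

Lemma bin2S n : 'C(n.+1, 2) = ('C(n, 2) + n)%N.
Proof. by rewrite binS bin1. Qed.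

Lemma exprNM (R : comNzRingType) (a b : R) n : (- (a * b)) ^+ n = (- a) ^+ n * b ^+ n.
Proof. by rewrite -mulNr exprMn. Qed.

Lemma bin2D h k : 'C((h + k).+1, 2) = ('C(h.+1, 2) + 'C(k.+1, 2) + h * k)%N.
Proof.
elim: k => [|k ih]; first by rewrite addn0 muln0 !addn0.
by rewrite addnS bin2S ih (bin2S k.+1); lia.
Qed.

Section Theta.

Definition theta (y : Zqx) : Zqx :=
  fps_sum (fun n => (- y) ^+ n * q ^+ 'C(n.+1, 2) / (qpoch q n * qpoch (y * q) n)).

Variable y : Zqx.
Hypothesis y0 : fcoef y 0 = 0.

Let uq n : qpoch q n \is a GRing.unit. Proof. by apply: qpoch_unit. Qed.

Lemma fcoef0_mul (a : Zqx) : fcoef (y * a) 0 = 0.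
Proof. by rewrite fcoef0M y0 mul0r. Qed.

Lemma qpochy_unit (a : Zqx) n : qpoch (y * a) n \is a GRing.unit.
Proof. by apply: qpoch_unit; rewrite fcoef0_mul. Qed.

Lemma y1_unit (a : Zqx) : 1 - y * a \is a GRing.unit.
Proof. by apply: unit_1sub; rewrite fcoef0_mul. Qed.

Lemma summable_pow (z : Zqx) (G H : nat -> Zqx) : fcoef z 0 = 0 ->
  summable (fun n => (- z) ^+ n * G n / H n).
Proof.
move=> z0 n k kn; rewrite -mulrA; have h := @summable_exp _ (- z) (fun n => G n / H n).
by apply: h kn; rewrite fcoefN z0 oppr0.
Qed.

Lemma theta_J_step : (1 - y * q) * theta y = J (y * q) - y * q * theta (y * q).
Proof.
have s1 : summable (fun n => (- y) ^+ n * q ^+ 'C(n.+1, 2) / (qpoch q n * qpoch (y * q) n)).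
  exact: summable_pow.
have s2 : summable (fun n => (- (y * q)) ^+ n * q ^+ 'C(n.+1, 2) / (qpoch q n * qpoch (y * q * q) n)).
  by apply: summable_pow; exact: fcoef0_mul.
rewrite /theta /J -(fps_sumZ (1 - y * q) s1) -[- (y * q * _)]mulNr -(fps_sumZ (- (y * q)) s2) -fps_sumD.
apply: fps_sum_ext => n; rewrite bin2S exprD exprNM.
have uW := qpochy_unit (q * q) n; rewrite mulrA in uW.
apply: (theta_J_term _ _ (uq n) (qpochy_unit q n) uW).
by rewrite -qpochS qpochSl.
Qed.

(** The numerators of theta and J differ by the factor q^n, and q^n - 1 cancels the last factor of
    (q;q)_n. The term n = 0 of the difference vanishes, so the index can be shifted. *)
Lemma theta_J : theta y = J y + y / (1 - y * q) * J (y * q).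
Proof.
apply/eqP; rewrite addrC -subr_eq; apply/eqP.
have s1 : summable (fun n => (- (y * q)) ^+ n * q ^+ 'C(n, 2) / (qpoch q n * qpoch (y * q * q) n)).
  by apply: summable_pow; exact: fcoef0_mul.
have s2 : summable (fun n => (- y) ^+ n * q ^+ 'C(n.+1, 2) / (qpoch q n * qpoch (y * q) n)).
  exact: summable_pow.
have s3 : summable (fun n => (- y) ^+ n * q ^+ 'C(n, 2) / (qpoch q n * qpoch (y * q) n)).
  exact: summable_pow.
rewrite /theta /J -(fps_sumZ (y / (1 - y * q)) s1) -[- fps_sum _]mulN1r -(fps_sumZ (-1) s3) -fps_sumD fps_sum_shift.
- apply: fps_sum_ext => n; rewrite (bin2S n.+1) exprD (bin2S n) exprD exprNM.
  rewrite (qpochSl (y * q)) (qpochS q) ![_ ^+ n.+1]exprS.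
  have uW := qpochy_unit (q * q) n; rewrite mulrA in uW.
  apply: (theta_J_shift_term _ _ _ (uq n) uW (y1_unit q)).
  by apply: unit_1sub; rewrite -exprS qXE fcoefXn.
- by rewrite (_ : 'C(1, 2) = 'C(0, 2)) // mulN1r subrr.
- by move=> n k kn; rewrite fcoefD (summableM (fun=> -1) s3) // s2 // addr0.
Qed.

Lemma theta_rec : (1 - y) * theta y = J y + y * (y * q) / (1 - y * q) * theta (y * q).
Proof.
have u1 := y1_unit q.
have e : J (y * q) = (1 - y * q) * theta y + y * q * theta (y * q) by rewrite theta_J_step; ring.
by have := theta_J; rewrite e; exact: theta_rec_alg (y1_unit q).
Qed.

End Theta.

Section MoreTermIdentities.
Variable R : comUnitRingType.
Implicit Types y z c : R.

Lemma level_rec_alg y z c (J0 T0 T1 T2 : R) : 1 - y \is a GRing.unit ->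
  (1 - y) * T0 = J0 - y * T1 -> (1 - y) * T1 = J0 + y * z / (1 - z) * T2 ->
  c * (y / (1 - y)) * T1 =
  y * (c * T0 + c * (y / (1 - y)) * T1 + c * (y / (1 - y)) * T1 +
       c * (y / (1 - y)) * (z / (1 - z)) * T2).
Proof.
move=> uy e0 e1.
have ea : (1 - y)^-1 = 1 + y / (1 - y).
  transitivity ((1 - y) / (1 - y) + y / (1 - y)); last by rewrite divrr.
  by move: (1 - y)^-1 => a; ring.
have {e0} -> : T0 = (J0 - y * T1) / (1 - y) by rewrite -e0 mulrC mulKr.
have e2 : T1 = (J0 + y * z / (1 - z) * T2) / (1 - y) by rewrite -e1 mulrC mulKr.
move: ea e2; move: (1 - y)^-1 (1 - z)^-1 => a b ea e2.
transitivity (y * (c * T1 * a)); first by ring.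
rewrite {1}ea; transitivity (y * (c * (T1 + y * a * T1))); first by ring.
by rewrite {1}e2; ring.
Qed.

Lemma level0_alg y z (J0 T0 T1 : R) :
  (1 - y) * T0 = J0 + y * z / (1 - z) * T1 -> T0 = J0 + y * (T0 + z / (1 - z) * T1).
Proof.
move=> e; transitivity ((1 - y) * T0 + y * T0); first by ring.
by rewrite e; move: (1 - z)^-1 => a; ring.
Qed.

Lemma antidiag_term (X1 X2 Q1 Q2 Q3 V W U S : R) :
  U \is a GRing.unit -> V \is a GRing.unit -> W \is a GRing.unit ->
  X1 * Q1 / V * (S * X2 * Q3 * Q2 / (U * W)) = X1 * X2 * (Q1 * Q2 * Q3) / (V * W) * (S / U).
Proof.
move=> uU uV uW; rewrite !invrM //; move: U^-1 V^-1 W^-1 => a b c; ring.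
Qed.

End MoreTermIdentities.

(** * The explicit solution and its uniqueness *)

Lemma fcoef_x0 : fcoef x 0 = 0. Proof. by []. Qed.

Lemma fcoef_xq0 h : fcoef (x * q ^+ h) 0 = 0.
Proof. exact: (fcoef0_mul fcoef_x0). Qed.

Definition level_coef h : Zqx := x ^+ h * q ^+ 'C(h.+1, 2) / qpoch (x * q) h.
Definition level h : Zqx := level_coef h * theta (x * q ^+ h).

Lemma level_coefS h : level_coef h.+1 =
  level_coef h * (x * q ^+ h.+1 / (1 - x * q ^+ h.+1)).
Proof.
rewrite /level_coef qpochS (bin2S h.+1) exprD (exprS x h) -[x * q * _]mulrA -(exprS q h).
have u1 := qpochy_unit fcoef_x0 q h; have u2 := y1_unit fcoef_x0 (q ^+ h.+1).
rewrite invrM //; move: (qpoch (x * q) h)^-1 (1 - x * q ^+ h.+1)^-1 => a b.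
move: (q ^+ h.+1) (q ^+ 'C(h.+1, 2)) (x ^+ h) => A B C.
ring.
Qed.

Lemma level_coef0 : level_coef 0 = 1.
Proof. by rewrite /level_coef /qpoch big_ord0 expr0 expr0 mulr1 divr1. Qed.

(** Both [theta_J_step] at x q^h and [theta_rec] at x q^(h+1) contain J(x q^(h+1)); eliminating it
    relates three consecutive values of theta. *)
Lemma levelS h : level h.+1 = x * q ^+ h.+1 * (level h + level h.+1 + level h.+1 + level h.+2).
Proof.
have e1 := theta_J_step (fcoef_xq0 h); have e2 := theta_rec (fcoef_xq0 h.+1).
have ey k : x * q ^+ k * q = x * q ^+ k.+1 by rewrite -mulrA -exprSr.
rewrite !ey in e1 e2.
rewrite /level (level_coefS h.+1) (level_coefS h).
exact: (level_rec_alg _ (y1_unit fcoef_x0 _) e1 e2).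
Qed.

(** No relation from a lower height is available to eliminate J(x), which takes the place of the
    initial term 1 and so becomes the common denominator. *)
Lemma level0 : level 0 = J x + x * (level 0 + level 1).
Proof.
have e := theta_rec fcoef_x0; rewrite /level level_coefS level_coef0 expr0 mulr1 !mul1r expr1.
exact: level0_alg e.
Qed.

(** The exponents combine by C(h+k+1,2) = C(h+1,2) + C(k+1,2) + hk, and (xq;q)_h (x q^(h+1);q)_k =
    (xq;q)_(h+k). Apart from (-1)^k / (q;q)_k, a term depends on h + k only. *)
Lemma K_levels : K x = fps_sum level.
Proof.
pose c h k : Zqx := x ^+ h * x ^+ k *
  (q ^+ 'C(h.+1, 2) * q ^+ 'C(k.+1, 2) * q ^+ (h * k)) /
  (qpoch (x * q) h * qpoch (x * q ^+ h * q) k) * ((-1) ^+ k / qpoch q k).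
have uq n : qpoch q n \is a GRing.unit by exact: qpoch_unit.
have cE h k : level_coef h * ((- (x * q ^+ h)) ^+ k * q ^+ 'C(k.+1, 2) /
    (qpoch q k * qpoch (x * q ^+ h * q) k)) = c h k.
  rewrite -mulN1r exprMn exprMn -exprM mulrA.
  apply: antidiag_term => //; first exact: qpochy_unit.
  by rewrite -mulrA; exact: qpochy_unit.
have E : level =1 fun h => fps_sum (c h).
  move=> h; rewrite /level /theta -(fps_sumZ (level_coef h)).
    by apply: fps_sum_ext => k; exact: cE.
  by apply: summable_pow; exact: fcoef_xq0.
rewrite (fps_sum_ext E) fps_sum_diag; last first.
  move=> h k n nhk; rewrite /c -exprD -!mulrA.
  exact: (@summable_exp _ x (fun=> _)).
apply: fps_sum_ext => n; rewrite mulr_sumr; apply: eq_bigr => k _.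
have kn : (k <= n)%N by rewrite -ltnS.
rewrite /c -exprD subnK // -!exprD -bin2D subnK // [x * q ^+ _ * q]mulrAC.
by rewrite -qpochD subnK.
Qed.

Definition alt_gf h : Zqx := Fps (fun n => tail_alt n h).
Definition peak_gf : Zqx := Fps tail_peak.

Lemma alt_gf_rec h : alt_gf h = (h == 0%N)%:R + x * (q ^+ h *
  ((if h is h'.+1 then alt_gf h' + alt_gf h else 0) + alt_gf h + alt_gf h.+1)).
Proof.
have c0 n : fcoef ((h == 0%N)%:R : Zqx) n = (if n is 0%N then (h == 0%N)%:R else 0).
  by case: (h == 0%N); [case: n | case: n].
apply/fpsP => -[|n]; rewrite fcoefD c0.
  by rewrite fcoefXM0 addr0; exact: tail_alt0.
rewrite add0r fcoefXMS qXE fcoefCM !fcoefD; rewrite [LHS]tail_altS; congr (_ * (_ + _ + _)).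
by case: h {c0}.
Qed.

(** Every right-hand side is a multiple of x, so the coefficients of x^n vanish by induction on n,
    for all heights at once. *)
Lemma fps_rec_eq0 (E : nat -> Zqx) :
  (forall h, E h = x * (q ^+ h * ((if h is h'.+1 then E h' + E h else 0) + E h + E h.+1))) ->
  forall h, E h = 0.
Proof.
move=> H h; apply/fpsP => n; rewrite fcoef0.
elim: n h => [|n ih] h; rewrite H ?fcoefXM0 // fcoefXMS qXE fcoefCM !fcoefD !ih.
by case: h => [|h]; rewrite ?fcoefD ?ih ?fcoef0 !addr0 mulr0.
Qed.

Lemma alt_gf_rec0 : alt_gf 0 = 1 + x * (alt_gf 0 + alt_gf 1).
Proof.
have := alt_gf_rec 0; rewrite expr0 eqxx.
by move: (alt_gf 0) (alt_gf 1) x => P0 P1 y e; rewrite {1}e mul1r add0r.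
Qed.

Lemma alt_gf_recS h : alt_gf h.+1 =
  x * (q ^+ h.+1 * (alt_gf h + alt_gf h.+1 + alt_gf h.+1 + alt_gf h.+2)).
Proof.
have := alt_gf_rec h.+1; rewrite /=.
by move: (alt_gf h) (alt_gf h.+1) (alt_gf h.+2) x (q ^+ h.+1) => P0 P1 P2 y z e; rewrite {1}e add0r.
Qed.

Lemma diff_rec0_alg (R : comNzRingType) (y L0 L1 P0 P1 J0 : R) :
  L0 = J0 + y * (L0 + L1) -> P0 = 1 + y * (P0 + P1) ->
  L0 - P0 * J0 = y * (1 * (0 + (L0 - P0 * J0) + (L1 - P1 * J0))).
Proof. by move=> eL eP; rewrite {1}eL {1}eP; ring. Qed.

Lemma diff_recS_alg (R : comNzRingType) (y z L0 L1 L2 P0 P1 P2 J0 : R) :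
  L1 = y * z * (L0 + L1 + L1 + L2) -> P1 = y * (z * (P0 + P1 + P1 + P2)) ->
  L1 - P1 * J0 = y * (z * ((L0 - P0 * J0) + (L1 - P1 * J0) + (L1 - P1 * J0) + (L2 - P2 * J0))).
Proof. by move=> eL eP; rewrite {1}eL {1}eP; ring. Qed.

Lemma level_alt_gf h : level h = alt_gf h * J x.
Proof.
apply/eqP; rewrite -subr_eq0; apply/eqP.
move: h; apply: (fps_rec_eq0 (E := fun h => level h - alt_gf h * J x)) => -[|h].
  by rewrite expr0; exact: diff_rec0_alg level0 alt_gf_rec0.
exact: diff_recS_alg (levelS h) (alt_gf_recS h).
Qed.

Lemma alt_gf_summable : summable alt_gf.
Proof. by move=> h n nh; exact: tail_alt_gt. Qed.

Lemma sum_alt_gf : fps_sum alt_gf = K x / J x.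
Proof.
have e : level =1 fun h => J x * alt_gf h by move=> h; rewrite level_alt_gf mulrC.
rewrite K_levels (fps_sum_ext e).
by rewrite fps_sumZ; [rewrite mulrC mulKr // J_unit | exact: alt_gf_summable].
Qed.

Lemma A_gfE : A_gf = alt_gf 0 + alt_gf 1.
Proof. by apply/fpsP => n; rewrite fcoefD /= A_FC_tail. Qed.

Lemma alt_gf0 : alt_gf 0 = 1 + x * A_gf.
Proof. by rewrite A_gfE; exact: alt_gf_rec0. Qed.

Lemma peak_gfE : peak_gf = q * alt_gf 1 + x * (q ^+ 2 * peak_gf).
Proof.
have e1 n : fcoef (q * alt_gf 1) n = fpsX int * tail_alt n 1 by exact: fcoefCM.
have e2 n : fcoef (q ^+ 2 * peak_gf) n = fpsX int ^+ 2 * tail_peak n.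
  by rewrite qXE; exact: fcoefCM.
apply/fpsP => -[|n]; rewrite fcoefD e1.
  by rewrite fcoefXM0 tail_alt0 mulr0 addr0; exact: tail_peak0.
by rewrite fcoefXMS e2; exact: tail_peakS.
Qed.

Lemma B_gfE : B_gf = fps_sum alt_gf + x * (q * peak_gf).
Proof.
apply/fpsP => n; rewrite fcoefD [LHS]B_FC_tail; congr (_ + _).
case: n => [|n]; first by rewrite fcoefXM0.
by rewrite fcoefXMS; exact/esym/fcoefCM.
Qed.

Lemma D_gfE : D_gf = 2 * fps_sum alt_gf - alt_gf 0 + q * alt_gf 1 + x * (q ^+ 2 * peak_gf).
Proof.
have e2 : (2 : Zqx) = fpsC 2 by apply/fpsP => -[|[|n]] //=; rewrite addr0.
apply/fpsP => n; rewrite 3!fcoefD fcoefN [LHS]D_FC_tail.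
rewrite e2 !fcoefCM; congr (_ + _).
case: n => [|n]; first by rewrite fcoefXM0.
by rewrite fcoefXMS qXE; exact/esym/fcoefCM.
Qed.

Section FinalIdentities.
Variable R : comUnitRingType.
Variables y z A B D P S pk j k r : R.
Hypotheses (uz : 1 - y * z \is a GRing.unit) (uz2 : 1 - y * z ^+ 2 \is a GRing.unit).
Hypotheses (eA : A = (1 - y * z)^-1 * r) (eP : P = (1 - y) * A - 1)
  (epk : pk = (1 - y * z ^+ 2)^-1 * (z * P)) (eS : S = k / j).

Lemma B_gf_alg : B = S + y * (z * pk) ->
  B = k / j + y * z ^+ 2 * (1 - y) / ((1 - y * z) * (1 - y * z ^+ 2)) * r
      - y * z ^+ 2 / (1 - y * z ^+ 2).
Proof.
rewrite epk eP eA eS invrM // => ->.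
by move: (k / j) (1 - y * z)^-1 (1 - y * z ^+ 2)^-1 => U a b; ring.
Qed.

Lemma D_gf_alg : D = 2 * S - (1 + y * A) + z * P + y * (z ^+ 2 * pk) ->
  D = 2 * k / j + (z - (1 + z) * y + y ^+ 2 * z ^+ 2) /
      ((1 - y * z) * (1 - y * z ^+ 2)) * r - z / (1 - y * z ^+ 2) - 1.
Proof.
have := mulVr uz2; rewrite epk eP eA eS invrM // => e ->; rewrite -(mulrA 2).
move: (k / j) (1 - y * z)^-1 (1 - y * z ^+ 2)^-1 e => U a b e.
apply/eqP; rewrite -subr_eq0; apply/eqP.
(* With b the inverse of 1 - y z^2, the difference of the two sides is a multiple of the relation
   defining b. *)
transitivity ((y * a * r - z * ((1 - y) * (a * r) - 1)) * (b * (1 - y * z ^+ 2) - 1)).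
  by ring.
by rewrite e subrr mulr0.
Qed.
End FinalIdentities.

(** By [level_alt_gf], A J(x) = theta(x) + xq / (1 - xq) theta(xq), and [theta_J_step] at x
    evaluates this sum. *)
Lemma A_gf_JE : A_gf = (1 - x * q)^-1 * (J (x * q) / J x).
Proof.
have e := theta_J_step fcoef_x0; have uJ := J_unit x; have u := y1_unit fcoef_x0 q.
rewrite A_gfE; apply: (mulIr uJ); rewrite mulrDl -!level_alt_gf mulrA mulrVK //.
apply: (mulrI u); rewrite mulVKr // mulrDr /level level_coefS level_coef0 expr0 mulr1 !mul1r expr1.
by rewrite e mulrA [_ * (_ / _)]mulrC mulrVK // subrK.
Qed.

Lemma alt_gf1E : alt_gf 1 = (1 - x) * A_gf - 1.
Proof.
have := alt_gf0; have := A_gfE; move: A_gf (alt_gf 0) (alt_gf 1) x => A P0 P1 y e0 e1.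
by rewrite mulrBl mul1r {1}e0 e1; ring.
Qed.

Lemma peak_gf_solve : peak_gf = (1 - x * q ^+ 2)^-1 * (q * alt_gf 1).
Proof.
apply: (mulrI (y1_unit fcoef_x0 (q ^+ 2))); rewrite (mulVKr (y1_unit fcoef_x0 (q ^+ 2))) mulrBl mul1r.
by apply/eqP; rewrite subr_eq -mulrA; apply/eqP; exact: peak_gfE.
Qed.

Theorem theorem3p1 :
  [/\ A_gf = 1 / (1 - x * q) * (J (x * q) / J x),
      B_gf = K x / J x
             + x * q ^+ 2 * (1 - x) / ((1 - x * q) * (1 - x * q ^+ 2))
               * (J (x * q) / J x)
             - x * q ^+ 2 / (1 - x * q ^+ 2)
    & D_gf = 2 * K x / J x
             + (q - (1 + q) * x + x ^+ 2 * q ^+ 2)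
               / ((1 - x * q) * (1 - x * q ^+ 2)) * (J (x * q) / J x)
             - q / (1 - x * q ^+ 2) - 1].
Proof.
have u1 := y1_unit fcoef_x0 q; have u2 := y1_unit fcoef_x0 (q ^+ 2).
have eD := D_gfE; rewrite alt_gf0 in eD.
split.
- by rewrite div1r; exact: A_gf_JE.
- exact: B_gf_alg u1 u2 A_gf_JE alt_gf1E peak_gf_solve sum_alt_gf B_gfE.
- exact: D_gf_alg u1 u2 A_gf_JE alt_gf1E peak_gf_solve sum_alt_gf eD.
Qed.
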